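(* Let $\beta>1$, $\boldsymbol\theta_0\in\Theta_1$, and $\mathbf X^n\sim P^{\rm CW}_{\boldsymbol\theta_0,\beta}$. Let $U_n\in\arg\min_{|u|\le1}\big[\frac{\beta u^2}2-\frac1n\sum_i\log\cosh(\beta u+\boldsymbol\theta_0^\top\mathbf X_i)\big]$. Then (i) $\sum_{i=1}^n\mathbf X_i\,\mathbb E^{\mathbb Q^{\rm CW}_{\boldsymbol\theta_0,\beta}}W_i=\sum_{i=1}^n\mathbf X_i\tanh(\beta U_n+\boldsymbol\theta_0^\top\mathbf X_i)+O_p(1)$; (ii) for $\mathbf h\in\mathbb R^d$ and $\boldsymbol\theta_n=\boldsymbol\theta_0+\mathbf h/\sqrt n$, $$\log\frac{dP^{\rm CW}_{\boldsymbol\theta_n,\beta}}{dP^{\rm CW}_{\boldsymbol\theta_0,\beta}}(\mathbf X^n)=\mathbf h^\top\tilde\Delta_{n,\boldsymbol\theta_0,\beta}-\tfrac12\mathbf h^\top I_\beta(\boldsymbol\theta_0)\mathbf h+o_p(1),$$ where $\tilde\Delta_{n,\boldsymbol\theta_0,\beta}=\sqrt n\big(\frac1n\sum_i\mathbf X_i\tanh(\beta U_n+\boldsymbol\theta_0^\top\mathbf X_i)-\boldsymbol\theta_0\big)\xrightarrow{d}N_d(0,I_\beta(\boldsymbol\theta_0))$ under $P^{\rm CW}_{\boldsymbol\theta_0,\beta}$. Hence $\{P^{\rm CW}_{\boldsymbol\theta,\beta}\}_{\boldsymbol\theta\in\Theta_1}$ is LAN at every $\boldsymbol\theta_0\in\Theta_1$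 with precision matrix $I_\beta(\boldsymbol\theta_0)$.
   Context: Curie–Weiss labels: $\mathbb Q^{\rm CW}_{0,\beta}(\mathbf z)\propto e^{n\beta\bar z^2/2}$ on $\{-1,1\}^n$, $\bar z=\frac1n\sum_iz_i$. Given $\mathbf Z^n$, the $\mathbf X_i$ are independent $N_d(\boldsymbol\theta Z_i,\mathbf I_d)$; $P^{\rm CW}_{\boldsymbol\theta,\beta}$ is the law of $\mathbf X^n$. Given $\mathbf X^n$, $\mathbb Q^{\rm CW}_{\boldsymbol\theta,\beta}(\mathbf w)\propto\exp(n\beta\bar w^2/2+\boldsymbol\theta^\top\sum_i\mathbf X_iw_i)$ on $\{-1,1\}^n$ and $\mathbb E^{\mathbb Q^{\rm CW}_{\boldsymbol\theta,\beta}}$ is expectation in $\mathbf W^n$ with $\mathbf X^n$ fixed. $\Theta_1$ is the lexicographically positive half-space of $\mathbb R^d\setminus\{0\}$. $m=m(\beta)>0$ solves $m=\tanh(\beta m)$; $\mathbb E_{\boldsymbol\theta_0}$ denotes expectation under $\frac{1+m}2N_d(\boldsymbol\theta_0,\mathbf I_d)+\frac{1-m}2N_d(-\boldsymbol\theta_0,\mathbf I_d)$. $\gamma_{1,1}=\beta-\beta^2\mathbb E_{\boldsymbol\theta_0}\operatorname{sech}^2(\beta m+\boldsymbol\theta_0^\top\mathbf X)$, $\boldsymbol\gamma_{1,2}=-\beta\mathbb E_{\boldsymbol\theta_0}\mathbf X\operatorname{sech}^2(\beta m+\boldsymbol\theta_0^\top\mathbf X)$, $\boldsymbol\gamma_{2,2}=\mathbf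 I_d-\mathbb E_{\boldsymbol\theta_0}\mathbf X\mathbf X^\top\operatorname{sech}^2(\beta m+\boldsymbol\theta_0^\top\mathbf X)$, $I_\beta(\boldsymbol\theta_0)=\boldsymbol\gamma_{2,2}-\boldsymbol\gamma_{1,2}\boldsymbol\gamma_{1,2}^\top/\gamma_{1,1}$. *)

(* Defs.v *)
From mathcomp Require Import all_boot all_order all_algebra.
From mathcomp Require Import all_classical all_reals all_analysis.
Set Implicit Arguments. Unset Strict Implicit. Unset Printing Implicit Defensive.
Import Order.TTheory GRing.Theory Num.Theory numFieldNormedType.Exports.
Local Open Scope classical_set_scope.
Local Open Scope ring_scope.

Section CurieWeiss.
Variable R : realType.

Definition coshR (x : R) : R := (expR x + expR (- x)) / 2.
Definition tanhR (x : R) : R := (expR x - expR (- x)) / (expR x + expR (- x)).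
Definition sech2 (x : R) : R := (coshR x) ^- 2.

Definition dotv d (u v : 'rV[R]_d) : R := \sum_(j < d) u 0 j * v 0 j.
Definition sqnorm d (v : 'rV[R]_d) : R := dotv v v.
Definition enorm d (v : 'rV[R]_d) : R := Num.sqrt (sqnorm v).
Definition qform d (h : 'rV[R]_d) (A : 'M[R]_d) : R := (h *m A *m h^T) 0 0.

Definition std_gauss_pdf d (v : 'rV[R]_d) : R :=
  (Num.sqrt (2 * pi)) ^- d * expR (- sqnorm v / 2).

Definition Theta1 d (th : 'rV[R]_d) : Prop :=
  exists j : 'I_d, 0 < th 0 j /\ forall k : 'I_d, (k < j)%N -> th 0 k = 0.

(* Lebesgue integral over R^I (I finite), as iterated one-dimensional
   Lebesgue integrals (Tonelli), for nonnegative extended-real integrands *)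
Fixpoint iter_int (I : eqType) (s : seq I) (F : (I -> R) -> \bar R)
    (x : I -> R) : \bar R :=
  match s with
  | [::] => F x
  | i :: s' => (\int[@lebesgue_measure R]_t
                  iter_int s' F (fun k => if k == i then t else x k))%E
  end.
Definition intF (I : finType) (F : (I -> R) -> \bar R) : \bar R :=
  iter_int (enum I) F (fun _ => 0).
Definition intF_real (I : finType) (g : (I -> R) -> R) : R :=
  fine (intF (fun x => (Num.max (g x) 0)%:E)) -
  fine (intF (fun x => (Num.max (- g x) 0)%:E)).

Definition rowv d (y : 'I_d -> R) : 'rV[R]_d := \row_j y j.

Definition spin (b : bool) : R := if b then 1 else -1.
Definition spin_mean n (z : {ffun 'I_n -> bool}) : R :=
  (\sum_(i < n) spin (z i)) / n%:R.

Definition cw_weight n (beta : R) (z : {ffun 'I_n -> bool}) : R :=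
  expR (n%:R * beta * spin_mean z ^+ 2 / 2).
Definition cw_prior n (beta : R) (z : {ffun 'I_n -> bool}) : R :=
  cw_weight beta z / \sum_(w : {ffun 'I_n -> bool}) cw_weight beta w.

Definition sample n d := ('I_n * 'I_d)%type -> R.
Definition obs n d (x : sample n d) (i : 'I_n) : 'rV[R]_d := \row_j x (i, j).

Definition cw_density n d (beta : R) (th : 'rV[R]_d) (x : sample n d) : R :=
  \sum_(z : {ffun 'I_n -> bool})
     cw_prior beta z * \prod_(i < n) std_gauss_pdf (obs x i - spin (z i) *: th).

Definition post_weight n d (beta : R) (th : 'rV[R]_d) (x : sample n d)
    (w : {ffun 'I_n -> bool}) : R :=
  expR (n%:R * beta * spin_mean w ^+ 2 / 2
        + \sum_(i < n) spin (w i) * dotv th (obs x i)).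
Definition post_mean n d (beta : R) (th : 'rV[R]_d) (x : sample n d) (i : 'I_n) : R :=
  (\sum_(w : {ffun 'I_n -> bool}) spin (w i) * post_weight beta th x w) /
  (\sum_(w : {ffun 'I_n -> bool}) post_weight beta th x w).

Definition cw_prob n d (beta : R) (th : 'rV[R]_d) (A : sample n d -> Prop) : R :=
  fine (intF (fun x : sample n d =>
          ((if `[< A x >] then 1 else 0) * cw_density beta th x)%:E)).
Definition cw_expect n d (beta : R) (th : 'rV[R]_d) (f : sample n d -> R) : R :=
  intF_real (fun x : sample n d => f x * cw_density beta th x).

Definition log_lr n d (beta : R) (th th0 : 'rV[R]_d) (x : sample n d) : R :=
  ln (cw_density beta th x / cw_density beta th0 x).

Definition bounded_in_prob d k (beta : R) (th0 : 'rV[R]_d)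
    (T : forall n, sample n d -> 'rV[R]_k) : Prop :=
  forall eps : R, 0 < eps -> exists M : R, exists N : nat, forall n, (N <= n)%N ->
    cw_prob beta th0 (fun x => M < enorm (T n x)) <= eps.
Definition vanishing_in_prob d (beta : R) (th0 : 'rV[R]_d)
    (T : forall n, sample n d -> R) : Prop :=
  forall eps : R, 0 < eps ->
    (fun n => cw_prob beta th0 (fun x => eps < `|T n x|)) @ \oo --> (0 : R).

(* N_d(0, Sigma) is the law of G *m S with G ~ N_d(0,I_d) and S^T S = Sigma *)
Definition gauss_expect d (S : 'M[R]_d) (f : 'rV[R]_d -> R) : R :=
  intF_real (fun y : 'I_d -> R => f (rowv y *m S) * std_gauss_pdf (rowv y)).
Definition conv_dist_normal d (beta : R) (th0 : 'rV[R]_d)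
    (T : forall n, sample n d -> 'rV[R]_d) (Sigma : 'M[R]_d) : Prop :=
  exists S : 'M[R]_d, S^T *m S = Sigma /\
  forall f : 'rV[R]_d -> R, continuous f -> (exists C : R, forall v, `|f v| <= C) ->
    (fun n => cw_expect beta th0 (fun x => f (T n x))) @ \oo --> gauss_expect S f.

Definition mix_expect d (m : R) (th0 : 'rV[R]_d) (g : 'rV[R]_d -> R) : R :=
  intF_real (fun y : 'I_d -> R => g (rowv y) *
     ((1 + m) / 2 * std_gauss_pdf (rowv y - th0)
      + (1 - m) / 2 * std_gauss_pdf (rowv y + th0))).

Definition gamma11 d (beta m : R) (th0 : 'rV[R]_d) : R :=
  beta - beta ^+ 2 * mix_expect m th0 (fun X => sech2 (beta * m + dotv th0 X)).
Definition gamma12 d (beta m : R) (th0 : 'rV[R]_d) : 'rV[R]_d :=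
  \row_j (- beta * mix_expect m th0 (fun X => X 0 j * sech2 (beta * m + dotv th0 X))).
Definition gamma22 d (beta m : R) (th0 : 'rV[R]_d) : 'M[R]_d :=
  \matrix_(j, k) ((j == k)%:R -
     mix_expect m th0 (fun X => X 0 j * X 0 k * sech2 (beta * m + dotv th0 X))).
Definition Ibeta d (beta m : R) (th0 : 'rV[R]_d) : 'M[R]_d :=
  gamma22 beta m th0 -
  (gamma11 beta m th0)^-1 *: ((gamma12 beta m th0)^T *m gamma12 beta m th0).

Definition cw_objective n d (beta : R) (th0 : 'rV[R]_d) (x : sample n d) (u : R) : R :=
  beta * u ^+ 2 / 2 -
  n%:R^-1 * \sum_(i < n) ln (coshR (beta * u + dotv th0 (obs x i))).

Definition tanh_score n d (beta : R) (th0 : 'rV[R]_d) (x : sample n d) (u : R)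
  : 'rV[R]_d :=
  \sum_(i < n) tanhR (beta * u + dotv th0 (obs x i)) *: obs x i.

Definition Delta_tilde n d (beta : R) (th0 : 'rV[R]_d) (x : sample n d) (u : R)
  : 'rV[R]_d :=
  Num.sqrt n%:R *: (n%:R^-1 *: tanh_score beta th0 x u - th0).

Definition LAN_at d (beta : R) (th0 : 'rV[R]_d) (I : 'M[R]_d) : Prop :=
  exists Delta : forall n, sample n d -> 'rV[R]_d,
    (forall h : 'rV[R]_d,
       vanishing_in_prob beta th0 (fun n x =>
         log_lr beta (th0 + (Num.sqrt n%:R)^-1 *: h) th0 x
         - (dotv h (Delta n x) - 2^-1 * qform h I)))
    /\ conv_dist_normal beta th0 Delta I.

End CurieWeiss.

(* Main.v *)
Require Import Defs.
From mathcomp Require Import all_boot all_order all_algebra.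
From mathcomp Require Import all_classical all_reals all_analysis.
From mathcomp Require Import measurable_realfun normal_distribution gauss_integral.
From mathcomp Require Import ring lra.
Set Implicit Arguments. Unset Strict Implicit. Unset Printing Implicit Defensive.
Import Order.TTheory GRing.Theory Num.Theory numFieldNormedType.Exports.
Local Open Scope classical_set_scope.
Local Open Scope ring_scope.

(* Write [exp (n beta wbar^2 / 2)] as a Gaussian integral over a latent field [u]: given [u] the
   spins are independent, and sums over spins become one-dimensional integrals of
   [exp (- n F_n u)], where [F_n] is the objective minimised by [U n x].  Laplace's method gives
   (i) and the expansion of the log likelihood ratio with explicit errors O(1) and O(n^-1/2),
   on the event that finitely many empirical averages are within [K / sqrt n] of their limits,
   for the sample [x] or for its reflection [- x].

   That event has probability at least 1 - C / K^2: given the labels, Chebyshev's inequality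
   applies to each average, and |zbar| - m is O(n^-1/2) in mean square by the quadratic growth
   of the mean-field objective.  The limit of [F_n] has a unique minimum at [m] on [-1, 1]: its
   gap exceeds that of the mean-field objective by a squared Hellinger-type distance, which is
   positive at [- m] because [th0 != 0].

   No central limit theorem is needed for (ii): likelihood ratios integrate to 1, so the
   expansion makes the limiting exponential moments of the score Gaussian, and bounded
   continuous functions are approximated by sums of exponentials, with errors dominated by
   sums of exponentials (powers by difference quotients, cosines by Taylor polynomials,
   continuous functions by Bernstein polynomials in sines). *)

(** * Iterated Lebesgue integrals *)

(** [U] is an arbitrary choice of minimisers, so events and expectations built from it need not be
    measurable. Integrals of nonnegative functions are still monotone; only additivity asks for
    measurability. Hence every probability or expectation involving [U] is bounded above by the
    integral of a measurable dominating function, and lower bounds come from replacing [f] by [- f].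
    This is why the exceptional event becomes a pointwise bound on densities, and why test functions
    are majorised by exponential sums.

    The reflection is forced by the model: its law is invariant under [x -> - x], whereas the limits
    involve only the well [m]. The quantities concerned are even in [(x, U)], so either of [x] and
    [- x] may be used.

    The exponential moments of the score are not estimated directly, since the exceptional event
    could dominate them. On the good event [exp (h . T) p_0] is close to [exp (h I h / 2) p_h], and
    the mass that [p_h] gives to the exceptional event is controlled through [p_0] and [p_2h]. *)

Section CoordinateIntegral.
Variable R : realType.
Local Notation mu := (@lebesgue_measure R).

Section OneDim.
Context d (T : measurableType d) (m : {measure set T -> \bar R}).

(** The integral of a nonnegative function is a supremum over the simple functions below it, so
    monotonicity needs no measurability. The minimisers [U n x] are not assumed measurable in
    [x]. *)
Lemma ge0_le_integral_nomeas (f g : T -> \bar R) :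
  (forall x, (0 <= f x)%E) -> (forall x, (f x <= g x)%E) ->
  (\int[m]_x f x <= \int[m]_x g x)%E.
Proof.
move=> f0 fg; have g0 x : (0 <= g x)%E by exact: le_trans (fg x).
rewrite !ge0_integralTE//; apply: ereal_sup_le => _ [h /= hf <-].
by exists h => //= x; exact: le_trans (fg x).
Qed.
End OneDim.

(** The image of Lebesgue measure under [x -> c - x] gives every half-open interval its length, so
    uniqueness of Lebesgue measure identifies it. *)
Lemma integral_lebesgue_reflect (c : R) (f : R -> \bar R) :
  measurable_fun setT f -> (forall x, (0 <= f x)%E) ->
  (\int[mu]_x f (c - x)%R = \int[mu]_x f x)%E.
Proof.
move=> mf f0.
pose r : R -> measurableTypeR R := fun x : R => c - x.
have mr : measurable_fun setT (r : R -> R).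
  by apply: measurable_funB => //; exact: measurable_cst.
transitivity (\int[mu]_(x in r @^-1` setT) (f \o r) x)%E => //.
rewrite -ge0_integral_pushforward//.
apply: eq_measure_integral => //= A mA _.
apply/esym/lebesgue_measure_unique => //= _ [[a b] _ <-].
rewrite /pushforward.
have -> : r @^-1` [set` `](a, b).1, (a, b).2]%R] = [set` `[c - b, c - a[%R].
  apply/seteqP; split => x /=; rewrite /r !in_itv/= => /andP[h1 h2];
    apply/andP; split; lra.
rewrite !lebesgue_measure_itv/= !lte_fin ltrD2l ltrN2.
by case: ifP => // _; rewrite -!EFinB; congr EFin; ring.
Qed.

(* Measurability for the product sigma-algebra on [I -> R], phrased without
   constructing that sigma-algebra: measurable along every measurable family. *)
Definition cmeas (I : eqType) d' (V : measurableType d') (F : (I -> R) -> V) : Prop :=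
  forall d (T : measurableType d) (X : T -> I -> R),
    (forall i, measurable_fun setT (fun t => X t i)) ->
    measurable_fun setT (fun t => F (X t)).

Section Iterated.
Variable I : eqType.
Implicit Types (s : seq I) (F G : (I -> R) -> \bar R) (x y : I -> R) (i : I).
Local Notation upd x i t := (fun k => if k == i then t else x k).

(** Extending a measurable family by one more real coordinate reduces this to Tonelli's
    measurability theorem on [T * R]. It is what allows induction on the list of integrated
    coordinates. *)
Lemma cmeas_integral i F : cmeas F -> (forall x, (0 <= F x)%E) ->
  cmeas (fun x => \int[mu]_t F (upd x i t))%E.
Proof.
move=> mF F0 d T X mX.
have := @measurable_fun_fubini_tonelli_F _ _ T _ R mu
  (fun p : T * measurableTypeR R => F (upd (X p.1) i p.2)).
apply => //.
apply: (mF _ _ (fun p : T * measurableTypeR R => upd (X p.1) i p.2)) => k /=.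
case: (k == i); first exact: measurable_snd.
exact: (measurableT_comp (mX k) measurable_fst).
Qed.

Lemma cmeas_upd d' (V : measurableType d') i x (F : (I -> R) -> V) :
  cmeas F -> measurable_fun [set: measurableTypeR R] (fun t => F (upd x i t)).
Proof.
move=> mF; apply: (mF _ (measurableTypeR R)) => k.
by case: (k == i); [exact: measurable_id|exact: measurable_cst].
Qed.

Lemma eq_iter_int s F G x : F =1 G -> iter_int s F x = iter_int s G x.
Proof. by move=> /funext ->. Qed.

Arguments eq_iter_int {s F} G {x}.

Lemma iter_int_ge0 s F x : (forall x, (0 <= F x)%E) -> (0 <= iter_int s F x)%E.
Proof.
move=> F0; elim: s x => [|i s IH] x //=; apply: integral_ge0 => t _; exact: IH.
Qed.

Lemma iter_int_le s F G x : (forall x, (0 <= F x)%E) ->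
  (forall x, (F x <= G x)%E) -> (iter_int s F x <= iter_int s G x)%E.
Proof.
move=> F0 FG; elim: s x => [|i s IH] x //=.
by apply: ge0_le_integral_nomeas => t; [exact: iter_int_ge0|exact: IH].
Qed.

Lemma cmeas_iter_int s F : cmeas F -> (forall x, (0 <= F x)%E) ->
  cmeas (iter_int s F).
Proof.
move=> mF F0; elim: s => [|i s IH] //=; apply: cmeas_integral => // x.
exact: iter_int_ge0.
Qed.

Lemma iter_intD s F G x : cmeas F -> cmeas G ->
  (forall x, (0 <= F x)%E) -> (forall x, (0 <= G x)%E) ->
  iter_int s (fun x => F x + G x)%E x = (iter_int s F x + iter_int s G x)%E.
Proof.
move=> mF mG F0 G0; elim: s x => [|i s IH] x //=.
rewrite -ge0_integralD//; first by apply: eq_integral => t _; rewrite IH.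
- by move=> t _; exact: iter_int_ge0.
- exact: (cmeas_upd i x (cmeas_iter_int s mF F0)).
- by move=> t _; exact: iter_int_ge0.
- exact: (cmeas_upd i x (cmeas_iter_int s mG G0)).
Qed.

Lemma iter_int_mull s (c : (I -> R) -> \bar R) F x : cmeas F ->
  (forall x, (0 <= F x)%E) -> (forall x, (0 <= c x)%E) ->
  (forall y i t, i \in s -> c (upd y i t) = c y) ->
  iter_int s (fun x => c x * F x)%E x = (c x * iter_int s F x)%E.
Proof.
move=> mF F0 c0; elim: s x => [|i s IH] x cs //=.
rewrite -ge0_integralZl//.
- apply: eq_integral => t _; rewrite IH => [|y j t' js].
    by rewrite cs// mem_head.
  by rewrite cs// inE js orbT.
- exact: (cmeas_upd i x (cmeas_iter_int s mF F0)).
- by move=> t _; exact: iter_int_ge0.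
Qed.

Arguments iter_int_mull {s} c {F x}.

Lemma iter_int_cat s1 s2 F x :
  iter_int (s1 ++ s2) F x = iter_int s1 (iter_int s2 F) x.
Proof.
by elim: s1 x => [|i s IH] x //=; apply: eq_integral => t _; rewrite IH.
Qed.

Lemma iter_int_base s F x y :
  (forall k, k \notin s -> x k = y k) -> iter_int s F x = iter_int s F y.
Proof.
elim: s x y => [|i s IH] x y xy /=.
  by congr F; apply/funext => k; exact: xy.
apply: eq_integral => t _; apply: IH => k ks; case: ifPn => // ki.
by apply: xy; rewrite inE negb_or ki.
Qed.

Lemma iter_int_opp s F x : cmeas F -> (forall x, (0 <= F x)%E) ->
  iter_int s (fun y => F (fun k => - y k)) x = iter_int s F (fun k => - x k).
Proof.
move=> mF F0; elim: s x => [|i s IH] x //=.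
rewrite -[RHS](integral_lebesgue_reflect 0).
- apply: eq_integral => t _; rewrite IH; congr iter_int; apply/funext => k.
  by case: ifP; rewrite ?sub0r ?opprK.
- exact: (cmeas_upd i (fun k => - x k) (cmeas_iter_int s mF F0)).
- by move=> t; exact: iter_int_ge0.
Qed.

Lemma iter_int_prod s (g : I -> R -> \bar R) x : uniq s ->
  (forall i, measurable_fun setT (g i)) -> (forall i t, (0 <= g i t)%E) ->
  iter_int s (fun y => \big[mule/1%E]_(i <- s) g i (y i))%E x =
  (\big[mule/1%E]_(i <- s) \int[mu]_t g i t)%E.
Proof.
move=> us mg g0; elim: s us x => [|i s IH] /= us x; first by rewrite !big_nil.
case/andP: us => ns us.
have mP : cmeas (fun y : I -> R => \big[mule/1%E]_(j <- s) g j (y j))%E.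
  move=> d T X mX; elim: (s) => [|j s' IH'].
    under eq_fun do rewrite big_nil; exact: measurable_cst.
  under eq_fun do rewrite big_cons; apply: emeasurable_funM => //.
  exact: (measurableT_comp (mg j) (mX j)).
have P0 y : (0 <= \big[mule/1%E]_(j <- s) g j (y j))%E.
  exact: prode_ge0.
rewrite big_cons; transitivity (\int[mu]_t (g i t *
   (\big[mule/1%E]_(i <- s) \int[mu]_t g i t)))%E; last first.
  rewrite muleC -ge0_integralZl//.
  - by apply: eq_integral => t _; rewrite muleC.
  - exact: mg.
  - by apply: prode_ge0 => j _; exact: integral_ge0.
apply: eq_integral => t _.
rewrite (eq_iter_int (fun y => g i (y i) *
  \big[mule/1%E]_(j <- s) g j (y j))%E); last by move=> y; rewrite big_cons.
rewrite (iter_int_mull (fun y => g i (y i)))//.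
  by rewrite eqxx IH.
move=> y j t' js; case: eqP => // ij; by rewrite ij js in ns.
Qed.

Lemma iter_int_map (J : eqType) (f : J -> I) (s : seq J)
    (G : (J -> R) -> \bar R) x : injective f ->
  iter_int (map f s) (fun y => G (y \o f)) x = iter_int s G (x \o f).
Proof.
move=> fi; elim: s x => [|j s IH] x //=; apply: eq_integral => t _.
rewrite IH; congr iter_int; apply/funext => k /=.
by rewrite (inj_eq fi).
Qed.

End Iterated.

Arguments eq_iter_int {I s F} G {x}.
Arguments iter_int_mull {I s} c {F x}.

Lemma intF_base (J : finType) (G : (J -> R) -> \bar R) x :
  iter_int (enum J) G x = intF G.
Proof. by apply: iter_int_base => k; rewrite mem_enum. Qed.

Lemma intF_prod (J : finType) (g : J -> R -> \bar R) :
  (forall i, measurable_fun setT (g i)) -> (forall i t, (0 <= g i t)%E) ->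
  intF (fun y : J -> R => \big[mule/1%E]_i g i (y i))%E =
  (\big[mule/1%E]_i \int[mu]_t g i t)%E.
Proof.
move=> mg g0; rewrite /intF; transitivity
  (\big[mule/1%E]_(i <- enum J) \int[mu]_t g i t)%E; last by rewrite big_enum.
rewrite -(@iter_int_prod _ _ _ (fun=> 0)) ?enum_uniq//.
by apply: eq_iter_int => y; rewrite big_enum.
Qed.

Lemma intF_prod_block (A B : finType) (g : A -> (B -> R) -> \bar R) :
  (forall a, cmeas (g a)) -> (forall a t, (0 <= g a t)%E) ->
  intF (fun y : (A * B)%type -> R => \big[mule/1%E]_a g a (fun b => y (a, b)))%E =
  (\big[mule/1%E]_a intF (g a))%E.
Proof.
move=> mg g0; rewrite /intF.
(* The enumeration of a product type is lexicographic, so the iterated integral runs through the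
   blocks one after the other. *)
have -> : enum {: A * B} = flatten [seq [seq (a, b) | b <- enum B] | a <- enum A].
  by rewrite [LHS]enumT [in LHS]unlock.
transitivity (\big[mule/1%E]_(a <- enum A) intF (g a))%E; last by rewrite big_enum.
rewrite (eq_iter_int (fun y => \big[mule/1%E]_(a <- enum A)
  g a (fun b => y (a, b)))%E); last by move=> y; rewrite big_enum.
elim: (enum A) (enum_uniq A) (fun _ : A * B => 0 : R) => [|a s IH] /= us x.
  by rewrite !big_nil.
case/andP: us => ns us.
have mP : cmeas (fun y : (A * B)%type -> R =>
    \big[mule/1%E]_(a <- s) g a (fun b => y (a, b)))%E.
  move=> d T X mX; elim: (s) => [|j s' IH'].
    under eq_fun do rewrite big_nil; exact: measurable_cst.
  under eq_fun do rewrite big_cons; apply: emeasurable_funM => //.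
  by apply: (mg j _ _ (fun t b => X t (j, b))) => b; exact: mX.
have P0 y : (0 <= \big[mule/1%E]_(a <- s) g a (fun b => y (a, b)))%E.
  exact: prode_ge0.
have C0 : (0 <= \big[mule/1%E]_(a <- s) intF (g a))%E.
  by apply: prode_ge0 => j _; exact: iter_int_ge0.
rewrite big_cons iter_int_cat.
rewrite (eq_iter_int (fun y => (\big[mule/1%E]_(a <- s) intF (g a)) *
   g a (fun b => y (a, b)))%E); last first.
  move=> y; rewrite (eq_iter_int (fun y => g a (fun b => y (a, b)) *
    \big[mule/1%E]_(a <- s) g a (fun b => y (a, b)))%E); last first.
    by move=> z; rewrite big_cons.
  rewrite (iter_int_mull (fun y => g a (fun b => y (a, b))))//.
    by rewrite IH// muleC.
  move=> z p t ps; congr (g a); apply/funext => b; case: eqP => // abp.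
  have /flatten_mapP[a' a's /mapP[b' _ pE]] := ps.
  by move: abp a's ns; rewrite pE => -[-> _] ->.
rewrite iter_int_mull//; last first.
  by move=> d T X mX; apply: (mg a _ _ (fun t b => X t (a, b))) => b; exact: mX.
rewrite muleC; congr (_ * _)%E.
rewrite (iter_int_map (f := pair a) (enum B) (g a) x); last by move=> b b' [].
exact: intF_base.
Qed.

Section SignedIntegral.
Variable I : finType.
Implicit Types F G : (I -> R) -> R.

(** Measurability is left out on purpose: integrability then passes by domination to functions of an
    arbitrary minimiser. *)
Definition fint F := (intF (fun x => `|F x|%:E) < +oo)%E.

Lemma intF_ge0 (F : (I -> R) -> \bar R) :
  (forall x, (0 <= F x)%E) -> (0 <= intF F)%E.
Proof. exact: iter_int_ge0. Qed.

Lemma intF_le (F G : (I -> R) -> \bar R) : (forall x, (0 <= F x)%E) ->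
  (forall x, (F x <= G x)%E) -> (intF F <= intF G)%E.
Proof. exact: iter_int_le. Qed.

Lemma intF0 : intF (fun _ : I -> R => 0%E) = 0%E.
Proof.
rewrite /intF; elim: (enum I) (fun _ : I => 0 : R) => [|i s IH] x //=.
by under eq_integral do rewrite IH; rewrite integral0.
Qed.

Lemma cmeas_EFin F : cmeas F -> cmeas (fun x => (F x)%:E).
Proof. by move=> mF d T X mX; apply/measurable_EFinP; exact: mF. Qed.

Lemma intF_real_ge0 F : (forall x, 0 <= F x) ->
  intF_real F = fine (intF (fun x => (F x)%:E)).
Proof.
move=> F0; rewrite /intF_real.
under [X in fine (intF X) - _]eq_fun do rewrite max_l//.
under [X in _ - fine (intF X)]eq_fun do rewrite max_r ?oppr_le0//.
by rewrite intF0 subr0.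
Qed.

Lemma fint_le F G : (forall x, `|F x| <= `|G x|) -> fint G -> fint F.
Proof. by move=> FG; apply: le_lt_trans; apply: intF_le => x; rewrite lee_fin. Qed.

Lemma fint_pos F : fint F -> (intF (fun x => (Num.max (F x) 0)%:E) < +oo)%E.
Proof.
apply: le_lt_trans; apply: intF_le => x; rewrite lee_fin ?le_max ?lexx ?orbT//.
by rewrite ge_max ler_norm normr_ge0.
Qed.

Lemma fintN F : fint F -> fint (fun x => - F x).
Proof. by apply: fint_le => x; rewrite normrN. Qed.

Lemma intF_fin_num F : (forall x, 0 <= F x) -> (intF (fun x => (F x)%:E) < +oo)%E ->
  intF (fun x => (F x)%:E) \is a fin_num.
Proof. by move=> F0 Foo; rewrite ge0_fin_numE//; apply: intF_ge0 => x; rewrite lee_fin. Qed.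

Lemma max0_ge0 (a : R) : 0 <= Num.max a 0.
Proof. by rewrite le_max lexx orbT. Qed.

Lemma fin_num_pos F : fint F ->
  intF (fun x => (Num.max (F x) 0)%:E) \is a fin_num.
Proof.
by move=> iF; apply: (intF_fin_num (F := fun x => Num.max (F x) 0)) => [x|];
  [exact: max0_ge0|exact: fint_pos].
Qed.

Lemma fin_num_neg F : fint F ->
  intF (fun x => (Num.max (- F x) 0)%:E) \is a fin_num.
Proof. by move=> /fintN /fin_num_pos. Qed.

(** Positive and negative parts are compared separately by monotonicity, so neither function has to
    be measurable. *)
Lemma intF_real_le F G : (forall x, F x <= G x) -> fint F -> fint G ->
  intF_real F <= intF_real G.
Proof.
move=> FG iF iG; rewrite /intF_real; apply: lerB; apply: fine_le.
- exact: fin_num_pos.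
- exact: fin_num_pos.
- by apply: intF_le => x; rewrite lee_fin ?max0_ge0// ge_max le_max FG max0_ge0.
- exact: fin_num_neg.
- exact: fin_num_neg.
- apply: intF_le => x; rewrite lee_fin ?max0_ge0//.
  by rewrite ge_max le_max lerN2 FG max0_ge0.
Qed.

Lemma intFD F G : cmeas F -> cmeas G -> (forall x, 0 <= F x) ->
  (forall x, 0 <= G x) -> intF (fun x => (F x + G x)%:E) =
  (intF (fun x => (F x)%:E) + intF (fun x => (G x)%:E))%E.
Proof.
move=> mF mG F0 G0; rewrite /intF -iter_intD//; [exact: cmeas_EFin|exact: cmeas_EFin].
Qed.

Lemma intFZ F (c : R) : cmeas F -> (forall x, 0 <= F x) -> 0 <= c ->
  intF (fun x => (c * F x)%:E) = (c%:E * intF (fun x => (F x)%:E))%E.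
Proof.
move=> mF F0 c0; rewrite /intF -(iter_int_mull (fun=> c%:E))//; exact: cmeas_EFin.
Qed.

Lemma cmeasD F G : cmeas F -> cmeas G -> cmeas (fun x => F x + G x).
Proof. by move=> mF mG d T X mX; apply: measurable_funD; [exact: mF|exact: mG]. Qed.

Lemma cmeasM F G : cmeas F -> cmeas G -> cmeas (fun x => F x * G x).
Proof. by move=> mF mG d T X mX; apply: measurable_funM; [exact: mF|exact: mG]. Qed.

Lemma cmeas_cst (c : R) : cmeas (fun _ : I -> R => c).
Proof. by move=> d T X mX; exact: measurable_cst. Qed.

Lemma cmeasN F : cmeas F -> cmeas (fun x => - F x).
Proof. by move=> mF d T X mX; apply: measurableT_comp => //; exact: mF. Qed.

Lemma cmeas_comp F (g : R -> R) : continuous g -> cmeas F -> cmeas (g \o F).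
Proof.
move=> cg mF d T X mX; apply: measurableT_comp; last exact: mF.
exact: continuous_measurable_fun.
Qed.

Lemma cmeas_sum (J : Type) (s : seq J) (F : J -> (I -> R) -> R) :
  (forall j, cmeas (F j)) -> cmeas (fun x => \sum_(j <- s) F j x).
Proof. by move=> mF d T X mX; apply: measurable_sum => j; exact: mF. Qed.

Lemma cmeas_prod (J : eqType) (s : seq J) (F : J -> (I -> R) -> R) :
  (forall j, cmeas (F j)) -> cmeas (fun x => \prod_(j <- s) F j x).
Proof. by move=> mF d T X mX; apply: measurable_prod => j _; exact: mF. Qed.

Lemma cmeas_max0 F : cmeas F -> cmeas (fun x => Num.max (F x) 0).
Proof.
move=> mF d T X mX; apply: measurable_maxr; [exact: mF|exact: measurable_cst].
Qed.

Lemma cmeas_norm F : cmeas F -> cmeas (fun x => `|F x|).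
Proof. by move=> mF d T X mX; apply: measurableT_comp => //; exact: mF. Qed.

Lemma fintD F G : cmeas F -> cmeas G -> fint F -> fint G ->
  fint (fun x => F x + G x).
Proof.
move=> mF mG iF iG; apply: (@le_lt_trans _ _ (intF (fun x => (`|F x| + `|G x|)%:E))).
  by apply: intF_le => x; rewrite lee_fin// ler_normD.
by rewrite intFD//; [exact: lte_add_pinfty|exact: cmeas_norm|exact: cmeas_norm].
Qed.

Lemma fintZ F (c : R) : cmeas F -> fint F -> fint (fun x => c * F x).
Proof.
move=> mF iF; rewrite /fint; under eq_fun do rewrite normrM.
by rewrite intFZ//; [exact: lte_mul_pinfty|exact: cmeas_norm].
Qed.

Lemma intF_realN F : intF_real (fun x => - F x) = - intF_real F.
Proof.
by rewrite /intF_real opprB; under [X in _ - fine (intF X)]eq_fun do rewrite opprK.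
Qed.

Lemma intF_realD F G : cmeas F -> cmeas G -> fint F -> fint G ->
  intF_real (fun x => F x + G x) = intF_real F + intF_real G.
Proof.
move=> mF mG iF iG.
pose p F x := Num.max (F x) 0; pose q F x := Num.max (- F x) 0 : R.
have pq (H : (I -> R) -> R) x : H x = p H x - q H x.
  by rewrite /p /q /Num.max !oppr_lt0; case: ltgtP => ?; rewrite ?subr0 ?sub0r ?opprK; lra.
have mp H : cmeas H -> cmeas (p H) by exact: cmeas_max0.
have mq H : cmeas H -> cmeas (q H) by move=> mH; exact/cmeas_max0/cmeasN.
have p0 H x : 0 <= p H x by exact: max0_ge0.
have q0 H x : 0 <= q H x by exact: max0_ge0.
pose H x := F x + G x.
have mH : cmeas H by exact: cmeasD.
have iH : fint H by exact: fintD.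
have fp K : fint K -> intF (fun x => (p K x)%:E) \is a fin_num.
  exact: fin_num_pos.
have fq K : fint K -> intF (fun x => (q K x)%:E) \is a fin_num.
  exact: fin_num_neg.
(* The identity [H + F^- + G^- = H^- + F^+ + G^+], with positive part of [H] on the left, involves
   nonnegative functions only, for which additivity is known. *)
have : intF (fun x => (p H x + (q F x + q G x))%:E) =
       intF (fun x => (q H x + (p F x + p G x))%:E).
  congr intF; apply/funext => x; congr EFin.
  have := pq H x; have := pq F x; have := pq G x; rewrite /H; lra.
rewrite !intFD//; try by [exact: mp|exact: mq|exact/cmeasD/mq|exact/cmeasD/mp|
  move=> x; apply: addr_ge0].
move/(congr1 fine); rewrite !fineD ?fin_numD ?fp ?fq//.
  by rewrite /intF_real /p /q /H => e; lra.
all: try exact: fintN.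
- by apply: cmeasD; exact: mp.
- by apply: cmeasD; exact: mq.
Qed.

Lemma intF_realZ F (c : R) : cmeas F -> fint F ->
  intF_real (fun x => c * F x) = c * intF_real F.
Proof.
move=> mF iF; wlog c0 : c / 0 <= c => [W|].
  have [/W//|/ltW c0] := leP 0 c.
  have := W (- c); rewrite oppr_ge0 => /(_ c0).
  by under eq_fun do rewrite mulNr; rewrite intF_realN mulNr => /oppr_inj.
rewrite /intF_real mulrBr.
have e (K : (I -> R) -> R) : cmeas K -> fint K ->
    fine (intF (fun x => (Num.max (c * K x) 0)%:E)) =
    c * fine (intF (fun x => (Num.max (K x) 0)%:E)).
  move=> mK iK; rewrite -[c in RHS]/(fine c%:E) -fineM//; last first.
    exact: fin_num_pos.
  rewrite -(intFZ (cmeas_max0 mK))//; last by move=> x; exact: max0_ge0.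
  congr (fine (intF _)); apply/funext => x; congr EFin.
  by rewrite maxr_pMr// mulr0.
rewrite e//; congr (_ - _); rewrite -(e _ (cmeasN mF) (fintN iF)).
by congr (fine (intF _)); apply/funext => x; rewrite mulrN.
Qed.

Lemma fint_sum (J : Type) (s : seq J) (F : J -> (I -> R) -> R) :
  (forall j, cmeas (F j)) -> (forall j, fint (F j)) ->
  fint (fun x => \sum_(j <- s) F j x).
Proof.
move=> mF iF; elim: s => [|j s IH].
  under eq_fun do rewrite big_nil.
  by rewrite /fint; under eq_fun do rewrite normr0; rewrite intF0.
by under eq_fun do rewrite big_cons; apply: fintD => //; exact: cmeas_sum.
Qed.

Lemma intF_real_sum (J : Type) (s : seq J) (F : J -> (I -> R) -> R) :
  (forall j, cmeas (F j)) -> (forall j, fint (F j)) ->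
  intF_real (fun x => \sum_(j <- s) F j x) = \sum_(j <- s) intF_real (F j).
Proof.
move=> mF iF; elim: s => [|j s IH].
  under eq_fun do rewrite big_nil.
  by rewrite intF_real_ge0// intF0 big_nil.
under eq_fun do rewrite big_cons.
by rewrite intF_realD ?IH ?big_cons//; [exact: cmeas_sum|exact: fint_sum].
Qed.

Lemma intF_opp (K : (I -> R) -> \bar R) : cmeas K -> (forall x, (0 <= K x)%E) ->
  intF (fun x => K (fun k => - x k)) = intF K.
Proof. by move=> mK K0; rewrite /intF iter_int_opp//; exact: intF_base. Qed.

Lemma fint_opp F : cmeas F -> fint F -> fint (fun x => F (fun k => - x k)).
Proof.
move=> mF; rewrite /fint -(@intF_opp (fun x => `|F x|%:E))//.
exact/cmeas_EFin/cmeas_norm.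
Qed.

Lemma intF_real_opp F : cmeas F ->
  intF_real (fun x => F (fun k => - x k)) = intF_real F.
Proof.
move=> mF; rewrite /intF_real; congr (fine _ - fine _).
- rewrite -[RHS]intF_opp// => [|x]; last by rewrite lee_fin max0_ge0.
  exact/cmeas_EFin/cmeas_max0.
- rewrite -[RHS]intF_opp// => [|x]; last by rewrite lee_fin max0_ge0.
  exact/cmeas_EFin/cmeas_max0/cmeasN.
Qed.

End SignedIntegral.

End CoordinateIntegral.

(** * Calculus of tanh and log cosh *)

Section HyperbolicCalculus.
Variable R : realType.
Implicit Types a b s t u x y : R.

Lemma is_derive_expRN x : is_derive x 1 (fun y : R => expR (- y)) (- expR (- x)).
Proof.
have := is_derive1_comp (is_derive_expR (- x)) (is_deriveN (is_derive_id x 1)).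
by rewrite mulrN1.
Qed.

Lemma coshR_gt0 x : 0 < coshR x.
Proof. by rewrite /coshR divr_gt0// addr_gt0// expR_gt0. Qed.

Lemma coshRN x : coshR (- x) = coshR x.
Proof. by rewrite /coshR opprK addrC. Qed.

Lemma tanhRE x : tanhR x = (expR x - expR (- x)) / 2 / coshR x.
Proof.
have := expR_gt0 x; have := expR_gt0 (- x); rewrite /tanhR /coshR => h1 h2.
by field; apply: lt0r_neq0; lra.
Qed.

Lemma tanhRN x : tanhR (- x) = - tanhR x.
Proof. by rewrite !tanhRE coshRN opprK -!mulNr opprB. Qed.

Lemma tanhR0 : tanhR (0 : R) = 0.
Proof. by rewrite /tanhR oppr0 subrr mul0r. Qed.

Lemma sech2E x : sech2 x = 1 - tanhR x ^+ 2.
Proof.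
rewrite tanhRE /sech2.
have c0 := lt0r_neq0 (coshR_gt0 x).
have e : coshR x ^+ 2 - ((expR x - expR (- x)) / 2) ^+ 2 = 1.
  by rewrite -[RHS](expRxMexpNx_1 x) /coshR; field.
by rewrite -[X in X = _]mul1r -{1}e; field.
Qed.

Lemma sech2_gt0 x : 0 < sech2 x.
Proof. by rewrite /sech2 invr_gt0 exprn_gt0// coshR_gt0. Qed.

Lemma tanhR_sqr_lt1 x : tanhR x ^+ 2 < 1.
Proof. by have := sech2_gt0 x; rewrite sech2E subr_gt0. Qed.

Lemma tanhR_norm_lt1 x : `|tanhR x| < 1.
Proof. by rewrite -(@expr_lt1 _ 2) ?normr_ge0// real_normK ?num_real// tanhR_sqr_lt1. Qed.

Lemma sech2_le1 x : sech2 x <= 1.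
Proof. by rewrite sech2E gerBl sqr_ge0. Qed.

Lemma is_derive_coshR x : is_derive x 1 (@coshR R) ((expR x - expR (- x)) / 2).
Proof.
have h := is_deriveD (is_derive_expR x) (is_derive_expRN x).
have -> : @coshR R = (fun y => 2^-1 *: (expR y + expR (- y))).
  by apply/funext => y; rewrite /coshR mulrC.
by rewrite mulrC; exact: (is_deriveZ (2^-1) h).
Qed.

Lemma is_derive_tanhR x : is_derive x 1 (@tanhR R) (sech2 x).
Proof.
have c0 := lt0r_neq0 (coshR_gt0 x).
have h1 := is_deriveD (is_derive_expR x) (is_deriveN (is_derive_expRN x)).
have h := is_deriveM h1 (is_deriveV c0 (is_derive_coshR x)).
have := is_deriveZ (2^-1) h.
have -> : 2^-1 \*: ((expR \+ \- (fun y => expR (- y))) \* (fun y => (coshR y)^-1)) = @tanhR R.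
  by apply/funext => y; rewrite tanhRE /= /GRing.scale/= mulrAC mulrC.
move/is_derive_eq; apply; rewrite sech2E tanhRE /GRing.scale/= opprK.
rewrite !fctE /coshR; have := expR_gt0 x; have := expR_gt0 (- x) => ? ?.
by field; apply: lt0r_neq0; lra.
Qed.

Definition lcosh x := ln (coshR x).

Lemma is_derive_lcosh x : is_derive x 1 lcosh (tanhR x).
Proof.
have := is_derive1_comp (is_derive1_ln (coshR_gt0 x)) (is_derive_coshR x).
by rewrite tanhRE mulrC.
Qed.

(** Writing the intermediate point as [th * s] treats both signs of [s], and [s = 0], at once. The
    Taylor bounds below apply this to a remainder, whose derivative is a remainder of lower
    order. *)
Lemma mvt_scaled (f df : R -> R) s : (forall t, is_derive t 1 f (df t)) ->
  exists2 th, 0 <= th <= 1 & f s - f 0 = s * df (th * s).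
Proof.
move=> fd; have fc : continuous f.
  by move=> t; exact/differentiable_continuous/derivable1_diffP/(@ex_derive _ _ _ _ _ _ _ (fd t)).
have [s0|s0|<-] := ltgtP 0 s; last first.
- by exists 0; rewrite ?lexx ?ler01// subrr mul0r.
- have [c] := MVT s0 (fun t _ => fd t) (continuous_subspaceT fc).
  rewrite in_itv/= => /andP[c1 c2] e; exists (c / s).
    by rewrite ler_ndivlMr// mul0r (ltW c2)/= ler_ndivrMr// mul1r (ltW c1).
  by rewrite divfK ?ltr0_neq0// -opprB e sub0r mulrN opprK mulrC.
- have [c] := MVT s0 (fun t _ => fd t) (continuous_subspaceT fc).
  rewrite in_itv/= => /andP[c1 c2] e; exists (c / s).
    by rewrite ler_pdivlMr// mul0r (ltW c1)/= ler_pdivrMr// mul1r (ltW c2).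
  by rewrite e subr0 divfK ?lt0r_neq0// mulrC.
Qed.

Lemma is_derive_affine a b x : is_derive x 1 (fun t : R => a + b * t) b.
Proof.
have h := is_deriveD (is_derive_cst a x 1) (is_deriveZ b (is_derive_id x 1)).
by move/is_derive_eq: h; apply; rewrite add0r /GRing.scale/= mulr1.
Qed.

Lemma is_derive_shift (f : R -> R) a x df : is_derive (a + x) 1 f df ->
  is_derive x 1 (fun t => f (a + t)) df.
Proof.
move=> h; have := is_derive_affine a 1 x; under eq_fun do rewrite mul1r; move=> h1.
by have := is_derive1_comp h h1; rewrite mulr1.
Qed.

Lemma norm_ths th s : 0 <= th <= 1 -> `|th * s| <= `|s|.
Proof. by case/andP=> t0 t1; rewrite normrM ger0_norm// ler_piMl. Qed.

Lemma tanhR_lip a s : `|tanhR (a + s) - tanhR a| <= `|s|.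
Proof.
have [th _] := mvt_scaled s (fun t => is_derive_shift (is_derive_tanhR (a + t))).
rewrite addr0 => ->; rewrite normrM ler_piMr// ger0_norm ?sech2_le1//.
exact/ltW/sech2_gt0.
Qed.

Lemma tanhR_mono a s : 0 <= s * (tanhR (a + s) - tanhR a).
Proof.
have [th _] := mvt_scaled s (fun t => is_derive_shift (is_derive_tanhR (a + t))).
by rewrite addr0 => ->; rewrite mulrA -expr2 mulr_ge0 ?sqr_ge0// ltW// sech2_gt0.
Qed.

Lemma sech2_lip a s : `|sech2 (a + s) - sech2 a| <= 2 * `|s|.
Proof.
rewrite !sech2E; have -> : 1 - tanhR (a + s) ^+ 2 - (1 - tanhR a ^+ 2) =
  (tanhR a - tanhR (a + s)) * (tanhR a + tanhR (a + s)) by ring.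
rewrite normrM [X in X <= _]mulrC distrC.
apply: ler_pM; [exact: normr_ge0|exact: normr_ge0| |exact: tanhR_lip].
have := tanhR_norm_lt1 a; have := tanhR_norm_lt1 (a + s).
have := ler_normD (tanhR a) (tanhR (a + s)); lra.
Qed.

Lemma lcosh_lip a s : `|lcosh (a + s) - lcosh a| <= `|s|.
Proof.
have [th _] := mvt_scaled s (fun t => is_derive_shift (is_derive_lcosh (a + t))).
by rewrite addr0 => ->; rewrite normrM ler_piMr// ltW// tanhR_norm_lt1.
Qed.

Lemma is_derive_sub_affine (f : R -> R) a c x df : is_derive (a + x) 1 f df ->
  is_derive x 1 (fun t => f (a + t) - f a - t * c) (df - c).
Proof.
move=> h; have h1 := is_deriveD (is_derive_shift h) (is_derive_affine (- f a) (- c) x).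
have -> : (fun t => f (a + t) - f a - t * c) =
  (fun t => f (a + t)) \+ (fun t => - f a + - c * t); last exact: h1.
by apply/funext => t /=; ring.
Qed.

Lemma lcosh_convex a s : 0 <= lcosh (a + s) - lcosh a - s * tanhR a.
Proof.
have [th /andP[t0 t1]] := mvt_scaled s
  (fun t => is_derive_sub_affine (tanhR a) (is_derive_lcosh (a + t))).
rewrite addr0 subrr mul0r !subr0 => ->.
move: t0; rewrite le_eqVlt => /predU1P[<-|t0].
  by rewrite mul0r addr0 subrr mulr0.
by rewrite -(pmulr_rge0 _ t0) mulrA; exact: tanhR_mono.
Qed.

Lemma tanhR_taylor2 a s : `|tanhR (a + s) - tanhR a - s * sech2 a| <= 2 * s ^+ 2.
Proof.
have [th t01] := mvt_scaled s
  (fun t => is_derive_sub_affine (sech2 a) (is_derive_tanhR (a + t))).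
rewrite addr0 subrr mul0r !subr0 => ->.
have -> : 2 * s ^+ 2 = `|s| * (2 * `|s|).
  by rewrite -real_normK ?num_real// expr2; ring.
rewrite normrM ler_wpM2l ?normr_ge0//.
by apply: le_trans (sech2_lip a _) _; rewrite ler_wpM2l// norm_ths.
Qed.

(** The derivative in [s] of this remainder is the remainder of [tanhR_taylor2]; no fourth
    derivative or explicit third one is needed. *)
Lemma lcosh_taylor3 a s :
  `|lcosh (a + s) - lcosh a - s * tanhR a - s ^+ 2 / 2 * sech2 a| <= 2 * `|s| ^+ 3.
Proof.
have h t : is_derive t 1 (fun t => lcosh (a + t) - lcosh a - t * tanhR a
    - t ^+ 2 / 2 * sech2 a) (tanhR (a + t) - tanhR a - t * sech2 a).
  have h1 := is_deriveD (is_derive_sub_affine (tanhR a) (is_derive_lcosh (a + t)))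
    (is_deriveZ (- (sech2 a / 2)) (is_deriveX 2 (is_derive_id t 1))).
  have -> : (fun t => lcosh (a + t) - lcosh a - t * tanhR a - t ^+ 2 / 2 * sech2 a) =
    (fun t => lcosh (a + t) - lcosh a - t * tanhR a) \+
    (- (sech2 a / 2)) \*: ((@id R) ^+ 2).
    by apply/funext => u /=; rewrite /GRing.scale/= !fctE; ring.
  apply: (is_derive_eq h1); by rewrite /GRing.scale/= expr1; field.
have [th t01] := mvt_scaled s h.
rewrite addr0 subrr !(mul0r, expr0n)/= !(mul0r, subr0) => ->.
rewrite normrM exprS mulrCA ler_wpM2l ?normr_ge0//.
apply: le_trans (tanhR_taylor2 _ _) _; rewrite ler_wpM2l//.
by rewrite -real_normK ?num_real// lerXn2r ?nnegrE ?normr_ge0// norm_ths.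
Qed.

Lemma continuous_of_derive (f df : R -> R) :
  (forall t, is_derive t 1 f (df t)) -> continuous f.
Proof.
move=> fd t.
exact/differentiable_continuous/derivable1_diffP/(@ex_derive _ _ _ _ _ _ _ (fd t)).
Qed.

Lemma continuous_tanhR : continuous (@tanhR R).
Proof. exact: (continuous_of_derive is_derive_tanhR). Qed.

Lemma continuous_lcosh : continuous lcosh.
Proof. exact: (continuous_of_derive is_derive_lcosh). Qed.

Lemma continuous_sech2 : continuous (@sech2 R).
Proof.
have -> : @sech2 R = (fun x => 1 - tanhR x ^+ 2).
  by apply/funext => x; rewrite sech2E.
move=> x; apply: cvgB; first exact: cvg_cst.
by apply: (cvg_comp _ _ (@continuous_tanhR x) (@exprn_continuous _ 2 _)).
Qed.

End HyperbolicCalculus.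

(** * Products of independent blocks and second moments of their sums *)

Section BlockProducts.
Variables (R : realType) (A B : finType).
Local Notation blk y a := (fun b : B => y (a, b)).

Lemma cmeas_blk (a : A) (h : (B -> R) -> R) : cmeas h ->
  cmeas (fun y : (A * B)%type -> R => h (blk y a)).
Proof. by move=> mh d T X mX; apply: (mh _ _ (fun t b => X t (a, b))). Qed.

Lemma fint_intF_real (I : finType) (F : (I -> R) -> R) : (forall x, 0 <= F x) ->
  fint F -> intF (fun x => (F x)%:E) = (intF_real F)%:E.
Proof.
move=> F0 iF; rewrite intF_real_ge0// fineK//; apply: intF_fin_num => //.
by move: iF; rewrite /fint; under eq_fun do rewrite ger0_norm//.
Qed.

Section Product.
Variable h : A -> (B -> R) -> R.
Hypothesis mh : forall a, cmeas (h a).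
Hypothesis ih : forall a, fint (h a).

Lemma intF_prod_ge0 : (forall a x, 0 <= h a x) ->
  intF (fun y : (A * B)%type -> R => (\prod_a h a (blk y a))%:E) =
  (\prod_a intF_real (h a))%:E.
Proof.
move=> h0; under eq_fun do rewrite -prodEFin.
rewrite (@intF_prod_block _ A B (fun a x => (h a x)%:E)); last 2 first.
- by move=> a; exact: cmeas_EFin.
- by move=> a t; rewrite lee_fin.
by rewrite -prodEFin; apply: eq_bigr => a _; rewrite fint_intF_real.
Qed.
End Product.

Lemma fint_norm (I : finType) (F : (I -> R) -> R) : fint F -> fint (fun x => `|F x|).
Proof. by apply: fint_le => x; rewrite normr_id. Qed.

Lemma fint_prod (h : A -> (B -> R) -> R) : (forall a, cmeas (h a)) ->
  (forall a, fint (h a)) -> fint (fun y : (A * B)%type -> R => \prod_a h a (blk y a)).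
Proof.
move=> mh ih; rewrite /fint; under eq_fun do rewrite normr_prod.
rewrite (@intF_prod_ge0 (fun a x => `|h a x|)) ?ltry// => a.
- exact: cmeas_norm.
- exact: fint_norm.
Qed.

Lemma cmeas_prod_blk (h : A -> (B -> R) -> R) : (forall a, cmeas (h a)) ->
  cmeas (fun y : (A * B)%type -> R => \prod_a h a (blk y a)).
Proof. by move=> mh; apply: cmeas_prod => a; exact: cmeas_blk. Qed.

Lemma intF_real_prod (h : A -> (B -> R) -> R) : (forall a, cmeas (h a)) ->
  (forall a, fint (h a)) ->
  intF_real (fun y : (A * B)%type -> R => \prod_a h a (blk y a)) =
  \prod_a intF_real (h a).
Proof.
(* The list holds the factors not yet known to be nonnegative; each induction step splits one of
   them into positive and negative parts. *)
have: forall a, a \notin enum A -> forall x, 0 <= h a x by move=> a; rewrite mem_enum.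
elim: (enum A) h => [|a s IH] h hs mh ih.
  have h0 a x : 0 <= h a x by exact: hs.
  by rewrite intF_real_ge0 ?intF_prod_ge0// => y; apply: prodr_ge0.
pose hp c := if c == a then (fun x => Num.max (h a x) 0) else h c.
pose hn c := if c == a then (fun x => Num.max (- h a x) 0) else h c.
have mp c : cmeas (hp c) by rewrite /hp; case: eqP => // _; exact: cmeas_max0.
have mn c : cmeas (hn c) by rewrite /hn; case: eqP => // _; exact/cmeas_max0/cmeasN.
have ip0 (k : (B -> R) -> R) : fint k -> fint (fun x => Num.max (k x) 0).
  apply: fint_le => x; rewrite ger0_norm ?max0_ge0//.
  by rewrite ge_max ler_norm normr_ge0.
have ip c : fint (hp c) by rewrite /hp; case: eqP => // _; exact: ip0.
have in_ c : fint (hn c) by rewrite /hn; case: eqP => // _; exact/ip0/fintN.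
have E y : \prod_c h c (blk y c) =
    \prod_c hp c (blk y c) + - \prod_c hn c (blk y c).
  rewrite (bigD1 a)//= [in X in _ = X - _](bigD1 a)//= [in X in _ = _ - X](bigD1 a)//=.
  rewrite [X in _ = X - _](_ : _ = Num.max (h a (blk y a)) 0 *
    \prod_(i | i != a) h i (blk y i)); last first.
    rewrite /hp eqxx; congr (_ * _); apply: eq_bigr => c /negbTE ca.
    by rewrite ca.
  rewrite [X in _ = _ - X](_ : _ = Num.max (- h a (blk y a)) 0 *
    \prod_(i | i != a) h i (blk y i)); last first.
    rewrite /hn eqxx; congr (_ * _); apply: eq_bigr => c /negbTE ca.
    by rewrite ca.
  rewrite -mulrBl; congr (_ * _).
  by rewrite /Num.max !oppr_lt0; case: ltgtP => ?; rewrite ?subr0 ?sub0r ?opprK; lra.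
under eq_fun do rewrite E.
rewrite intF_realD; [|exact: cmeas_prod_blk|exact/cmeasN/cmeas_prod_blk|
  exact: fint_prod|exact/fintN/fint_prod].
rewrite intF_realN IH//; last first.
  move=> c cs x; rewrite /hp; case: eqP => ca; first exact: max0_ge0.
  by apply: hs; rewrite inE negb_or cs andbT; apply/eqP.
rewrite IH//; last first.
  move=> c cs x; rewrite /hn; case: eqP => ca; first exact: max0_ge0.
  by apply: hs; rewrite inE negb_or cs andbT; apply/eqP.
rewrite (bigD1 a)//= [in X in _ - X](bigD1 a)//= [in X in _ = X](bigD1 a)//=.
have -> : hp a = (fun x => Num.max (h a x) 0) by rewrite /hp eqxx.
have -> : hn a = (fun x => Num.max (- h a x) 0) by rewrite /hn eqxx.
rewrite [X in _ * X - _](_ : _ = \prod_(i | i != a) intF_real (h i)); last first.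
  by apply: eq_bigr => c /negbTE ca; rewrite /hp ca.
rewrite [X in _ - _ * X](_ : _ = \prod_(i | i != a) intF_real (h i)); last first.
  by apply: eq_bigr => c /negbTE ca; rewrite /hn ca.
rewrite -mulrBl; congr (_ * _).
rewrite intF_real_ge0; last by move=> x; exact: max0_ge0.
by rewrite intF_real_ge0 // => x; exact: max0_ge0.
Qed.

Section SecondMoment.
Variables p g : A -> (B -> R) -> R.
Hypothesis mp : forall a, cmeas (p a).
Hypothesis ip : forall a, fint (p a).
Hypothesis p1 : forall a, intF_real (p a) = 1.
Hypothesis mg : forall a, cmeas (g a).
Hypothesis ig2 : forall a, fint (fun x => g a x ^+ 2 * p a x).
Hypothesis g0 : forall a, intF_real (fun x => g a x * p a x) = 0.

Let ig a : fint (fun x => g a x * p a x).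
Proof.
(* Domination by [|g| <= 1 + g ^ 2]. *)
have: fint (fun x => p a x + g a x ^+ 2 * p a x).
  by apply: fintD => //; apply: cmeasM => //; exact: cmeasM.
apply: fint_le => x.
rewrite -[X in _ <= `|X + _|]mul1r -mulrDl !normrM ler_wpM2r//.
rewrite [X in _ <= X]ger0_norm ?addr_ge0 ?sqr_ge0 ?ler01//.
rewrite -[g a x ^+ 2]real_normK ?num_real//.
by have := sqr_ge0 (`|g a x| - 1); have := normr_ge0 (g a x); nra.
Qed.

(** Factor of index [c] in the [(a, b)] term of the expanded square. The conditionals make diagonal
    and off-diagonal terms alike products over all blocks. *)
Let K a b c := fun x => (if c == a then g a x else 1) * (if c == b then g b x else 1) * p c x.

Let mK a b c : cmeas (K a b c).
Proof.
by apply: cmeasM => //; apply: cmeasM; case: eqP => // _; exact: cmeas_cst.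
Qed.

Let iK a b c : fint (K a b c).
Proof.
rewrite /K; case: (eqVneq c a) => [->|_]; case: eqP => [<-|_].
- by under eq_fun do rewrite -expr2.
- by under eq_fun do rewrite mulr1.
- by under eq_fun do rewrite mul1r.
- by under eq_fun do rewrite !mul1r.
Qed.

Let E y : (\sum_a g a (blk y a)) ^+ 2 * \prod_a p a (blk y a) =
  \sum_a \sum_b \prod_c K a b c (blk y c).
Proof.
rewrite expr2 big_distrlr/= big_distrl/=; apply: eq_bigr => a _.
rewrite big_distrl/=; apply: eq_bigr => b _.
rewrite /K !big_split/=; congr (_ * _ * _).
- by rewrite (bigD1 a)//= eqxx big1 ?mulr1// => c /negbTE ->.
- by rewrite (bigD1 b)//= eqxx big1 ?mulr1// => c /negbTE ->.
Qed.

Lemma fint_second_moment : fint (fun y : (A * B)%type -> R =>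
  (\sum_a g a (blk y a)) ^+ 2 * \prod_a p a (blk y a)).
Proof.
under eq_fun do rewrite E.
by apply: fint_sum => a; [apply: cmeas_sum => b; exact: cmeas_prod_blk|
  apply: fint_sum => b; [exact: cmeas_prod_blk|exact: fint_prod]].
Qed.

(** For [a != b] the term contains the vanishing integral of [g a * p a]; on the diagonal all other
    factors integrate to 1. *)
Lemma second_moment : intF_real (fun y : (A * B)%type -> R =>
    (\sum_a g a (blk y a)) ^+ 2 * \prod_a p a (blk y a)) =
  \sum_a intF_real (fun x => g a x ^+ 2 * p a x).
Proof.
under eq_fun do rewrite E.
rewrite intF_real_sum; last 2 first.
- by move=> a; apply: cmeas_sum => b; exact: cmeas_prod_blk.
- by move=> a; apply: fint_sum => b; [exact: cmeas_prod_blk|exact: fint_prod].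
apply: eq_bigr => a _; rewrite intF_real_sum; last 2 first.
- by move=> b; exact: cmeas_prod_blk.
- by move=> b; exact: fint_prod.
rewrite (bigD1 a)//= big1 ?addr0 => [|b ba].
  rewrite intF_real_prod// (bigD1 a)//= big1 => [|c /negbTE ca].
    rewrite mulr1; congr intF_real; apply/funext => x.
    by rewrite /K eqxx expr2.
  rewrite -[RHS](p1 c); congr intF_real; apply/funext => x.
  by rewrite /K ca !mul1r.
rewrite intF_real_prod// (bigD1 a)//= [X in X * _](_ : _ = 0) ?mul0r//.
rewrite -[RHS](g0 a); congr intF_real; apply/funext => x.
by rewrite /K eqxx eq_sym (negbTE ba) mulr1.
Qed.

End SecondMoment.
End BlockProducts.

(** * Gaussian integrals *)

Section GaussianIntegrals.
Variable R : realType.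
Local Notation mu := (@lebesgue_measure R).

Lemma gauss_integral (s c : R) : 0 < s ->
  (\int[mu]_u (expR (- s * (u - c) ^+ 2 / 2))%:E = (Num.sqrt (2 * pi / s))%:E)%E.
Proof.
move=> s0; pose sg := (Num.sqrt s)^-1.
have sg0 : sg != 0 by rewrite invr_neq0// sqrtr_eq0 -ltNge.
have sg2 : sg ^+ 2 = s^-1 by rewrite exprVn sqr_sqrtr// ltW.
have p0 : 0 < Num.sqrt (2 * pi / s) by rewrite sqrtr_gt0 divr_gt0// mulr_gt0// pi_gt0.
transitivity (\int[mu]_u ((Num.sqrt (2 * pi / s))%:E * (normal_pdf c sg u)%:E))%E.
  apply: eq_integral => u _; rewrite -EFinM; congr EFin.
  rewrite normal_pdfE// /normal_peak /normal_fun sg2.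
  have -> : s^-1 * pi *+ 2 = 2 * pi / s by ring.
  rewrite mulVKf ?lt0r_neq0//; congr expR.
  by rewrite -mulr_natr; field; exact: lt0r_neq0.
rewrite ge0_integralZl//.
- by rewrite integral_normal_pdf mule1.
- by apply/measurable_EFinP; exact: measurable_normal_pdf.
- by move=> u _; rewrite lee_fin normal_pdf_ge0.
Qed.

Lemma measurable_gauss (s c : R) :
  measurable_fun setT (fun u : R => expR (- s * (u - c) ^+ 2 / 2)).
Proof.
apply: measurableT_comp => //; apply: measurable_funM => //.
apply: measurable_funM => //; apply: measurable_funX.
exact: measurable_funB.
Qed.

Lemma gauss_integral_tilt (s c k : R) : 0 < s ->
  (\int[mu]_u (expR (- s * (u - c) ^+ 2 / 2 + k * (u - c)))%:E =
   (expR (k ^+ 2 / (2 * s)) * Num.sqrt (2 * pi / s))%:E)%E.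
Proof.
move=> s0; rewrite EFinM -(gauss_integral (c + k / s) s0) -ge0_integralZl//.
- apply: eq_integral => u _; rewrite -EFinM -expRD; congr (expR _)%:E.
  by field; rewrite lt0r_neq0.
- by apply/measurable_EFinP; exact: measurable_gauss.
Qed.

Definition phi1 (t : R) := (Num.sqrt (2 * pi))^-1 * expR (- t ^+ 2 / 2).

Lemma sqrt2pi_gt0 : 0 < Num.sqrt (2 * pi) :> R.
Proof. by rewrite sqrtr_gt0 mulr_gt0// pi_gt0. Qed.

Lemma phi1_ge0 t : 0 <= phi1 t.
Proof. by rewrite mulr_ge0 ?expR_ge0// invr_ge0 sqrtr_ge0. Qed.

Lemma continuous_phi1 : continuous phi1.
Proof.
move=> x; apply: cvgM; first exact: cvg_cst.
have h : - y ^+ 2 / 2 @[y --> x] --> - x ^+ 2 / 2.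
  by apply: cvgM; [apply: cvgN; exact: exprn_continuous|exact: cvg_cst].
exact: (cvg_comp _ _ h (@continuous_expR R _)).
Qed.

Lemma measurable_phi1 (a : R) : measurable_fun setT (fun t : R => phi1 (t - a)).
Proof.
apply: (measurableT_comp (continuous_measurable_fun continuous_phi1)).
exact: measurable_funB.
Qed.

Lemma integral_phi1_tilt a k : (\int[mu]_t (expR (k * t) * phi1 (t - a))%:E =
  (expR (k * a + k ^+ 2 / 2))%:E)%E.
Proof.
have P := sqrt2pi_gt0.
transitivity (\int[mu]_t ((expR (k * a) / Num.sqrt (2 * pi))%:E *
   (expR (- 1 * (t - a) ^+ 2 / 2 + k * (t - a)))%:E))%E.
  apply: eq_integral => u _; rewrite -EFinM; congr EFin.
  rewrite /phi1 mulrCA [RHS]mulrAC [RHS]mulrC; congr (_ * _).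
  by rewrite -!expRD; congr expR; rewrite mulN1r; ring.
rewrite ge0_integralZl//.
- rewrite gauss_integral_tilt// -EFinM; congr EFin.
  rewrite divr1 mulr1 expRD mulrACA -mulrA; congr (_ * _).
  by rewrite mulVf ?mulr1// lt0r_neq0.
- apply/measurable_EFinP; apply: measurableT_comp => //.
  apply: measurable_funD; apply: measurable_funM => //.
  + by apply: measurable_funM => //; apply: measurable_funX; exact: measurable_funB.
  + exact: measurable_funB.
Qed.

Section Dot.
Variable d : nat.
Implicit Types u v w : 'rV[R]_d.

Lemma dotvC u v : dotv u v = dotv v u.
Proof. by apply: eq_bigr => j _; rewrite mulrC. Qed.

Lemma dotvDl u v w : dotv (u + v) w = dotv u w + dotv v w.
Proof. by rewrite -big_split; apply: eq_bigr => j _ /=; rewrite mxE mulrDl. Qed.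

Lemma dotvZl a u v : dotv (a *: u) v = a * dotv u v.
Proof. by rewrite mulr_sumr; apply: eq_bigr => j _ /=; rewrite mxE mulrA. Qed.

Lemma dotvNl u v : dotv (- u) v = - dotv u v.
Proof. by rewrite -scaleN1r dotvZl mulN1r. Qed.

Lemma dotvDr u v w : dotv w (u + v) = dotv w u + dotv w v.
Proof. by rewrite dotvC dotvDl !(dotvC w). Qed.

Lemma dotvZr a u v : dotv v (a *: u) = a * dotv v u.
Proof. by rewrite dotvC dotvZl dotvC. Qed.

Lemma dotvNr u v : dotv v (- u) = - dotv v u.
Proof. by rewrite dotvC dotvNl dotvC. Qed.

Lemma dotvr0 v : dotv v 0 = 0.
Proof. by rewrite -(scale0r 0) dotvZr mul0r. Qed.

Lemma dotv_sumr (J : Type) (s : seq J) (f : J -> 'rV[R]_d) v :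
  dotv v (\sum_(i <- s) f i) = \sum_(i <- s) dotv v (f i).
Proof.
elim: s => [|i s IH]; last by rewrite !big_cons dotvDr IH.
by rewrite !big_nil /dotv big1// => j _; rewrite mxE mulr0.
Qed.

Lemma sqnormD u v : sqnorm (u + v) = sqnorm u + 2 * dotv u v + sqnorm v.
Proof. by rewrite /sqnorm dotvDl !dotvDr (dotvC v u); ring. Qed.

Lemma sqnormN u : sqnorm (- u) = sqnorm u.
Proof. by rewrite /sqnorm dotvNl dotvNr opprK. Qed.

Lemma sqnormZ a u : sqnorm (a *: u) = a ^+ 2 * sqnorm u.
Proof. by rewrite /sqnorm dotvZl dotvZr mulrA. Qed.

Lemma std_gauss_pdf_ge0 v : 0 <= std_gauss_pdf v.
Proof. by rewrite mulr_ge0 ?expR_ge0// invr_ge0 exprn_ge0// sqrtr_ge0. Qed.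

Lemma std_gauss_pdf_gt0 v : 0 < std_gauss_pdf v.
Proof. by rewrite mulr_gt0 ?expR_gt0// invr_gt0 exprn_gt0// sqrt2pi_gt0. Qed.

Lemma std_gauss_pdf_tilt c v w : expR (dotv c v) * std_gauss_pdf (v - w) =
  expR (dotv c w + sqnorm c / 2) * std_gauss_pdf (v - (w + c)).
Proof.
rewrite /std_gauss_pdf !(mulrCA (expR _)) -!expRD; congr (_ * expR _).
rewrite opprD addrA (sqnormD (v - w)) sqnormN dotvNr dotvDl dotvNl.
by rewrite (dotvC v c) (dotvC w c); field.
Qed.

End Dot.

Section MultivariateGaussian.
Variable d : nat.
Implicit Types (v w : 'rV[R]_d) (y : 'I_d -> R) (f g : 'rV[R]_d -> R).

Definition gpdf w y : R := std_gauss_pdf (rowv y - w).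

Lemma gpdf_ge0 w y : 0 <= gpdf w y. Proof. exact: std_gauss_pdf_ge0. Qed.

Lemma gpdf_prod w y : gpdf w y = \prod_j phi1 (y j - w 0 j).
Proof.
rewrite /gpdf /std_gauss_pdf /phi1 big_split/= prodr_const card_ord exprVn.
rewrite -expR_sum; congr (_ * expR _).
rewrite -mulr_suml; congr (_ / _); rewrite /sqnorm /dotv -sumrN.
by apply: eq_bigr => j _; rewrite !mxE expr2.
Qed.

Lemma cmeas_coord (I : eqType) (i : I) : cmeas (fun y : I -> R => y i).
Proof. by move=> d' T X mX; exact: mX. Qed.

Lemma cmeas_gpdf w : cmeas (gpdf w).
Proof.
have -> : gpdf w = (fun y => \prod_j phi1 (y j - w 0 j)).
  by apply/funext => y; exact: gpdf_prod.
apply: cmeas_prod => j; apply: (@cmeas_comp _ _ (fun y => y j - w 0 j)).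
  exact: continuous_phi1.
by apply: cmeasD; [exact: cmeas_coord|exact: cmeas_cst].
Qed.

Lemma intF_gpdf w : intF (fun y => (gpdf w y)%:E) = 1%E.
Proof.
under eq_fun do rewrite gpdf_prod -prodEFin.
rewrite (@intF_prod _ _ (fun j t => (phi1 (t - w 0 j))%:E)); last 2 first.
- by move=> j; apply/measurable_EFinP; exact: measurable_phi1.
- by move=> j t; rewrite lee_fin phi1_ge0.
rewrite big1// => j _; have := integral_phi1_tilt (w 0 j) 0.
under eq_integral do rewrite mul0r expR0 mul1r.
by rewrite expr0n/= !mul0r addr0 expR0.
Qed.

Definition l1norm v : R := \sum_j `|v 0 j|.

Lemma l1norm_ge0 v : 0 <= l1norm v. Proof. exact: sumr_ge0. Qed.

Lemma fint_gpdf_exp w (C : R) : 0 <= C ->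
  fint (fun y => expR (C * (1 + l1norm (rowv y))) * gpdf w y).
Proof.
move=> C0; have E y : expR (C * (1 + l1norm (rowv y))) * gpdf w y =
    expR C * \prod_j (expR (C * `|y j|) * phi1 (y j - w 0 j)).
  rewrite gpdf_prod mulrDr mulr1 expRD -mulrA; congr (_ * _).
  rewrite [RHS]big_split/=; congr (_ * _); rewrite -expR_sum; congr expR.
  by rewrite mulr_sumr; apply: eq_bigr => j _; rewrite mxE.
under eq_fun do rewrite E.
have mabs j : measurable_fun setT (fun t : R => expR (C * `|t|) * phi1 (t - w 0 j)).
  apply: measurable_funM; last exact: measurable_phi1.
  by apply: measurableT_comp => //; apply: measurable_funM.
apply: fintZ.
  apply: cmeas_prod => j d' T X mX.
  exact: (measurableT_comp (mabs j) (mX j)).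
have P0 (y : 'I_d -> R) : 0 <= \prod_j (expR (C * `|y j|) * phi1 (y j - w 0 j)).
  by apply: prodr_ge0 => j _; rewrite mulr_ge0 ?expR_ge0 ?phi1_ge0.
rewrite /fint; under eq_fun do rewrite ger0_norm// -prodEFin.
rewrite (@intF_prod _ _ (fun j t => (expR (C * `|t|) * phi1 (t - w 0 j))%:E)); last 2 first.
- by move=> j; apply/measurable_EFinP.
- by move=> j t; rewrite lee_fin mulr_ge0 ?expR_ge0 ?phi1_ge0.
suff fj j : exists r : R, (\int[mu]_t (expR (C * `|t|) * phi1 (t - w 0 j))%:E = r%:E)%E.
  rewrite (eq_bigr (fun j => (projT1 (cid (fj j)))%:E)); last first.
    by move=> j _; case: cid.
  by rewrite prodEFin ltry.
(* [exp (C |t|) <= exp (C t) + exp (- C t)] reduces the claim to Gaussian exponential moments. *)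
have le : (\int[mu]_t (expR (C * `|t|) * phi1 (t - w 0 j))%:E <=
  \int[mu]_t ((expR (C * t) * phi1 (t - w 0 j))%:E +
    (expR (- C * t) * phi1 (t - w 0 j))%:E))%E.
  apply: ge0_le_integral_nomeas => t.
    by rewrite lee_fin mulr_ge0 ?expR_ge0 ?phi1_ge0.
  rewrite -EFinD lee_fin -mulrDl ler_wpM2r ?phi1_ge0//.
  have [t0|t0] := leP 0 t; first by rewrite ger0_norm// lerDl expR_ge0.
  by rewrite ltr0_norm// mulrN mulNr lerDr expR_ge0.
have m1 (k : R) : measurable_fun setT (fun t : R => (expR (k * t) * phi1 (t - w 0 j))%:E).
  apply/measurable_EFinP; apply: measurable_funM; last exact: measurable_phi1.
  by apply: measurableT_comp => //; apply: measurable_funM.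
have p0 (k t : R) : (0 <= (expR (k * t) * phi1 (t - w 0 j))%:E)%E.
  by rewrite lee_fin mulr_ge0 ?expR_ge0 ?phi1_ge0.
move: le; rewrite (ge0_integralD mu measurableT (fun t _ => p0 C t) (m1 C)
  (fun t _ => p0 (- C) t) (m1 (- C))).
rewrite (integral_phi1_tilt _ C) (integral_phi1_tilt _ (- C)) => le.
set J := (\int[mu]_t _)%E in le *.
have J0 : (0 <= J)%E.
  by apply: integral_ge0 => t _; rewrite lee_fin mulr_ge0 ?expR_ge0 ?phi1_ge0.
have Jf : J \is a fin_num by rewrite ge0_fin_numE// (le_lt_trans le)// -EFinD ltry.
by exists (fine J); rewrite fineK.
Qed.

(** Exponential growth is stable under sums and products and integrable against every Gaussian
    density; the summand 1 lets constants be absorbed into [C]. *)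
Definition nice g : Prop := cmeas (fun y => g (rowv y)) /\
  exists C : R, 0 <= C /\ forall v, `|g v| <= expR (C * (1 + l1norm v)).

Lemma nice_fint g w : nice g -> fint (fun y => g (rowv y) * gpdf w y).
Proof.
case=> _ [C [C0 gC]]; apply: fint_le (fint_gpdf_exp w C0) => y.
by rewrite !normrM ler_wpM2r// (ger0_norm (expR_ge0 _)).
Qed.

Lemma nice_cmeas g w : nice g -> cmeas (fun y => g (rowv y) * gpdf w y).
Proof. by case=> mg _; apply: cmeasM => //; exact: cmeas_gpdf. Qed.

Lemma nice_bounded g (c : R) : cmeas (fun y => g (rowv y)) ->
  (forall v, `|g v| <= c) -> nice g.
Proof.
move=> mg gc; have c0 : 0 <= c by exact: le_trans (gc 0).
split => //; exists c; split => // v; apply: le_trans (gc v) _.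
apply: le_trans (expR_ge1Dx _); have := l1norm_ge0 v; nra.
Qed.

Lemma nice_cst (c : R) : nice (fun=> c).
Proof. by apply: (@nice_bounded _ `|c|) => //; exact: cmeas_cst. Qed.

Lemma niceM f g : nice f -> nice g -> nice (fun v => f v * g v).
Proof.
move=> [mf [C [C0 fC]]] [mg [D [D0 gD]]]; split; first exact: cmeasM.
exists (C + D); split => [|v]; first exact: addr_ge0.
by rewrite normrM mulrDl expRD ler_pM.
Qed.

Lemma niceD f g : nice f -> nice g -> nice (fun v => f v + g v).
Proof.
move=> [mf [C [C0 fC]]] [mg [D [D0 gD]]]; split; first exact: cmeasD.
(* The extra 1 yields a factor [exp (1 + l1norm v) >= 2], which suffices because [x + y <= 2 x y]
   for [x, y >= 1]. *)
exists (C + D + 1); split => [|v]; first by rewrite !addr_ge0.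
apply: le_trans (ler_normD _ _) _; apply: le_trans (lerD (fC v) (gD v)) _.
have : 1 <= 1 + l1norm v by rewrite lerDl l1norm_ge0.
move: (1 + _) => l l1; rewrite 2!mulrDl mul1r 2!expRD.
have e1 (x : R) : 0 <= x -> 1 <= expR x by move=> x0; rewrite -expR0 ler_expR.
have l0 : 0 <= l by exact: le_trans l1.
have := e1 _ (mulr_ge0 C0 l0); have := e1 _ (mulr_ge0 D0 l0); have := expR_ge1Dx l.
set x := expR (C * l); set y := expR (D * l); set z := expR l => z1 y1 x1.
have : x * y * 2 <= x * y * z by apply: ler_wpM2l; [nra|lra].
nra.
Qed.

Lemma niceZ (c : R) g : nice g -> nice (fun v => c * g v).
Proof. by move=> ng; apply: niceM => //; exact: nice_cst. Qed.

Lemma nice_norm g : nice g -> nice (fun v => `|g v|).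
Proof.
move=> [mg [C [C0 gC]]]; split; first exact: cmeas_norm.
by exists C; split => // v; rewrite normr_id.
Qed.

Lemma nice_coord j : nice (fun v => v 0 j).
Proof.
split; first by move=> d' T X mX; under eq_fun do rewrite mxE; exact: mX.
exists 1; split => // v; rewrite mul1r.
apply: le_trans (expR_ge1Dx _).
rewrite /l1norm (bigD1 j)//=.
have : 0 <= \sum_(i | i != j) `|v 0 i| by apply: sumr_ge0.
have := normr_ge0 (v 0 j); lra.
Qed.

Lemma nice_sum (J : Type) (s : seq J) (f : J -> 'rV[R]_d -> R) :
  (forall i, nice (f i)) -> nice (fun v => \sum_(i <- s) f i v).
Proof.
move=> nf; elim: s => [|i s IH].
  by under eq_fun do rewrite big_nil; exact: nice_cst.
by under eq_fun do rewrite big_cons; exact: niceD.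
Qed.

Lemma nice_dotv w : nice (dotv w).
Proof. by apply: nice_sum => j; apply: niceZ; exact: nice_coord. Qed.

Lemma nice_comp_dotv (k : R -> R) (a c : R) w : continuous k ->
  (forall t, `|k t| <= c) -> nice (fun v => k (a + dotv w v)).
Proof.
move=> ck kc; apply: (@nice_bounded _ c) => // d' T X mX.
apply: (measurableT_comp (continuous_measurable_fun ck)).
by apply: measurable_funD => //; exact: (nice_dotv w).1.
Qed.

Lemma nice_exp_dotv w : nice (fun v => expR (dotv w v)).
Proof.
split.
  by apply: (cmeas_comp (g := expR)); [exact: continuous_expR|exact: (nice_dotv w).1].
exists (l1norm w); split => [|v]; first exact: l1norm_ge0.
rewrite ger0_norm ?expR_ge0// ler_expR mulrDr mulr1.
rewrite -[X in X <= _]add0r lerD ?l1norm_ge0// /l1norm mulr_suml ler_sum// => j _.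
apply: le_trans (ler_norm _) _; rewrite normrM ler_wpM2l//.
rewrite (bigD1 j)//= lerDl; exact: sumr_ge0.
Qed.

End MultivariateGaussian.
End GaussianIntegrals.

(** * Concentration given the labels *)

Section GaussianExpectation.
Variables (R : realType) (d : nat).
Implicit Types (v w th : 'rV[R]_d) (f g : 'rV[R]_d -> R).

Definition gE w g : R := intF_real (fun y : 'I_d -> R => g (rowv y) * gpdf w y).

Lemma fint_gpdf w : fint (@gpdf R d w).
Proof.
by have := nice_fint w (nice_cst d 1); under eq_fun do rewrite mul1r.
Qed.

Lemma intF_real_gpdf w : intF_real (@gpdf R d w) = 1.
Proof. by rewrite intF_real_ge0 ?intF_gpdf// => y; exact: gpdf_ge0. Qed.

Lemma gEZ w c g : nice g -> gE w (fun v => c * g v) = c * gE w g.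
Proof.
move=> ng; rewrite /gE -intF_realZ; [|exact: nice_cmeas|exact: nice_fint].
by congr intF_real; apply/funext => y; rewrite mulrA.
Qed.

Lemma gED w f g : nice f -> nice g -> gE w (fun v => f v + g v) = gE w f + gE w g.
Proof.
move=> nf ng; rewrite /gE -intF_realD; try exact: nice_cmeas; try exact: nice_fint.
by congr intF_real; apply/funext => y; rewrite mulrDl.
Qed.

Lemma gE_cst w c : gE w (fun=> c) = c.
Proof.
rewrite /gE intF_realZ ?intF_real_gpdf ?mulr1//; [exact: cmeas_gpdf|exact: fint_gpdf].
Qed.

Lemma gEB w f g : nice f -> nice g -> gE w (fun v => f v - g v) = gE w f - gE w g.
Proof.
move=> nf ng; have -> : (fun v => f v - g v) = (fun v => f v + (- 1) * g v).
  by apply/funext => v; rewrite mulN1r.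
by rewrite gED ?gEZ ?mulN1r//; exact: niceZ.
Qed.

Lemma gE_le w f g : nice f -> nice g -> (forall v, f v <= g v) -> gE w f <= gE w g.
Proof.
move=> nf ng fg; apply: intF_real_le; try exact: nice_fint.
by move=> y; rewrite ler_wpM2r ?gpdf_ge0.
Qed.

Lemma gE_ge0 w g : nice g -> (forall v, 0 <= g v) -> 0 <= gE w g.
Proof. by move=> ng g0; rewrite -(gE_cst w 0); apply: gE_le => //; exact: nice_cst. Qed.

Lemma gE_tilt w c g : nice g ->
  gE w (fun v => expR (dotv c v) * g v) = expR (dotv c w + sqnorm c / 2) * gE (w + c) g.
Proof.
move=> ng; rewrite /gE -intF_realZ; [|exact: nice_cmeas|exact: nice_fint].
congr intF_real; apply/funext => y.
by rewrite mulrAC std_gauss_pdf_tilt mulrC mulrCA.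
Qed.

Lemma mix_expectE m th g : nice g ->
  mix_expect m th g = (1 + m) / 2 * gE th g + (1 - m) / 2 * gE (- th) g.
Proof.
move=> ng; rewrite /mix_expect /gE -!intF_realZ; try exact: nice_cmeas; try exact: nice_fint.
rewrite -intF_realD; last 4 first.
- by apply: cmeasM; [exact: cmeas_cst|exact: nice_cmeas].
- by apply: cmeasM; [exact: cmeas_cst|exact: nice_cmeas].
- by apply: fintZ; [exact: nice_cmeas|exact: nice_fint].
- by apply: fintZ; [exact: nice_cmeas|exact: nice_fint].
by congr intF_real; apply/funext => y; rewrite /gpdf opprK; ring.
Qed.

End GaussianExpectation.

Lemma sqrD_le (R : realType) (a b : R) : (a + b) ^+ 2 <= 2 * a ^+ 2 + 2 * b ^+ 2.
Proof. by have := sqr_ge0 (a - b); rewrite !expr2; nra. Qed.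

Lemma sqr_half_le (R : realType) (a b : R) : 2 * (a / 2 * b) ^+ 2 <= b ^+ 2 * a ^+ 2.
Proof. by have := mulr_ge0 (sqr_ge0 a) (sqr_ge0 b); rewrite !expr2; lra. Qed.

Section ConditionalLaw.
Variables (R : realType) (n d : nat).
Implicit Types (th : 'rV[R]_d) (g : 'rV[R]_d -> R) (z : {ffun 'I_n -> bool})
  (x : sample R n d).

Definition opps x : sample R n d := fun k => - x k.

Lemma obs_opps x i : obs (opps x) i = - obs x i.
Proof. by apply/rowP => j; rewrite !mxE. Qed.

(** Conditional density of the sample given the labels [z]. *)
Definition zpdf th z x : R := \prod_(i < n) std_gauss_pdf (obs x i - spin R (z i) *: th).

Lemma zpdf_ge0 th z x : 0 <= zpdf th z x.
Proof. by apply: prodr_ge0 => i _; exact: std_gauss_pdf_ge0. Qed.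

Lemma cmeas_zpdf th z : cmeas (zpdf th z).
Proof.
by apply: (@cmeas_prod_blk _ _ _ (fun i => gpdf (spin R (z i) *: th))) => i; exact: cmeas_gpdf.
Qed.

Lemma fint_zpdf th z : fint (zpdf th z).
Proof.
apply: (@fint_prod _ _ _ (fun i => gpdf (spin R (z i) *: th))) => i.
- exact: cmeas_gpdf.
- exact: fint_gpdf.
Qed.

Lemma intF_real_zpdf th z : intF_real (zpdf th z) = 1.
Proof.
rewrite (@intF_real_prod _ _ _ (fun i => gpdf (spin R (z i) *: th))).
- by apply: big1 => i _; exact: intF_real_gpdf.
- by move=> i; exact: cmeas_gpdf.
- by move=> i; exact: fint_gpdf.
Qed.

Definition flipz z : {ffun 'I_n -> bool} := [ffun i => ~~ z i].

Lemma spin_neg b : spin R (~~ b) = - spin R b.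
Proof. by case: b; rewrite /= ?opprK. Qed.

Lemma spin_mean_flipz z : spin_mean R (flipz z) = - spin_mean R z.
Proof.
rewrite /spin_mean -mulNr -sumrN; congr (_ / _).
by apply: eq_bigr => i _; rewrite ffunE spin_neg.
Qed.

Lemma zpdf_flipz th z x : zpdf th (flipz z) x = zpdf th z (opps x).
Proof.
apply: eq_bigr => i _; rewrite obs_opps ffunE spin_neg scaleNr -opprD.
by rewrite /std_gauss_pdf sqnormN opprK.
Qed.

Definition dev g e x : R := n%:R^-1 * (\sum_(i < n) g (obs x i)) - e.

(** The mean label is close to [m] or to [- m]. Reflecting the sample in the second case makes it
    look as if [|zbar|] were the mean label. *)
Definition signed z x : sample R n d := if 0 <= spin_mean R z then x else opps x.

Lemma cmeas_obs g (i : 'I_n) : nice g -> cmeas (fun x => g (obs x i)).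
Proof. by move=> [mg _]; exact: (cmeas_blk i mg). Qed.

Lemma cmeas_dev g e : nice g -> cmeas (dev g e).
Proof.
move=> ng; apply: cmeasD; last exact: cmeas_cst.
apply: cmeasM; first exact: cmeas_cst.
by apply: cmeas_sum => i; exact: cmeas_obs.
Qed.

Section Chebyshev.
Variables (g : 'rV[R]_d -> R) (th : 'rV[R]_d) (m : R).
Hypothesis ng : nice g.
Let G b := gE (spin R b *: th) g.
Let V b := gE (spin R b *: th) (fun v => (g v - G b) ^+ 2).
Let e := mix_expect m th g.
(** The first summand bounds the fluctuation given the labels, the second the bias due to
    [|zbar| != m]; the factor 2 comes from [sqrD_le]. *)
Definition cheb_const := 2 * (V true + V false) + (G true - G false) ^+ 2.

Let nc b : nice (fun v => g v - G b).
Proof. by apply: niceD => //; exact: nice_cst. Qed.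

Let nV b : nice (fun v => (g v - G b) ^+ 2).
Proof. by have := niceM (nc b) (nc b); under eq_fun do rewrite -expr2. Qed.

Let V0 b : 0 <= V b.
Proof. by apply: gE_ge0 => // v; exact: sqr_ge0. Qed.

Lemma cheb_const_ge0 : 0 <= cheb_const.
Proof. by rewrite addr_ge0 ?sqr_ge0// mulr_ge0// addr_ge0. Qed.

Let S z x := \sum_(i < n) (g (obs x i) - G (z i)).

Let centered z : fint (fun x => S z x ^+ 2 * zpdf th z x) /\
  intF_real (fun x => S z x ^+ 2 * zpdf th z x) = \sum_i V (z i).
Proof.
have H1 := @fint_second_moment R _ _ (fun i : 'I_n => gpdf (spin R (z i) *: th))
  (fun i y => g (rowv y) - G (z i)).
have H2 := @second_moment R _ _ (fun i : 'I_n => gpdf (spin R (z i) *: th))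
  (fun i y => g (rowv y) - G (z i)).
split; [apply: H1|apply: H2] => i; try exact: cmeas_gpdf; try exact: fint_gpdf;
  try exact: intF_real_gpdf; try exact: (nc _).1.
- exact: (nice_fint _ (nV (z i))).
- exact: (nice_fint _ (nV (z i))).
- have := gEB (spin R (z i) *: th) ng (nice_cst d (G (z i))).
  by rewrite gE_cst /gE -/(gE _ _) -/(G _) subrr.
Qed.

Hypothesis n0 : (0 < n)%N.

Let nE : n%:R = \sum_(i < n) 1 :> R.
Proof. by rewrite sumr_const card_ord. Qed.

Let bound z x : dev g e x ^+ 2 <=
  2 / n%:R ^+ 2 * S z x ^+ 2 + (G true - G false) ^+ 2 * (spin_mean R z - m) ^+ 2.
Proof.
have nR : 0 < n%:R :> R by rewrite ltr0n.
(* Given the labels, the expected average is affine in the mean label, and at mean label [m] it is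
   the mixture expectation [e]. *)
have E : dev g e x = n%:R^-1 * S z x + (spin_mean R z - m) / 2 * (G true - G false).
  rewrite /dev /S sumrB mulrBr -addrA; congr (_ + _).
  rewrite /e mix_expectE//; have -> : \sum_(i < n) G (z i) =
     n%:R * (G true + G false) / 2 + n%:R * spin_mean R z * (G true - G false) / 2.
    rewrite /spin_mean mulrCA divff ?lt0r_neq0// mulr1.
    rewrite nE !mulr_suml -big_split/=; apply: eq_bigr => i _.
    by case: (z i); rewrite /spin; move: (G true) (G false) => a b; lra.
  rewrite /G /spin scale1r scaleN1r; move: (gE _ _) (gE _ _) (spin_mean _ _) => a b c; field.
  exact: lt0r_neq0.
rewrite E; apply: le_trans (sqrD_le _ _) _.
apply: lerD; last exact: sqr_half_le.
by rewrite exprMn exprVn mulrA.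
Qed.

Let cS z : cmeas (fun x => S z x ^+ 2 * zpdf th z x).
Proof.
apply: cmeasM; last exact: cmeas_zpdf.
have cS : cmeas (S z).
  apply: cmeas_sum => i; apply: cmeasD; [exact: cmeas_obs|exact: cmeas_cst].
by have := cmeasM cS cS; under eq_fun do rewrite -expr2.
Qed.

Let plain z : fint (fun x => dev g e x ^+ 2 * zpdf th z x) /\
  intF_real (fun x => dev g e x ^+ 2 * zpdf th z x) <=
  cheb_const * (n%:R^-1 + (spin_mean R z - m) ^+ 2).
Proof.
have nR : 0 < n%:R :> R by rewrite ltr0n.
have [iS JS] := centered z.
pose D := (G true - G false) ^+ 2 * (spin_mean R z - m) ^+ 2.
pose B x := 2 / n%:R ^+ 2 * (S z x ^+ 2 * zpdf th z x) + D * zpdf th z x.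
have dB x : dev g e x ^+ 2 * zpdf th z x <= B x.
  by rewrite /B mulrA -mulrDl ler_wpM2r ?zpdf_ge0.
have iB : fint B.
  apply: fintD; [|apply: cmeasM; [exact: cmeas_cst|exact: cmeas_zpdf]| |].
  - by apply: cmeasM => //; exact: cmeas_cst.
  - exact: fintZ.
  - by apply: fintZ; [exact: cmeas_zpdf|exact: fint_zpdf].
have p0 x : 0 <= dev g e x ^+ 2 * zpdf th z x by rewrite mulr_ge0 ?sqr_ge0 ?zpdf_ge0.
have id : fint (fun x => dev g e x ^+ 2 * zpdf th z x).
  by apply: fint_le iB => x; rewrite !ger0_norm// (le_trans _ (dB x)).
split => //; apply: le_trans (intF_real_le dB id iB) _.
rewrite intF_realD; last 4 first.
- by apply: cmeasM => //; exact: cmeas_cst.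
- by apply: cmeasM; [exact: cmeas_cst|exact: cmeas_zpdf].
- exact: fintZ.
- by apply: fintZ; [exact: cmeas_zpdf|exact: fint_zpdf].
rewrite (intF_realZ _ (cS z) iS) (intF_realZ D (cmeas_zpdf th z) (fint_zpdf th z)).
rewrite intF_real_zpdf JS mulr1 /cheb_const mulrDr; apply: lerD.
- have sV : \sum_(i < n) V (z i) <= n%:R * (V true + V false).
    rewrite nE mulr_suml.
    apply: ler_sum => i _; rewrite mul1r; case: (z i).
      by rewrite lerDl.
    by rewrite lerDr.
  apply: le_trans (ler_wpM2l _ sV) _.
    by rewrite divr_ge0// sqr_ge0.
  rewrite [X in X <= _](_ : _ = 2 * (V true + V false) / n%:R); last first.
    move: (V true + V false) => w; field; exact: lt0r_neq0.
  by rewrite ler_wpM2r ?invr_ge0 ?ler0n// lerDl sqr_ge0.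
- rewrite /D ler_wpM2r ?sqr_ge0// lerDr mulr_ge0// addr_ge0//.
Qed.

(** Reflecting the sample amounts to flipping the labels in its conditional law, which reduces a
    negative mean label to a positive one. *)
Lemma chebyshev_z z :
  fint (fun x => dev g e (signed z x) ^+ 2 * zpdf th z x) /\
  intF_real (fun x => dev g e (signed z x) ^+ 2 * zpdf th z x) <=
  cheb_const * (n%:R^-1 + (`|spin_mean R z| - m) ^+ 2).
Proof.
rewrite /signed; case: leP => z0; first by rewrite ger0_norm//; exact: plain.
rewrite ltr0_norm// -spin_mean_flipz.
have [ip jp] := plain (flipz z).
have cp : cmeas (fun x => dev g e x ^+ 2 * zpdf th (flipz z) x).
  apply: cmeasM; last exact: cmeas_zpdf.
  by have := cmeasM (cmeas_dev e ng) (cmeas_dev e ng); under eq_fun do rewrite -expr2.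
have E x : dev g e (opps x) ^+ 2 * zpdf th z x =
   (fun x => dev g e x ^+ 2 * zpdf th (flipz z) x) (fun k => - x k).
  rewrite zpdf_flipz; congr (_ * zpdf _ _ _).
  by apply/funext => k; rewrite /opps opprK.
under eq_fun do rewrite E.
split; first exact: (fint_opp cp ip).
apply: le_trans jp.
by rewrite le_eqVlt; apply/orP; left; apply/eqP; exact: (intF_real_opp cp).
Qed.
End Chebyshev.

End ConditionalLaw.

(** * Gaussian moments on the line *)

Section LineIntegral.
Variable R : realType.
Local Notation mu := (@lebesgue_measure R).
Implicit Types (f g : R -> R) (s c k : R).

Definition integ f := mu.-integrable setT (EFin \o f).
Definition L f : R := \int[mu]_u f u.

Lemma integ_measurable f : integ f -> measurable_fun [set: measurableTypeR R] f.
Proof. by move=> /measurable_int/measurable_EFinP. Qed.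

Lemma integ_ge0 f r : measurable_fun [set: measurableTypeR R] f -> (forall u, 0 <= f u) ->
  (\int[mu]_u (f u)%:E = r%:E)%E -> integ f /\ L f = r.
Proof.
move=> mf f0 e; split; last by rewrite /L /Rintegral e.
apply/integrableP; split; first exact/measurable_EFinP.
by under eq_integral do rewrite gee0_abs ?lee_fin//; rewrite e ltry.
Qed.

Lemma L_gauss s c : 0 < s -> integ (fun u => expR (- s * (u - c) ^+ 2 / 2)) /\
  L (fun u => expR (- s * (u - c) ^+ 2 / 2)) = Num.sqrt (2 * pi / s).
Proof.
move=> s0; apply: integ_ge0 => //; last exact: gauss_integral.
exact: measurable_gauss.
Qed.

Lemma L_gauss_tilt s c k : 0 < s ->
  integ (fun u => expR (- s * (u - c) ^+ 2 / 2 + k * (u - c))) /\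
  L (fun u => expR (- s * (u - c) ^+ 2 / 2 + k * (u - c))) =
    expR (k ^+ 2 / (2 * s)) * Num.sqrt (2 * pi / s).
Proof.
move=> s0; apply: integ_ge0 => //; last exact: gauss_integral_tilt.
apply: measurableT_comp => //; apply: measurable_funD; apply: measurable_funM => //.
- by apply: measurable_funM => //; apply: measurable_funX; exact: measurable_funB.
- exact: measurable_funB.
Qed.

Lemma integD f g : integ f -> integ g -> integ (fun u => f u + g u).
Proof. exact: integrableD. Qed.

Lemma LD f g : integ f -> integ g -> L (fun u => f u + g u) = L f + L g.
Proof. by move=> ? ?; exact: RintegralD. Qed.

Lemma integZ c f : integ f -> integ (fun u => c * f u).
Proof.
move=> iF; rewrite /integ (_ : EFin \o _ = (fun x => (c%:E * (EFin \o f) x)%E)).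
  exact: integrableZl.
exact/funext.
Qed.

Lemma LZ c f : integ f -> L (fun u => c * f u) = c * L f.
Proof. by move=> ?; exact: RintegralZl. Qed.

Lemma integ_sum (J : Type) (r : seq J) (F : J -> R -> R) : (forall j, integ (F j)) ->
  integ (fun u => \sum_(j <- r) F j u).
Proof.
move=> iF; elim: r => [|j r IH].
  under eq_fun do rewrite big_nil; exact: (integrable0 mu).
by under eq_fun do rewrite big_cons; exact: integD.
Qed.

Lemma L_sum (J : Type) (r : seq J) (F : J -> R -> R) : (forall j, integ (F j)) ->
  L (fun u => \sum_(j <- r) F j u) = \sum_(j <- r) L (F j).
Proof.
move=> iF; elim: r => [|j r IH].
  under eq_fun do rewrite big_nil; rewrite big_nil.
  by rewrite /L /Rintegral integral0.
under eq_fun do rewrite big_cons.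
by rewrite LD ?IH ?big_cons//; exact: integ_sum.
Qed.

Lemma L_le f g : integ f -> integ g -> (forall u, f u <= g u) -> L f <= L g.
Proof. by move=> ? ? fg; apply: le_Rintegral. Qed.

Lemma L_norm f : integ f -> `|L f| <= L (fun u => `|f u|).
Proof. by move=> ?; exact: le_normr_Rintegral. Qed.

Lemma integ_le f g : measurable_fun [set: measurableTypeR R] f -> integ g ->
  (forall u, `|f u| <= g u) -> integ f.
Proof.
move=> mf ig fg; apply: (le_integrable measurableT _ _ ig); first exact/measurable_EFinP.
by move=> u _ /=; rewrite lee_fin (le_trans (fg u))// ler_norm.
Qed.

Lemma integ_norm f : integ f -> integ (fun u => `|f u|).
Proof. by move=> iF; exact: (integrable_norm iF). Qed.

(* The class of integrands of the posterior of the latent field [u]. *)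
Definition gdom s f := measurable_fun [set: measurableTypeR R] f /\
  exists A K : R, [/\ 0 <= A, 0 <= K & forall u, `|f u| <= A * expR (- s * u ^+ 2 / 2 + K * `|u|)].

Lemma gdom_integ s f : 0 < s -> gdom s f -> integ f.
Proof.
move=> s0 [mf [A [K [A0 K0 fA]]]].
have [i1 _] := L_gauss_tilt 0 K s0; have [i2 _] := L_gauss_tilt 0 (- K) s0.
apply: (@integ_le f _ mf (integZ A (integD i1 i2))) => u.
apply: le_trans (fA u) _; rewrite subr0 ler_wpM2l//.
have [u0|u0] := leP 0 u; first by rewrite ger0_norm// lerDl expR_ge0.
by rewrite ltr0_norm// mulrN -(mulNr K) lerDr expR_ge0.
Qed.

Lemma gdomD s f g : gdom s f -> gdom s g -> gdom s (fun u => f u + g u).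
Proof.
move=> [mf [A [K [A0 K0 fA]]]] [mg [B [J [B0 J0 gB]]]].
split; first exact: measurable_funD.
exists (A + B), (K + J); split; try exact: addr_ge0.
move=> u; apply: le_trans (ler_normD _ _) _; rewrite mulrDl lerD//.
- by apply: le_trans (fA u) _; rewrite ler_wpM2l// ler_expR lerD2l ler_wpM2r// lerDl.
- by apply: le_trans (gB u) _; rewrite ler_wpM2l// ler_expR lerD2l ler_wpM2r// lerDr.
Qed.

Lemma gdomM s f g (A K : R) : gdom s f -> measurable_fun [set: measurableTypeR R] g ->
  0 <= A -> 0 <= K -> (forall u, `|g u| <= A * expR (K * `|u|)) ->
  gdom s (fun u => g u * f u).
Proof.
move=> [mf [B [J [B0 J0 fB]]]] mg A0 K0 gA; split; first exact: measurable_funM.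
exists (A * B), (K + J); split; [exact: mulr_ge0|exact: addr_ge0|move=> u].
rewrite normrM; apply: le_trans (ler_pM _ _ (gA u) (fB u)) _ => //.
rewrite mulrACA ler_wpM2l ?mulr_ge0// -expRD ler_expR.
by rewrite mulrDl addrCA.
Qed.

Lemma gdomZ s c f : gdom s f -> gdom s (fun u => c * f u).
Proof.
move=> gf; apply: (gdomM gf _ (normr_ge0 c) (lexx 0)); first exact: measurable_cst.
by move=> u; rewrite mul0r expR0 mulr1.
Qed.

Lemma gdom_bound s f g c : gdom s f -> measurable_fun [set: measurableTypeR R] g ->
  (forall u, `|g u| <= c) -> gdom s (fun u => g u * f u).
Proof.
move=> gf mg gc; have c0 : 0 <= c by exact: le_trans (gc 0).
by apply: (gdomM gf mg c0 (lexx 0)) => u; rewrite mul0r expR0 mulr1.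
Qed.

Lemma gdom_id s f : gdom s f -> gdom s (fun u => u * f u).
Proof.
move=> gf; apply: (gdomM (A := 1) (K := 1) gf) => // u.
by rewrite !mul1r (le_trans _ (expR_ge1Dx _))// lerDr.
Qed.

Lemma gdom_sum s (J : Type) (r : seq J) (F : J -> R -> R) : (forall j, gdom s (F j)) ->
  gdom s (fun u => \sum_(j <- r) F j u).
Proof.
move=> iF; elim: r => [|j r IH].
  under eq_fun do rewrite big_nil; split; first exact: measurable_cst.
  by exists 0, 0; split => // u; rewrite normr0 mul0r.
by under eq_fun do rewrite big_cons; exact: gdomD.
Qed.

Lemma gdom_exp s k : gdom s (fun u => expR (- s * u ^+ 2 / 2 + k * u)).
Proof.
split.
  apply: measurableT_comp => //; apply: measurable_funD; apply: measurable_funM => //.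
  by apply: measurable_funM => //; apply: measurable_funX.
exists 1, `|k|; split => // u; rewrite mul1r ger0_norm ?expR_ge0// ler_expR lerD2l.
by rewrite -normrM ler_norm.
Qed.

Lemma L_reflect f c : integ f -> L (fun u => f (c - u)) = L f.
Proof.
move=> iF; rewrite /L /Rintegral [in RHS]integralE [in LHS]integralE.
have mf : measurable_fun [set: R] (EFin \o f) by exact: measurable_int iF.
rewrite -(integral_lebesgue_reflect c (f := (EFin \o f)^\+%E)); last 2 first.
- exact: measurable_funepos.
- by move=> u; exact: funepos_ge0.
rewrite -(integral_lebesgue_reflect c (f := (EFin \o f)^\-%E)); last 2 first.
- exact: measurable_funeneg.
- by move=> u; exact: funeneg_ge0.
by congr (fine (_ - _)); apply: eq_integral => u _; rewrite (funeposE, funenegE) (funeposE, funenegE).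
Qed.

Lemma L_gauss_odd s c : 0 < s ->
  L (fun u => (u - c) * expR (- s * (u - c) ^+ 2 / 2)) = 0.
Proof.
move=> s0; pose f u := (u - c) * expR (- s * (u - c) ^+ 2 / 2).
have iF : integ f.
  have := gdom_exp s (s * c) => gd.
  have E u : f u = expR (- s * c ^+ 2 / 2) * (u * expR (- s * u ^+ 2 / 2 + s * c * u)
     + (- c) * expR (- s * u ^+ 2 / 2 + s * c * u)).
    by rewrite /f -mulrDl [RHS]mulrCA -[in RHS]expRD; congr (_ * expR _); field.
  apply: (gdom_integ s0); have := gdomZ (expR (- s * c ^+ 2 / 2))
    (gdomD (gdom_id gd) (gdomZ (- c) gd)).
  by under eq_fun do rewrite -E.
have := L_reflect (2 * c) iF.
have -> : (fun u => f (2 * c - u)) = (fun u => (- 1) * f u).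
  apply/funext => u; rewrite /f.
  by rewrite (_ : 2 * c - u - c = - (u - c)) ?sqrrN ?mulN1r ?mulNr//; ring.
by rewrite LZ// mulN1r -/f; lra.
Qed.

(** Half of the Gaussian exponent is spent on the polynomial factor, through [y <= exp y] at
    [y = s t ^ 2 / 4]. *)
Lemma gauss_sqr_le s t : 0 < s ->
  t ^+ 2 * expR (- s * t ^+ 2 / 2) <= 4 / s * expR (- (s / 2) * t ^+ 2 / 2).
Proof.
move=> s0; have -> : - s * t ^+ 2 / 2 = - (s / 2) * t ^+ 2 / 2 - s * t ^+ 2 / 4 by field.
rewrite expRD mulrCA mulrC ler_wpM2r ?expR_ge0//.
have h := expR_ge1Dx (s * t ^+ 2 / 4).
have e0 := expR_gt0 (- (s * t ^+ 2 / 4)).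
have e1 : expR (- (s * t ^+ 2 / 4)) * expR (s * t ^+ 2 / 4) = 1.
  by rewrite -expRD addNr expR0.
rewrite ler_pdivlMr// mulrAC.
by have := ler_wpM2l (ltW e0) h; rewrite e1; lra.
Qed.

(** The exact constant is 1 instead of 8; only the order [1 / s] matters. The loss comes from
    [gauss_sqr_le] and from [sqrt 2 <= 2]. *)
Lemma L_gauss_sqr s c : 0 < s ->
  integ (fun u => (u - c) ^+ 2 * expR (- s * (u - c) ^+ 2 / 2)) /\
  L (fun u => (u - c) ^+ 2 * expR (- s * (u - c) ^+ 2 / 2)) <=
    8 / s * Num.sqrt (2 * pi / s).
Proof.
move=> s0; have s2 : 0 < s / 2 by exact: divr_gt0.
have [ig Lg] := L_gauss c s2.
have le u : (u - c) ^+ 2 * expR (- s * (u - c) ^+ 2 / 2) <=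
   4 / s * expR (- (s / 2) * (u - c) ^+ 2 / 2) by exact: gauss_sqr_le.
have iq : integ (fun u => (u - c) ^+ 2 * expR (- s * (u - c) ^+ 2 / 2)).
  apply: (integ_le _ (integZ (4 / s) ig)) => [|u].
    apply: measurable_funM; last exact: measurable_gauss.
    by apply: measurable_funX; exact: measurable_funB.
  by rewrite ger0_norm// mulr_ge0 ?expR_ge0// sqr_ge0.
split => //; apply: le_trans (L_le iq (integZ (4 / s) ig) le) _.
rewrite LZ// Lg; have -> : 8 / s = 4 / s * 2 by ring.
rewrite -(mulrA (4 / s)); apply: ler_wpM2l; first by rewrite divr_ge0// ltW.
have -> : 2 * pi / (s / 2) = 2 * (2 * pi / s) :> R by field; exact: lt0r_neq0.
move: (2 * pi / s) => q; rewrite sqrtrM// ler_wpM2r ?sqrtr_ge0//.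
rewrite -[leRHS](@ger0_norm _ 2)// -sqrtr_sqr ler_wsqrtr// expr2; lra.
Qed.

End LineIntegral.

(** * Hubbard-Stratonovich linearisation *)

Section HubbardStratonovich.
Variables (R : realType) (n : nat) (beta : R) (a : 'I_n -> R).
Hypotheses (n0 : (0 < n)%N) (b0 : 0 < beta).
Implicit Types (w : {ffun 'I_n -> bool}) (u : R).
Let s := n%:R * beta.

Let nR : 0 < n%:R :> R. Proof. by rewrite ltr0n. Qed.
Let s0 : 0 < s. Proof. exact: mulr_gt0. Qed.

Definition cw_wt w : R :=
  expR (n%:R * beta * spin_mean R w ^+ 2 / 2 + \sum_(i < n) spin R (w i) * a i).

Definition field_wt u := expR (- s * u ^+ 2 / 2) * \prod_(i < n) coshR (beta * u + a i).

(** Unnormalised joint weight of the spins and the latent field: integrating out [u] gives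
    [cw_wt w], and summing out [w] gives [field_wt u], both up to constants. *)
Definition joint_wt w u :=
  expR (- s * u ^+ 2 / 2) * \prod_(i < n) expR (spin R (w i) * (beta * u + a i)).

Lemma sum_spin w : \sum_(i < n) spin R (w i) = n%:R * spin_mean R w.
Proof. by rewrite /spin_mean mulrCA divff ?lt0r_neq0// mulr1. Qed.

Lemma joint_wt_gauss w u :
  joint_wt w u = cw_wt w * expR (- s * (u - spin_mean R w) ^+ 2 / 2).
Proof.
rewrite /joint_wt /cw_wt -expR_sum -!expRD; congr expR.
under eq_bigr do rewrite mulrDr.
by rewrite big_split/= -mulr_suml sum_spin /s; field.
Qed.

Let Q := Num.sqrt (2 * pi / s).
Let Q0 : 0 < Q.
Proof. by rewrite sqrtr_gt0 divr_gt0// mulr_gt0// pi_gt0. Qed.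

Lemma gdom_joint_wt w : gdom s (joint_wt w).
Proof.
have -> : joint_wt w = (fun u => cw_wt w * expR (- s * spin_mean R w ^+ 2 / 2) *
    expR (- s * u ^+ 2 / 2 + s * spin_mean R w * u)).
  by apply/funext => u; rewrite joint_wt_gauss -[RHS]mulrA; congr (_ * _);
    rewrite -expRD; congr expR; field.
by apply: gdomZ; exact: gdom_exp.
Qed.

Lemma L_joint_wt w : L (joint_wt w) = cw_wt w * Q.
Proof.
have -> : joint_wt w = fun u => cw_wt w * expR (- s * (u - spin_mean R w) ^+ 2 / 2).
  by apply/funext => u; exact: joint_wt_gauss.
by have [i1 e1] := L_gauss (spin_mean R w) s0; rewrite LZ// e1.
Qed.

Lemma L_joint_wt_id w : L (fun u => u * joint_wt w u) = spin_mean R w * L (joint_wt w).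
Proof.
have gj := gdom_joint_wt w.
have i1 := gdom_integ s0 (gdom_id gj); have i2 := gdom_integ s0 gj.
have := L_gauss_odd (spin_mean R w) s0.
have := LD i1 (integZ (- spin_mean R w) i2); rewrite LZ//.
have -> : (fun u => u * joint_wt w u + - spin_mean R w * joint_wt w u) =
   (fun u => cw_wt w * ((u - spin_mean R w) * expR (- s * (u - spin_mean R w) ^+ 2 / 2))).
  by apply/funext => u; rewrite -mulrDl joint_wt_gauss mulrCA.
move=> e1 e2; rewrite LZ in e1.
  by move: e1; rewrite e2 mulr0 mulNr => /eqP; rewrite eq_sym subr_eq0 => /eqP.
have := integZ (cw_wt w)^-1 (integD i1 (integZ (- spin_mean R w) i2)).
rewrite (_ : (fun u => _) = (fun u => (u - spin_mean R w) *
  expR (- s * (u - spin_mean R w) ^+ 2 / 2)))//; apply/funext => u.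
by rewrite -mulrDl joint_wt_gauss mulrCA mulKf// lt0r_neq0// expR_gt0.
Qed.

Lemma sum_prod_spin (t : 'I_n -> R) :
  \sum_(w : {ffun 'I_n -> bool}) \prod_(i < n) expR (spin R (w i) * t i) =
  2 ^+ n * \prod_(i < n) coshR (t i).
Proof.
rewrite -(bigA_distr_bigA (fun i b => expR (spin R b * t i)))/=.
rewrite -[n in _ ^+ n]card_ord -prodr_const -big_split/=; apply: eq_bigr => i _.
by rewrite big_bool/= mul1r mulN1r /coshR mulrC divfK.
Qed.

Lemma sum_joint_wt u : \sum_w joint_wt w u = 2 ^+ n * field_wt u.
Proof. by rewrite -mulr_sumr sum_prod_spin mulrCA. Qed.

(** Given [u], spin [k] has mean [tanhR (beta * u + a k)]: its two exponentials are summed with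
    signs, giving [sinh] where the other sites give [cosh]. *)
Lemma sum_spin_joint_wt k u :
  \sum_(w : {ffun 'I_n -> bool}) spin R (w k) * joint_wt w u = 2 ^+ n * (tanhR (beta * u + a k) * field_wt u).
Proof.
under eq_bigr do rewrite /joint_wt mulrCA.
rewrite -mulr_sumr /field_wt (mulrCA (tanhR _)) [RHS]mulrCA.
congr (_ * _); set t := fun i => beta * u + a i.
pose F i b := (if i == k then spin R b else 1) * expR (spin R b * t i).
have E w : spin R (w k) * \prod_(i < n) expR (spin R (w i) * t i) = \prod_i F i (w i).
  rewrite /F big_split/=; congr (_ * _).
  by rewrite (bigD1 k)//= eqxx big1 ?mulr1// => i /negbTE ->.
under eq_bigr do rewrite E; rewrite -(bigA_distr_bigA F)/=.
rewrite -[n in _ ^+ n]card_ord -prodr_const.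
have -> : tanhR (beta * u + a k) = \prod_(i < n) (if i == k then tanhR (t k) else 1).
  by rewrite (bigD1 k)//= eqxx big1 ?mulr1// => i /negbTE ->.
rewrite -!big_split/=; apply: eq_bigr => i _; rewrite big_bool /F /=.
have c0 := lt0r_neq0 (coshR_gt0 (t i)).
case: eqP => [<-|_]; rewrite !mul1r !mulN1r.
  by rewrite tanhRE divfK// mulrC divfK.
by rewrite /coshR mulrC divfK.
Qed.

Let P2 : 2 ^+ n != 0 :> R. Proof. by rewrite expf_neq0. Qed.

Lemma gdom_field_wt : gdom s field_wt.
Proof.
have -> : field_wt = fun u => (2 ^+ n)^-1 * \sum_(w <- enum {ffun 'I_n -> bool}) joint_wt w u.
  by apply/funext => u; rewrite big_enum sum_joint_wt mulKf.
by apply: gdomZ; apply: gdom_sum => w; exact: gdom_joint_wt.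
Qed.

Lemma L_sum_w (F : {ffun 'I_n -> bool} -> R -> R) : (forall w, integ (F w)) ->
  L (fun u => \sum_w F w u) = \sum_w L (F w).
Proof.
move=> iF; rewrite -big_enum -L_sum//; congr (L _); apply/funext => u.
by rewrite big_enum.
Qed.

Lemma hs_partition : Q * \sum_w cw_wt w = 2 ^+ n * L field_wt.
Proof.
rewrite -LZ; last exact: (gdom_integ s0 gdom_field_wt).
rewrite (_ : (fun u => 2 ^+ n * _) = (fun u => \sum_w joint_wt w u)); last first.
  by apply/funext => u; rewrite sum_joint_wt.
rewrite L_sum_w => [|w].
  by rewrite mulr_sumr; apply: eq_bigr => w _; rewrite L_joint_wt mulrC.
exact: (gdom_integ s0 (gdom_joint_wt w)).
Qed.

Lemma gdom_tanh k : gdom s (fun u => tanhR (beta * u + a k) * field_wt u).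
Proof.
apply: (gdom_bound gdom_field_wt) => [|u]; last exact/ltW/tanhR_norm_lt1.
apply: (measurableT_comp (continuous_measurable_fun (@continuous_tanhR R))).
by apply: measurable_funD => //; apply: measurable_funM.
Qed.

Lemma hs_spin k : Q * \sum_(w : {ffun 'I_n -> bool}) spin R (w k) * cw_wt w =
  2 ^+ n * L (fun u => tanhR (beta * u + a k) * field_wt u).
Proof.
rewrite -LZ; last exact: (gdom_integ s0 (gdom_tanh k)).
rewrite (_ : (fun u => 2 ^+ n * _) =
  (fun u => \sum_(w : {ffun 'I_n -> bool}) spin R (w k) * joint_wt w u)); last first.
  by apply/funext => u; rewrite sum_spin_joint_wt.
rewrite L_sum_w => [|w].
  rewrite mulr_sumr; apply: eq_bigr => w _; rewrite LZ ?L_joint_wt; first by ring.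
  exact: (gdom_integ s0 (gdom_joint_wt w)).
by apply: integZ; exact: (gdom_integ s0 (gdom_joint_wt w)).
Qed.

(* Conditionally on the spins, [u] is Gaussian around their mean: this exact
   identity replaces the second-order term of the Laplace expansion. *)
Lemma L_stationary : L (fun u =>
  (u - n%:R^-1 * \sum_(k < n) tanhR (beta * u + a k)) * field_wt u) = 0.
Proof.
have gj w := gdom_integ s0 (gdom_joint_wt w).
have iu := gdom_integ s0 (gdom_id gdom_field_wt).
have it k := gdom_integ s0 (gdom_tanh k).
have -> : (fun u => (u - n%:R^-1 * \sum_(k < n) tanhR (beta * u + a k)) * field_wt u) =
  (fun u => u * field_wt u + (- n%:R^-1) * \sum_(k <- enum 'I_n) tanhR (beta * u + a k) * field_wt u).
  by apply/funext => u; rewrite mulrBl big_enum/= mulNr -mulrA mulr_suml.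
rewrite LD//; last by apply: integZ; exact: integ_sum.
rewrite LZ ?L_sum//; last exact: integ_sum.
apply: (mulfI P2); rewrite mulr0 mulrDr mulrCA -[X in X + _]LZ//.
have -> : (fun u => 2 ^+ n * (u * field_wt u)) = (fun u => \sum_w u * joint_wt w u).
  by apply/funext => u; rewrite -mulr_sumr sum_joint_wt mulrCA.
rewrite L_sum_w; last by move=> w; exact: (gdom_integ s0 (gdom_id (gdom_joint_wt w))).
rewrite big_enum mulr_sumr; under [X in _ + _ * X]eq_bigr do rewrite -hs_spin.
rewrite (eq_bigr (fun w => Q * (spin_mean R w * cw_wt w))); last first.
  by move=> w _; rewrite L_joint_wt_id L_joint_wt mulrA [RHS]mulrC.
rewrite -!mulr_sumr exchange_big/=.
rewrite [X in _ + _ * (_ * X)](eq_bigr (fun w => n%:R * (spin_mean R w * cw_wt w))).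
  by rewrite -mulr_sumr mulNr mulrCA (mulrA n%:R^-1) mulVf ?mul1r ?subrr// lt0r_neq0.
by move=> w _; rewrite -mulr_suml sum_spin mulrA.
Qed.

Definition field_obj u := beta * u ^+ 2 / 2 - n%:R^-1 * \sum_(i < n) lcosh (beta * u + a i).

Lemma field_wtE u : field_wt u = expR (- (n%:R * field_obj u)).
Proof.
rewrite /field_wt /field_obj mulrBr mulVKf ?lt0r_neq0// opprB addrC expRD expR_sum.
congr (_ * _); last by apply: eq_bigr => i _; rewrite lnK// posrE coshR_gt0.
by congr expR; rewrite /s; field.
Qed.

End HubbardStratonovich.

(** * The mean-field objective *)

Section QuadraticGrowth.
Variable R : realType.
Implicit Types (u v m : R) (F : R -> R).

Lemma interval_gap F (a b K : R) : continuous F ->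
  (forall u, a <= u <= b -> K < F u) ->
  exists2 eta, 0 < eta & forall u, a <= u <= b -> K + eta <= F u.
Proof.
move=> cF FK; have [ab|ba] := leP a b; last first.
  by exists 1 => // u /andP[au ub]; have := le_lt_trans (le_trans au ub) ba; rewrite ltxx.
have [c cab cmin] := EVT_min ab (continuous_subspaceT cF).
exists (F c - K); first by rewrite subr_gt0 FK.
by move=> u uab; rewrite addrC subrK cmin.
Qed.

(** The points at distance at least [delta] form at most two compact intervals, possibly empty, and
    a continuous function attains its minimum on each. *)
Lemma minimum_gap F (lo hi m delta : R) : continuous F -> 0 < delta ->
  (forall u, lo <= u <= hi -> u != m -> F m < F u) ->
  exists2 eta, 0 < eta & forall u, lo <= u <= hi -> delta <= `|u - m| -> F m + eta <= F u.
Proof.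
move=> cF d0 Fm.
have [e1 e10 h1] : exists2 eta, 0 < eta & forall u, lo <= u <= Num.min hi (m - delta) -> F m + eta <= F u.
  apply: interval_gap => // u; rewrite le_min => /and3P[lu uh um].
  by apply: Fm; rewrite ?lu//; apply/eqP; lra.
have [e2 e20 h2] : exists2 eta, 0 < eta & forall u, Num.max lo (m + delta) <= u <= hi -> F m + eta <= F u.
  apply: interval_gap => // u; rewrite ge_max => /andP[/andP[lu um] uh].
  by apply: Fm; rewrite ?lu//; apply/eqP; lra.
exists (Num.min e1 e2); first by rewrite lt_min e10.
move=> u /andP[lu uh]; have [um|mu] := leP m u => du.
- apply: (@le_trans _ _ (F m + e2)); first by rewrite lerD2l ge_min lexx orbT.
  by apply: h2; rewrite ge_max lu uh andbT/=; move: du; rewrite ger0_norm; lra.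
- apply: (@le_trans _ _ (F m + e1)); first by rewrite lerD2l ge_min lexx.
  by apply: h1; rewrite le_min lu uh/=; move: du; rewrite ltr0_norm; lra.
Qed.

(** Glues three regimes: curvature near [U], a gap on the rest of [[-1, 1]] where
    [(u - U) ^ 2 <= 4], and growth outside. There [(|u| + 1) ^ 2 <= 2 (|u| - 1) ^ 2 + 8] explains
    the requirements [c <= b / 4] and [c <= eta / 8]. *)
Lemma quadratic_growth (D u U delta c1 eta b c : R) : `|U| <= 1 -> 0 < c ->
  c <= c1 -> c <= eta / 8 -> c <= b / 4 ->
  (`|u - U| <= delta -> c1 * (u - U) ^+ 2 <= D) ->
  (`|u| <= 1 -> delta <= `|u - U| -> eta <= D) ->
  (1 < `|u| -> eta + b * (`|u| - 1) ^+ 2 / 2 <= D) ->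
  c * (u - U) ^+ 2 <= D.
Proof.
move=> U1 c0 c1c ce cb near mid tail.
have tri : (u - U) ^+ 2 <= (`|u| + 1) ^+ 2.
  rewrite -real_normK ?num_real// lerXn2r ?nnegrE ?addr_ge0//.
  by apply: le_trans (ler_normB _ _) _; rewrite lerD2l.
have [u1|u1] := leP `|u| 1; last first.
  apply: le_trans (tail u1); have t := ler_wpM2l (ltW c0) tri.
  apply: le_trans t _; set y := `|u| - 1; have -> : `|u| + 1 = y + 2 by rewrite /y; ring.
  have y0 : 0 <= y by rewrite /y; lra.
  by have := sqr_ge0 (y - 2); have := sqr_ge0 y; nra.
have [du|du] := leP `|u - U| delta.
  by apply: le_trans (near du); rewrite ler_wpM2r// sqr_ge0.
apply: le_trans (mid u1 (ltW du)).
have : (`|u| + 1) ^+ 2 <= 4 by have := normr_ge0 u; nra.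
by have := ler_wpM2l (ltW c0) tri; nra.
Qed.

End QuadraticGrowth.

Lemma is_derive_scale (R : realType) (b x : R) : is_derive x 1 (fun t : R => b * t) b.
Proof. by have := is_derive_affine 0 b x; under eq_fun do rewrite add0r. Qed.

Section MeanField.
Variables (R : realType) (beta m : R).
Hypotheses (b1 : 1 < beta) (m0 : 0 < m) (mE : m = tanhR (beta * m)).
Let b0 : 0 < beta. Proof. exact: lt_trans b1. Qed.
Implicit Types u v : R.

Lemma meanfield_lt1 : m < 1.
Proof. by have := tanhR_norm_lt1 (beta * m); rewrite -mE ger0_norm// ltW. Qed.

Let T v := tanhR (beta * v).

Let dT v : is_derive v 1 T (beta * sech2 (beta * v)).
Proof.
have h := is_derive_scale beta v.
by have := is_derive1_comp (is_derive_tanhR (beta * v)) h; rewrite mulrC.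
Qed.

Let mvtT (a b : R) : a < b ->
  exists2 c, a < c < b & T b - T a = beta * sech2 (beta * c) * (b - a).
Proof.
move=> ab.
have [c] := MVT ab (fun v _ => dT v) (continuous_subspaceT (continuous_of_derive dT)).
by rewrite in_itv/= => cab e; exists c.
Qed.

Lemma tanhR_lt (x y : R) : x < y -> tanhR x < tanhR y.
Proof.
move=> xy; have [th _] := mvt_scaled (y - x) (fun t => is_derive_shift (is_derive_tanhR (x + t))).
rewrite addr0 (addrC x (y - x)) subrK => e.
by rewrite -subr_gt0 e mulr_gt0 ?subr_gt0// sech2_gt0.
Qed.

Lemma sech2_lt (x y : R) : 0 <= x -> x < y -> sech2 y < sech2 x.
Proof.
move=> x0 xy; have t0 : 0 <= tanhR x.
  move: x0; rewrite le_eqVlt => /predU1P[<-|/tanhR_lt]; first by rewrite tanhR0.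
  by rewrite tanhR0 => /ltW.
by rewrite !sech2E ltrD2l ltrN2; have := tanhR_lt xy; nra.
Qed.

Let slope (x y : R) : 0 < x -> x < y -> beta * sech2 (beta * y) < beta * sech2 (beta * x).
Proof. by move=> x0 xy; rewrite ltr_pM2l// sech2_lt ?ltr_pM2l// mulr_ge0// ltW. Qed.

Let T0 : T 0 = 0. Proof. by rewrite /T mulr0 tanhR0. Qed.
Let Tm : T m = m. Proof. exact: esym. Qed.

(** On [[0, m]] the map [v -> tanh (beta v)] has mean slope 1, attained at an interior point; the
    slope decreases strictly, so it is below 1 at the endpoint [m]. *)
Lemma meanfield_slope : beta * sech2 (beta * m) < 1.
Proof.
have [c /andP[c0 cm]] := mvtT m0; rewrite Tm T0 !subr0 => e.
have -> : 1 = beta * sech2 (beta * c) :> R.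
  by apply: (mulIf (lt0r_neq0 m0)); rewrite mul1r.
exact: slope.
Qed.

Let below v : 0 < v -> v < m -> v < T v.
Proof.
move=> v0 vm; have [c1 /andP[c10 c1v]] := mvtT v0; rewrite T0 !subr0 => e1.
have [c2 /andP[c2v c2m]] := mvtT vm; rewrite Tm => e2.
have := slope c10 (lt_trans c1v c2v).
move: (beta * sech2 _) (beta * sech2 _) e1 e2 => k1 k2 e1 e2 k.
have vm' : 0 < m - v by rewrite subr_gt0.
have : (m - T v) * v < T v * (m - v) by rewrite e2 e1; have := mulr_gt0 v0 vm'; nra.
by move: vm'; nra.
Qed.

Let above v : m < v -> T v < v.
Proof.
move=> mv; have [c1 /andP[c10 c1v]] := mvtT m0; rewrite Tm T0 !subr0 => e1.
have [c2 /andP[c2v c2m]] := mvtT mv; rewrite Tm => e2.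
have := slope c10 (lt_trans c1v c2v).
have -> : beta * sech2 (beta * c1) = 1 by apply: (mulIf (lt0r_neq0 m0)); rewrite mul1r.
move=> k; have : 0 < v - m by rewrite subr_gt0.
by nra.
Qed.

(** Mean-field free energy, that is, the objective at zero field. Its critical points are the fixed
    points of [tanh (beta v)]. *)
Definition mf_obj v := beta * v ^+ 2 / 2 - lcosh (beta * v).

Lemma is_derive_mf_obj v : is_derive v 1 mf_obj (beta * (v - T v)).
Proof.
have h := is_derive_scale beta v.
have h1 := is_derive1_comp (is_derive_lcosh (beta * v)) h.
have h2 := is_deriveZ (beta / 2) (is_deriveX 2 (is_derive_id v 1)).
have := is_deriveB h2 h1.
have -> : (beta / 2) \*: ((@id R) ^+ 2) - ((@lcosh R) \o *%R beta) = mf_obj.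
  by apply/funext => u; rewrite /mf_obj !fctE /GRing.scale/= mulrAC.
by move/is_derive_eq; apply; rewrite /GRing.scale/= expr1 /T; field.
Qed.

Lemma continuous_mf_obj : continuous mf_obj.
Proof. exact: (continuous_of_derive is_derive_mf_obj). Qed.

Lemma mf_obj_min v : 0 <= v -> v != m -> mf_obj m < mf_obj v.
Proof.
move=> v0; rewrite neq_lt => /orP[vm|mv].
- have [c] := MVT vm (fun v _ => is_derive_mf_obj v) (continuous_subspaceT continuous_mf_obj).
  rewrite in_itv/= => /andP[vc cm] e; rewrite -subr_lt0 e.
  by rewrite nmulr_rlt0 ?subr_gt0// pmulr_rlt0// subr_lt0 below// (le_lt_trans v0).
- have [c] := MVT mv (fun v _ => is_derive_mf_obj v) (continuous_subspaceT continuous_mf_obj).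
  rewrite in_itv/= => /andP[vc cm] e; rewrite -subr_gt0 e.
  by rewrite mulr_gt0 ?subr_gt0// mulr_gt0// subr_gt0 above.
Qed.

Lemma mf_objN v : mf_obj (- v) = mf_obj v.
Proof. by rewrite /mf_obj sqrrN mulrN /lcosh coshRN. Qed.

(** Beyond [u = 1] the term [beta u ^ 2 / 2] outgrows this linear bound by exactly
    [beta (u - 1) ^ 2 / 2], the tail term of [quadratic_growth]. *)
Lemma lcosh_tail (a u : R) : 1 <= u ->
  lcosh (beta * u + a) <= lcosh (beta + a) + beta * (u - 1).
Proof.
move=> u1; have := lcosh_lip (beta + a) (beta * (u - 1)).
rewrite (@ger0_norm _ (beta * _)); last by rewrite mulr_ge0 ?subr_ge0// ltW.
have -> : beta + a + beta * (u - 1) = beta * u + a by ring.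
by move/(le_trans (ler_norm _)); lra.
Qed.

Lemma mf_obj_growth :
  exists2 c, 0 < c & forall v, c * (`|v| - m) ^+ 2 <= mf_obj v - mf_obj m.
Proof.
(* [k] is half of the second derivative at [m], positive by [meanfield_slope]. Within [delta] of [m]
   the cubic Taylor remainder uses up at most half of the quadratic term. *)
pose k := beta / 2 * (1 - beta * sech2 (beta * m)).
have k0 : 0 < k by rewrite mulr_gt0 ?divr_gt0// subr_gt0 meanfield_slope.
pose delta := k / 2 / (2 * beta ^+ 3).
have b3 : 0 < 2 * beta ^+ 3 by rewrite mulr_gt0// exprn_gt0.
have d0 : 0 < delta by rewrite divr_gt0// divr_gt0.
have near v : `|v - m| <= delta -> k / 2 * (v - m) ^+ 2 <= mf_obj v - mf_obj m.
  move=> vd; have := lcosh_taylor3 (beta * m) (beta * (v - m)).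
  have -> : beta * m + beta * (v - m) = beta * v by ring.
  rewrite -mE => /(le_trans (ler_norm _)) h.
  have h2 : 2 * `|beta * (v - m)| ^+ 3 <= k / 2 * (v - m) ^+ 2.
    have -> : 2 * `|beta * (v - m)| ^+ 3 = 2 * beta ^+ 3 * `|v - m| * (v - m) ^+ 2.
      by rewrite normrM (gtr0_norm b0) -[(v - m) ^+ 2]real_normK ?num_real//; ring.
    by rewrite ler_wpM2r ?sqr_ge0// mulrC -ler_pdivlMr.
  rewrite /mf_obj /k; move: h h2; rewrite /k !exprMn.
  move: (2 * _) (sech2 _) => e s.
  by move: (lcosh _) (lcosh _) => l1 l2; lra.
have [eta e0 gap] := minimum_gap (lo := 0) (hi := 1) continuous_mf_obj d0
  (fun u h => @mf_obj_min u (proj1 (andP h))).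
pose c := Num.min (k / 2) (Num.min (Num.min (eta) (mf_obj 1 - mf_obj m) / 8) (beta / 4)).
have g1 : 0 < mf_obj 1 - mf_obj m.
  by rewrite subr_gt0 mf_obj_min// gt_eqF// meanfield_lt1.
exists c; first by rewrite !lt_min !divr_gt0// lt_min e0.
move=> v; wlog v0 : v / 0 <= v => [W|].
  have [/W//|/ltW v0] := leP 0 v.
  by have := W (- v); rewrite oppr_ge0 normrN mf_objN => /(_ v0).
rewrite (ger0_norm v0).
apply: (@quadratic_growth _ _ _ _ delta (k / 2) (Num.min eta (mf_obj 1 - mf_obj m)) beta).
- by rewrite ger0_norm ltW// meanfield_lt1.
- by rewrite !lt_min !divr_gt0// lt_min e0.
- by rewrite /c ge_min lexx.
- by rewrite /c !ge_min lexx orbT.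
- by rewrite /c !ge_min lexx !orbT.
- exact: near.
- rewrite ger0_norm// => v1 dv; rewrite ge_min; apply/orP; left.
  by rewrite lerBrDl gap// v0.
- rewrite ger0_norm// => v1.
  apply: (@le_trans _ _ ((mf_obj 1 - mf_obj m) + beta * (v - 1) ^+ 2 / 2)).
    by rewrite lerD2r ge_min lexx orbT.
  have := lcosh_tail 0 (ltW v1); rewrite !addr0 /mf_obj mulr1.
  by move: (lcosh _) (lcosh _) (lcosh _) => x y z; lra.
Qed.

End MeanField.

(** * Laplace bounds and concentration of the Curie-Weiss prior *)

Section Average.
Variables (R : realType) (n : nat).
Implicit Types (f g : 'I_n -> R).

Definition avg f : R := n%:R^-1 * \sum_(i < n) f i.

Lemma avgD f g : avg (fun i => f i + g i) = avg f + avg g.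
Proof. by rewrite /avg big_split mulrDr. Qed.

Lemma avgZ c f : avg (fun i => c * f i) = c * avg f.
Proof. by rewrite /avg -mulr_sumr mulrCA. Qed.

Lemma avgN f : avg (fun i => - f i) = - avg f.
Proof. by rewrite /avg sumrN mulrN. Qed.

Lemma avgB f g : avg (fun i => f i - g i) = avg f - avg g.
Proof. by rewrite avgD avgN. Qed.

Lemma avg_le f g : (forall i, f i <= g i) -> avg f <= avg g.
Proof. by move=> fg; rewrite ler_wpM2l ?invr_ge0// ler_sum. Qed.

Lemma avg_ge0 f : (forall i, 0 <= f i) -> 0 <= avg f.
Proof. by move=> f0; rewrite mulr_ge0 ?invr_ge0// sumr_ge0. Qed.

Lemma avg_norm f : `|avg f| <= avg (fun i => `|f i|).
Proof.
by rewrite normrM ger0_norm ?invr_ge0// ler_wpM2l ?invr_ge0// ler_norm_sum.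
Qed.

Lemma avg_cst c : (0 < n)%N -> avg (fun=> c) = c.
Proof.
move=> n0; rewrite /avg sumr_const card_ord -[c *+ n]mulr_natl mulKf//.
by rewrite pnatr_eq0 -lt0n.
Qed.

Lemma avg_close f g h : (forall i, `|f i - g i| <= h i) -> `|avg f - avg g| <= avg h.
Proof. by move=> fg; rewrite -avgB (le_trans (avg_norm _))//; exact: avg_le. Qed.

End Average.

Section Laplace.
Variables (R : realType) (n : nat) (beta : R) (a : 'I_n -> R).
Hypotheses (n0 : (0 < n)%N) (b0 : 0 < beta).
Implicit Types (u U c : R).
Let F := field_obj beta a.
Let nR : 0 < n%:R :> R. Proof. by rewrite ltr0n. Qed.

Definition grad u := beta * (u - avg (fun i => tanhR (beta * u + a i))).
Definition hess u := beta - beta ^+ 2 * avg (fun i => sech2 (beta * u + a i)).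

Lemma field_objE u : F u = beta * u ^+ 2 / 2 - avg (fun i => lcosh (beta * u + a i)).
Proof. by []. Qed.

Let arg U u i : beta * u + a i = beta * U + a i + beta * (u - U).
Proof. ring. Qed.

(** Convexity of log cosh bounds the second derivative of the objective by [beta] globally. This
    yields both the lower Laplace bound and the decrease along a gradient step. *)
Lemma field_obj_upper U u : F u - F U <= grad U * (u - U) + beta * (u - U) ^+ 2 / 2.
Proof.
have h : avg (fun i => lcosh (beta * U + a i)) + beta * (u - U) *
    avg (fun i => tanhR (beta * U + a i)) <= avg (fun i => lcosh (beta * u + a i)).
  rewrite -avgZ -avgD; apply: avg_le => i.
  by have := lcosh_convex (beta * U + a i) (beta * (u - U)); rewrite -arg; lra.
rewrite !field_objE /grad; move: h.
by move: (avg _) (avg _) (avg _) => x y z; nra.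
Qed.

Lemma field_obj_taylor U u :
  `|F u - F U - grad U * (u - U) - hess U * (u - U) ^+ 2 / 2| <=
  2 * beta ^+ 3 * `|u - U| ^+ 3.
Proof.
have := @avg_close _ _ (fun i => lcosh (beta * u + a i)) (fun i => lcosh (beta * U + a i)
  + (beta * (u - U)) * tanhR (beta * U + a i)
  + (beta * (u - U)) ^+ 2 / 2 * sech2 (beta * U + a i))
  (fun i => 2 * beta ^+ 3 * `|u - U| ^+ 3).
rewrite avg_cst// => h; have {h} := h (fun i => _).
rewrite !avgD !avgZ => /(_ _)h.
rewrite -normrN !field_objE /grad /hess.
set x := avg _ in h *; set y := avg _ in h *; set z := avg _ in h *; set t := avg _ in h *.
have -> : - (beta * u ^+ 2 / 2 - x - (beta * U ^+ 2 / 2 - y) - beta * (U - z) * (u - U) -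
     (beta - beta ^+ 2 * t) * (u - U) ^+ 2 / 2) =
   x - (y + beta * (u - U) * z + (beta * (u - U)) ^+ 2 / 2 * t) by field.
apply: h => i; have := lcosh_taylor3 (beta * U + a i) (beta * (u - U)).
have -> : 2 * `|beta * (u - U)| ^+ 3 = 2 * beta ^+ 3 * `|u - U| ^+ 3.
  by rewrite normrM (gtr0_norm b0); ring.
rewrite -arg; move: (lcosh _) (lcosh _) (tanhR _) (sech2 _) => l1 l2 t1 t2.
by apply: le_trans; rewrite le_eqVlt; apply/orP; left; apply/eqP; congr `|_|; ring.
Qed.

Let fw := field_wt beta a.
Let s := n%:R * beta.
Let s0 : 0 < s. Proof. exact: mulr_gt0. Qed.

Lemma field_wt_integ : integ fw.
Proof. exact: (gdom_integ s0 (gdom_field_wt _ _ n0)). Qed.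

Lemma laplace_lower U : grad U = 0 ->
  expR (- (n%:R * F U)) * Num.sqrt (2 * pi / s) <= L fw.
Proof.
move=> g0; have [ig <-] := L_gauss U s0; rewrite -LZ//.
apply: L_le; [exact: integZ|exact: field_wt_integ|move=> u].
rewrite /fw field_wtE// -expRD ler_expR.
have := field_obj_upper U u; rewrite g0 mul0r add0r => /(ler_wpM2l (ltW nR)).
by rewrite -/F /s; lra.
Qed.

Lemma sqrt_ratio c : 0 < c ->
  Num.sqrt (2 * pi / (2 * (n%:R * c))) = Num.sqrt (beta / (2 * c)) * Num.sqrt (2 * pi / s) :> R.
Proof.
move=> c0; rewrite -sqrtrM; last by rewrite divr_ge0 ?ltW// mulr_gt0.
congr Num.sqrt; rewrite /s; field.
by rewrite !lt0r_neq0.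
Qed.

(** The growth hypothesis dominates the numerator by a Gaussian integral and [laplace_lower] bounds
    the denominator below. The factor [exp (- n F U)] cancels, so no asymptotics of the partition
    function are needed. *)
Lemma laplace_moment U c : grad U = 0 -> 0 < c ->
  (forall u, c * (u - U) ^+ 2 <= F u - F U) ->
  integ (fun u => (u - U) ^+ 2 * fw u) /\
  L (fun u => (u - U) ^+ 2 * fw u) <= 4 / c * Num.sqrt (beta / (2 * c)) / n%:R * L fw.
Proof.
move=> g0 c0 cF; pose s' := 2 * (n%:R * c).
have s'0 : 0 < s' by rewrite !mulr_gt0.
have [iq Lq] := L_gauss_sqr U s'0.
have le u : (u - U) ^+ 2 * fw u <= expR (- (n%:R * F U)) *
    ((u - U) ^+ 2 * expR (- s' * (u - U) ^+ 2 / 2)).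
  rewrite [leRHS]mulrCA ler_wpM2l ?sqr_ge0// /fw field_wtE// -expRD ler_expR.
  by have := ler_wpM2l (ltW nR) (cF u); rewrite /F /s'; lra.
have i2 : integ (fun u => (u - U) ^+ 2 * fw u).
  apply: (integ_le _ (integZ (expR (- (n%:R * F U))) iq)) => [|u].
    apply: measurable_funM; last exact: integ_measurable field_wt_integ.
    by apply: measurable_funX; exact: measurable_funB.
  by rewrite ger0_norm// mulr_ge0 ?sqr_ge0// /fw field_wtE// expR_ge0.
split => //; apply: le_trans (L_le i2 (integZ _ iq) le) _; rewrite LZ//.
apply: le_trans (ler_wpM2l (expR_ge0 _) Lq) _.
have k0 : 0 <= 4 / c * Num.sqrt (beta / (2 * c)) / n%:R.
  by rewrite !mulr_ge0 ?sqrtr_ge0 ?invr_ge0// ltW.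
apply: le_trans (ler_wpM2l k0 (laplace_lower g0)).
rewrite sqrt_ratio// le_eqVlt; apply/orP; left; apply/eqP; rewrite /s'.
by move: (Num.sqrt _) (Num.sqrt _) (expR _) => x y z; field; rewrite !lt0r_neq0.
Qed.

End Laplace.

Section PriorConcentration.
Variables (R : realType) (beta m : R).
Hypotheses (b1 : 1 < beta) (m0 : 0 < m) (mE : m = tanhR (beta * m)).
Let b0 : 0 < beta. Proof. exact: lt_trans b1. Qed.

Lemma abs_dist_le (u w : R) : (`|w| - m) ^+ 2 <= 2 * (`|u| - m) ^+ 2 + 2 * (u - w) ^+ 2.
Proof.
have h : (`|w| - `|u|) ^+ 2 <= (u - w) ^+ 2.
  rewrite -(real_normK (num_real (u - w))) -(real_normK (num_real (`|w| - `|u|))).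
  by rewrite lerXn2r ?nnegrE// (distrC u) ler_dist_dist.
have -> : `|w| - m = (`|u| - m) + (`|w| - `|u|) by ring.
by apply: le_trans (sqrD_le _ _) _; rewrite lerD2l ler_wpM2l.
Qed.

Section FixedSize.
Variable n : nat.
Hypothesis n0 : (0 < n)%N.
Let nR : 0 < n%:R :> R. Proof. by rewrite ltr0n. Qed.
Let a : 'I_n -> R := fun=> 0.
Let s := n%:R * beta.
Let s0 : 0 < s. Proof. exact: mulr_gt0. Qed.

Let obj0 u : field_obj beta a u = mf_obj beta u.
Proof. by rewrite field_objE /a /= avg_cst// addr0. Qed.

Let grad0 : grad beta a m = 0.
Proof. by rewrite /grad /a /= avg_cst// addr0 -mE subrr mulr0. Qed.

Let fw := field_wt beta a.
Let ifw : integ fw. Proof. exact: field_wt_integ. Qed.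

Let fw_ge0 u : 0 <= fw u. Proof. by rewrite /fw field_wtE// expR_ge0. Qed.

(** The objective at zero field is even with two minimisers; the weight at [u] is dominated by the
    Gaussian bump at [m] evaluated at [|u|], hence by the sum of the bumps at [m] and [- m]. *)
Lemma two_well c : 0 < c -> (forall v, c * (`|v| - m) ^+ 2 <= mf_obj beta v - mf_obj beta m) ->
  integ (fun u => (`|u| - m) ^+ 2 * fw u) /\
  L (fun u => (`|u| - m) ^+ 2 * fw u) <= 8 / c * Num.sqrt (beta / (2 * c)) / n%:R * L fw.
Proof.
move=> c0 cF; pose s' := 2 * (n%:R * c).
have s'0 : 0 < s' by rewrite !mulr_gt0.
have [iq Lq] := L_gauss_sqr m s'0; have [iq' Lq'] := L_gauss_sqr (- m) s'0.
pose G (x u : R) := (u - x) ^+ 2 * expR (- s' * (u - x) ^+ 2 / 2).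
have le u : (`|u| - m) ^+ 2 * fw u <= expR (- (n%:R * mf_obj beta m)) * (G m u + G (- m) u).
  apply: (@le_trans _ _ (expR (- (n%:R * mf_obj beta m)) * G m `|u|)).
    rewrite /G [leRHS]mulrCA ler_wpM2l ?sqr_ge0// /fw field_wtE// obj0 -expRD ler_expR.
    by have := ler_wpM2l (ltW nR) (cF u); rewrite /s'; lra.
  have G0 x v : 0 <= G x v by rewrite mulr_ge0 ?sqr_ge0 ?expR_ge0.
  rewrite ler_wpM2l ?expR_ge0//; have [u0|u0] := leP 0 u.
    by rewrite ger0_norm// lerDl.
  rewrite ltr0_norm// [leLHS](_ : _ = G (- m) u) ?lerDr//.
  by rewrite /G opprK (_ : - u - m = - (u + m)) ?sqrrN//; ring.
have i2 : integ (fun u => (`|u| - m) ^+ 2 * fw u).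
  apply: (integ_le _ (integZ (expR (- (n%:R * mf_obj beta m))) (integD iq iq'))) => [|u].
    apply: measurable_funM; last exact: integ_measurable ifw.
    apply: measurable_funX; apply: measurable_funB => //.
  by rewrite ger0_norm ?le// mulr_ge0 ?sqr_ge0.
split => //; apply: le_trans (L_le i2 (integZ _ (integD iq iq')) le) _.
rewrite LZ; last exact: integD.
rewrite LD//; apply: le_trans (ler_wpM2l (expR_ge0 _) (lerD Lq Lq')) _.
have k0 : 0 <= 8 / c * Num.sqrt (beta / (2 * c)) / n%:R.
  by rewrite !mulr_ge0 ?sqrtr_ge0 ?invr_ge0// ltW.
apply: le_trans (ler_wpM2l k0 (laplace_lower n0 b0 grad0)).
rewrite obj0 (sqrt_ratio n0 b0)// le_eqVlt; apply/orP; left; apply/eqP; rewrite /s'.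
by move: (Num.sqrt _) (Num.sqrt _) (expR _) => x y z; field; rewrite !lt0r_neq0.
Qed.

Let Q := Num.sqrt (2 * pi / s).
Let Q0 : 0 < Q.
Proof. by rewrite sqrtr_gt0 divr_gt0// mulr_gt0// pi_gt0. Qed.

Lemma cw_weightE (z : {ffun 'I_n -> bool}) : cw_weight beta z = cw_wt beta a z.
Proof. by rewrite /cw_wt big1 ?addr0// => i _; rewrite mulr0. Qed.

(** Given the spins, [u] is Gaussian around their mean with variance [1 / (n beta)]. The distance of
    the mean spin to the wells is thus controlled by that of [u], which [two_well] bounds; the
    summand [16 / beta] is the price of the exchange. *)
Lemma prior_moment c : 0 < c ->
  (forall v, c * (`|v| - m) ^+ 2 <= mf_obj beta v - mf_obj beta m) ->
  \sum_(z : {ffun 'I_n -> bool}) cw_prior beta z * (`|spin_mean R z| - m) ^+ 2 <=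
  (16 / c * Num.sqrt (beta / (2 * c)) + 16 / beta) / n%:R.
Proof.
move=> c0 cF; pose W := \sum_(z : {ffun 'I_n -> bool}) cw_wt beta a z.
have Wpos : 0 < W.
  rewrite /W (bigD1 [ffun=> true])//= ltr_pwDl ?expR_gt0// sumr_ge0// => z _.
  exact: expR_ge0.
have [i2 L2] := two_well c0 cF.
pose J z := joint_wt beta a z.
have iJ z : integ (J z) by exact: (gdom_integ s0 (gdom_joint_wt _ _ n0 z)).
have J0 w v : 0 <= J w v by rewrite /J joint_wt_gauss// mulr_ge0// expR_ge0.
have iJ2 (z : {ffun 'I_n -> bool}) : integ (fun u => (`|u| - m) ^+ 2 * J z u).
  apply: (integ_le _ (integZ (2 ^+ n) i2)) => [|u].
    apply: measurable_funM; last exact: integ_measurable (iJ z).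
    by apply: measurable_funX; apply: measurable_funB.
  rewrite ger0_norm; last by apply: mulr_ge0; [exact: sqr_ge0|exact: J0].
  rewrite [leRHS]mulrCA ler_wpM2l ?sqr_ge0// -sum_joint_wt (bigD1 z)//= lerDl sumr_ge0//.
have key (z : {ffun 'I_n -> bool}) : Q * (cw_wt beta a z * (`|spin_mean R z| - m) ^+ 2) <=
    2 * L (fun u => (`|u| - m) ^+ 2 * J z u) + 16 / s * (Q * cw_wt beta a z).
  have [ig Lg] := L_gauss_sqr (spin_mean R z) s0.
  have ig' := integZ (cw_wt beta a z) ig.
  apply: (@le_trans _ _ (L (fun u => 2 * ((`|u| - m) ^+ 2 * J z u) +
     2 * (cw_wt beta a z * ((u - spin_mean R z) ^+ 2 *
        expR (- s * (u - spin_mean R z) ^+ 2 / 2)))))).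
    have -> : Q * (cw_wt beta a z * (`|spin_mean R z| - m) ^+ 2) =
        (`|spin_mean R z| - m) ^+ 2 * L (J z).
      by rewrite L_joint_wt// -/s -/Q; ring.
    rewrite -LZ//; apply: L_le; [exact: integZ|by apply: integD; exact: integZ|].
    move=> u; have -> : cw_wt beta a z * ((u - spin_mean R z) ^+ 2 *
        expR (- s * (u - spin_mean R z) ^+ 2 / 2)) = (u - spin_mean R z) ^+ 2 * J z u.
      by rewrite /J joint_wt_gauss// -/s; ring.
    have := ler_wpM2r (J0 z u) (abs_dist_le u (spin_mean R z)).
    by move: (J z u) (`|spin_mean R z| - m) (`|u| - m) (u - _) => j p q r; lra.
  rewrite LD; [|exact: integZ|exact: integZ].
  rewrite !LZ// lerD2l.
  have := ler_wpM2l (expR_ge0 (n%:R * beta * spin_mean R z ^+ 2 / 2 +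
    \sum_(i < n) spin R (z i) * a i)) Lg.
  rewrite -/(cw_wt beta a z) -/s -/Q => h.
  have -> : 16 / s * (Q * cw_wt beta a z) = 2 * (cw_wt beta a z * (8 / s * Q)) by ring.
  by rewrite ler_wpM2l.
have tot : Q * \sum_(z : {ffun 'I_n -> bool}) cw_wt beta a z * (`|spin_mean R z| - m) ^+ 2 <=
   (16 / c * Num.sqrt (beta / (2 * c)) + 16 / beta) / n%:R * (Q * W).
  rewrite mulr_sumr; apply: le_trans (ler_sum _ (fun z _ => key z)) _.
  rewrite big_split/= -!mulr_sumr -/W -L_sum_w//.
  have -> : (fun u => \sum_w (`|u| - m) ^+ 2 * J w u) =
      (fun u => 2 ^+ n * ((`|u| - m) ^+ 2 * fw u)).
    by apply/funext => u; rewrite -mulr_sumr sum_joint_wt mulrCA.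
  rewrite (LZ _ i2); set k := Num.sqrt _ in L2 *.
  have -> : (16 / c * k + 16 / beta) / n%:R * (Q * W) =
      2 * (2 ^+ n * (8 / c * k / n%:R * L fw)) + 16 / s * (Q * W).
    rewrite (hs_partition a n0 b0) -/fw /s; move: (L fw) (2 ^+ n) => x y.
    by field; rewrite !lt0r_neq0.
  by rewrite lerD2r ler_wpM2l// ler_wpM2l// exprn_ge0.
rewrite (eq_bigr (fun z => (cw_wt beta a z * (`|spin_mean R z| - m) ^+ 2) / W)); last first.
  move=> z _; rewrite /cw_prior -cw_weightE mulrAC; congr (_ / _).
  by apply: eq_bigr => w _; rewrite cw_weightE.
rewrite -mulr_suml ler_pdivrMr// -(ler_pM2l Q0).
by apply: le_trans tot _; rewrite mulrCA.
Qed.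
End FixedSize.

Lemma prior_concentration : exists2 C, 0 <= C & forall n, (0 < n)%N ->
  \sum_(z : {ffun 'I_n -> bool}) cw_prior beta z * (`|spin_mean R z| - m) ^+ 2 <= C / n%:R.
Proof.
have [c c0 cF] := mf_obj_growth b1 m0 mE.
exists (16 / c * Num.sqrt (beta / (2 * c)) + 16 / beta) => [|n n0].
  by rewrite addr_ge0// ?mulr_ge0 ?sqrtr_ge0 ?invr_ge0// ltW.
exact: prior_moment.
Qed.

End PriorConcentration.

(** * Posterior mean and likelihood ratio by Laplace's method *)

Section ExponentialEstimates.
Variable R : realType.
Implicit Types x y z t : R.

Lemma expR_diff_le x y z : x <= z -> y <= z -> `|expR x - expR y| <= `|x - y| * expR z.
Proof.
wlog yx : x y / y <= x => [W xz yz|xz yz].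
  by have [/W->//|/ltW /W] := leP y x; rewrite distrC (distrC y); apply.
rewrite !ger0_norm ?subr_ge0 ?ler_expR//.
have h := expR_ge1Dx (y - x); have e : expR y = expR x * expR (y - x).
  by rewrite -expRD addrC subrK.
have xy : 0 <= x - y by rewrite subr_ge0.
have := ler_wpM2l xy (_ : expR x <= expR z); rewrite ler_expR => /(_ xz).
have := ler_wpM2l (expR_ge0 x) h; rewrite -e; nra.
Qed.

Lemma ln1D_norm_le x : `|x| <= 2^-1 -> `|ln (1 + x)| <= 2 * `|x|.
Proof.
rewrite ler_norml => /andP[x1 x2]; have p : 0 < 1 + x by lra.
have up : ln (1 + x) <= x.
  by rewrite -ler_expR lnK ?posrE// expR_ge1Dx.
have lo : - ln (1 + x) <= - x / (1 + x).
  rewrite -lnV ?posrE// -ler_expR lnK ?posrE ?invr_gt0//.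
  apply: le_trans (expR_ge1Dx _); rewrite le_eqVlt; apply/orP; left; apply/eqP.
  by field; rewrite lt0r_neq0.
have lo2 : - x / (1 + x) <= 2 * `|x|.
  by rewrite ler_pdivrMr//; have := normr_ge0 x; have := ler_norm (- x); rewrite normrN; nra.
rewrite ler_norml; apply/andP; split; first by lra.
by have := ler_norm x; have := normr_ge0 x; lra.
Qed.

(** From [t / k <= exp (t / k)] raised to the power [k], whence the constants [k ^ k]. *)
Lemma cubic_le_expR t : 0 <= t -> [/\ t <= expR t, t ^+ 2 <= 4 * expR t & t ^+ 3 <= 27 * expR t].
Proof.
move=> t0; have h1 := expR_ge1Dx t; have h2 := expR_ge1Dx (t / 2); have h3 := expR_ge1Dx (t / 3).
split; first by lra.
- have -> : expR t = expR (t / 2) ^+ 2 by rewrite -expRM_natl; congr expR; field.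
  by rewrite !expr2; nra.
- have -> : expR t = expR (t / 3) ^+ 3 by rewrite -expRM_natl; congr expR; field.
  have -> : 27 * expR (t / 3) ^+ 3 = (3 * expR (t / 3)) ^+ 3 by ring.
  by rewrite lerXn2r ?nnegrE// ?mulr_ge0 ?expR_ge0//; lra.
Qed.

End ExponentialEstimates.

Section PosteriorMean.
Variables (R : realType) (n : nat) (beta : R) (a : 'I_n -> R) (U c h0 : R).
Hypotheses (n0 : (0 < n)%N) (b0 : 0 < beta) (g0 : grad beta a U = 0).
Hypotheses (c0 : 0 < c) (h00 : 0 < h0) (hU : h0 <= hess beta a U).
Hypothesis growth : forall u, c * (u - U) ^+ 2 <= field_obj beta a u - field_obj beta a U.
Let nR : 0 < n%:R :> R. Proof. by rewrite ltr0n. Qed.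
Let fw := field_wt beta a.
Let s0 : 0 < n%:R * beta. Proof. exact: mulr_gt0. Qed.
Let ifw : integ fw. Proof. exact: field_wt_integ. Qed.
Let fw0 u : 0 <= fw u. Proof. by rewrite /fw field_wtE// expR_ge0. Qed.
Let arg u i : beta * u + a i = beta * U + a i + beta * (u - U).
Proof. ring. Qed.

Lemma L_field_wt_gt0 : 0 < L fw.
Proof.
apply: lt_le_trans (laplace_lower n0 b0 g0).
by rewrite mulr_gt0 ?expR_gt0// sqrtr_gt0 divr_gt0// mulr_gt0// pi_gt0.
Qed.

Let C1 := 4 / c * Num.sqrt (beta / (2 * c)).
Let V := L (fun u => (u - U) ^+ 2 * fw u).

Let taylor (y : 'I_n -> R) u :
  `|avg (fun i => y i * tanhR (beta * u + a i)) - avg (fun i => y i * tanhR (beta * U + a i))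
    - beta * (u - U) * avg (fun i => y i * sech2 (beta * U + a i))| <=
  2 * beta ^+ 2 * avg (fun i => `|y i|) * (u - U) ^+ 2.
Proof.
rewrite -avgZ -!avgB; apply: le_trans (avg_norm _) _.
rewrite mulrAC -avgZ; apply: avg_le => i.
rewrite (_ : _ - _ - _ = y i * (tanhR (beta * u + a i) - tanhR (beta * U + a i)
   - beta * (u - U) * sech2 (beta * U + a i))); last by ring.
rewrite normrM mulrC ler_wpM2r// arg (le_trans (tanhR_taylor2 _ _))//.
by rewrite exprMn mulrA.
Qed.

Let i1 : integ (fun u => (u - U) * fw u).
Proof.
have -> : (fun u => (u - U) * fw u) = (fun u => u * fw u + (- U) * fw u).
  by apply/funext => u; rewrite -mulrDl.
apply: integD; last exact: integZ.
exact: (gdom_integ s0 (gdom_id (gdom_field_wt _ _ n0))).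
Qed.

(** Localisation alone gives a first moment of relative order [n^-1/2]. By [L_stationary] the
    gradient has mean zero; linearising it at [U], with slope the Hessian, leaves a second moment,
    of relative order [1 / n]. *)
Lemma L_shift_le : `|L (fun u => (u - U) * fw u)| * h0 <= 2 * beta ^+ 3 * V.
Proof.
have [iq _] := laplace_moment n0 b0 g0 c0 growth.
pose r u := u - avg (fun i => tanhR (beta * u + a i)).
have ir : integ (fun u => r u * fw u).
  apply: (gdom_integ s0); have -> : (fun u => r u * fw u) =
    (fun u => u * fw u + (- 1) * (avg (fun i => tanhR (beta * u + a i)) * fw u)).
    by apply/funext => u; rewrite mulN1r -mulrBl.
  apply: gdomD; first exact/gdom_id/gdom_field_wt.
  apply/gdomZ; have -> : (fun u => avg (fun i => tanhR (beta * u + a i)) * fw u) =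
    (fun u => n%:R^-1 * \sum_(i <- enum 'I_n) tanhR (beta * u + a i) * fw u).
    by apply/funext => u; rewrite big_enum/= /avg -(mulrA n%:R^-1) mulr_suml.
  by apply/gdomZ/gdom_sum => i; exact: gdom_tanh.
have e0 : L (fun u => r u * fw u) = 0 by exact: L_stationary.
have gU : U = avg (fun i => tanhR (beta * U + a i)).
  by move/eqP: g0; rewrite mulf_eq0 gt_eqF//= subr_eq0 => /eqP.
pose H := hess beta a U; have HU : h0 <= H := hU.
have key u : `|H * ((u - U) * fw u) - beta * (r u * fw u)| <= 2 * beta ^+ 3 * ((u - U) ^+ 2 * fw u).
  suff h : `|H * (u - U) - beta * r u| <= 2 * beta ^+ 3 * (u - U) ^+ 2.
    move: (fw u) (fw0 u) (r u) h => w w0 p h.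
    have -> : H * ((u - U) * w) - beta * (p * w) = (H * (u - U) - beta * p) * w by ring.
    by rewrite mulrA normrM (ger0_norm w0) ler_wpM2r.
  have := taylor (fun=> 1) u; rewrite normr1 avg_cst//.
  rewrite !avgZ !mul1r -gU mulr1 => /(ler_wpM2l (ltW b0)).
  rewrite -{1}(gtr0_norm b0) -normrM.
  have -> : beta * (2 * beta ^+ 2 * (u - U) ^+ 2) = 2 * beta ^+ 3 * (u - U) ^+ 2 by ring.
  apply: le_trans; rewrite le_eqVlt; apply/orP; left; apply/eqP; congr `|_|.
  rewrite /H /hess /r; move: (avg _) (avg _) => p q; ring.
have iH := integZ H i1; have ib := integZ beta ir.
have := L_norm (integD iH (integZ (-1) ib)).
rewrite LD//; last exact: integZ.
rewrite !LZ// e0 !mulr0 addr0 => h.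
have H0 : 0 < H by exact: lt_le_trans HU.
apply: (@le_trans _ _ (`|H * L (fun u => (u - U) * fw u)|)).
  by rewrite normrM mulrC ler_wpM2r// gtr0_norm.
apply: le_trans h _; rewrite /V -LZ//; apply: L_le.
- by apply: integ_norm; apply: integD => //; exact: integZ.
- exact: integZ.
- by move=> u; rewrite mulN1r.
Qed.

Definition post_tanh i := L (fun u => tanhR (beta * u + a i) * fw u) / L fw.

(** The sum is [n] times the posterior mean of a function of [u] vanishing at [U]. Its linear part
    is bounded by [L_shift_le], its quadratic part by [laplace_moment]; both are [O(1 / n)], which
    cancels the factor [n]. *)
Lemma post_mean_close (y : 'I_n -> R) :
  `|\sum_(i < n) y i * (post_tanh i - tanhR (beta * U + a i))| <=
  (2 * beta ^+ 4 / h0 + 2 * beta ^+ 2) * C1 * avg (fun i => `|y i|).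
Proof.
have [iq Lq] := laplace_moment n0 b0 g0 c0 growth; rewrite -/C1 -/V in Lq.
have D0 := L_field_wt_gt0; set M := avg _.
have M0 : 0 <= M by exact: avg_ge0.
pose k := avg (fun i => y i * sech2 (beta * U + a i)).
have kM : `|k| <= M.
  apply: le_trans (avg_norm _) _; apply: avg_le => i.
  rewrite normrM ler_piMr// ger0_norm ?sech2_le1//; exact/ltW/sech2_gt0.
have it i : integ (fun u => tanhR (beta * u + a i) * fw u).
  exact: (gdom_integ s0 (gdom_tanh _ _ n0 i)).
pose d u := avg (fun i => y i * tanhR (beta * u + a i)) -
            avg (fun i => y i * tanhR (beta * U + a i)).
have E u : d u * fw u = \sum_(i <- enum 'I_n)
   (n%:R^-1 * y i * (tanhR (beta * u + a i) * fw u) +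
    - (n%:R^-1 * y i * tanhR (beta * U + a i)) * fw u).
  rewrite big_enum/= /d -avgB /avg -(mulrA n%:R^-1) mulr_suml mulr_sumr.
  by apply: eq_bigr => i _; move: (tanhR _) (tanhR _) (fw u) => p q w; ring.
have iE i : integ (fun u => n%:R^-1 * y i * (tanhR (beta * u + a i) * fw u) +
    - (n%:R^-1 * y i * tanhR (beta * U + a i)) * fw u).
  by apply: integD; exact: integZ.
have id : integ (fun u => d u * fw u).
  by rewrite (funext E); exact: (integ_sum _ iE).
have Ld : \sum_(i < n) y i * (post_tanh i - tanhR (beta * U + a i)) =
    n%:R * (L (fun u => d u * fw u) / L fw).
  rewrite (funext E).
  rewrite L_sum// big_enum/= mulr_suml mulr_sumr; apply: eq_bigr => i _.
  rewrite LD; [|exact: integZ|exact: integZ]; rewrite !LZ// /post_tanh -/fw.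
  by move: D0 => /lt0r_neq0 D0; move: (lt0r_neq0 nR) => N0; field; rewrite D0.
have key u : `|d u * fw u - beta * k * ((u - U) * fw u)| <=
    2 * beta ^+ 2 * M * ((u - U) ^+ 2 * fw u).
  have h : `|d u - beta * (u - U) * k| <= 2 * beta ^+ 2 * M * (u - U) ^+ 2 by exact: taylor.
  move: (fw u) (fw0 u) (d u) (k) h => w w0 p k' h.
  have -> : p * w - beta * k' * ((u - U) * w) = (p - beta * (u - U) * k') * w by ring.
  by rewrite mulrA normrM (ger0_norm w0) ler_wpM2r.
have := L_norm (integD id (integZ (- (beta * k)) i1)).
rewrite LD//; last exact: integZ.
rewrite LZ// => h1.
have h2 : `|L (fun u => d u * fw u) + - (beta * k) * L (fun u => (u - U) * fw u)| <=
    2 * beta ^+ 2 * M * V.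
  apply: le_trans h1 _; rewrite /V -LZ//; apply: L_le.
  - by apply: integ_norm; apply: integD => //; exact: integZ.
  - exact: integZ.
  - by move=> u; rewrite mulNr; exact: key.
have h3 : `|L (fun u => (u - U) * fw u)| <= 2 * beta ^+ 3 / h0 * V.
  by rewrite mulrAC ler_pdivlMr// L_shift_le.
have V0 : V <= C1 / n%:R * L fw by [].
have h4 : `|L (fun u => d u * fw u)| <= (2 * beta ^+ 4 / h0 + 2 * beta ^+ 2) * M * V.
  set x := L _ in h2 *; set z := L _ in h2 h3.
  have -> : x = (x + - (beta * k) * z) + beta * k * z by ring.
  apply: le_trans (ler_normD _ _) _.
  have -> : (2 * beta ^+ 4 / h0 + 2 * beta ^+ 2) * M * V =
     2 * beta ^+ 2 * M * V + beta * M * (2 * beta ^+ 3 / h0 * V) by field; rewrite lt0r_neq0.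
  apply: lerD => //; rewrite normrM ler_pM// normrM (gtr0_norm b0).
  by rewrite ler_wpM2l// ltW.
rewrite Ld normrM (gtr0_norm nR) normrM normfV (gtr0_norm D0) mulrA ler_pdivrMr//.
apply: (@le_trans _ _ (n%:R * ((2 * beta ^+ 4 / h0 + 2 * beta ^+ 2) * M * (C1 / n%:R * L fw)))).
  rewrite ler_wpM2l ?ler0n// (le_trans h4)// ler_wpM2l// mulr_ge0//.
  by rewrite addr_ge0// ?divr_ge0 ?mulr_ge0 ?exprn_ge0// ltW.
rewrite le_eqVlt; apply/orP; left; apply/eqP.
by field; rewrite !lt0r_neq0.
Qed.

End PosteriorMean.

Section MixedDifference.
Variable R : realType.
Implicit Types x y d : R.

Let df x d y := tanhR (x + d + y) - tanhR (x + y).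

Let dE x d c y : is_derive y 1 (fun t => lcosh (x + d + t) - lcosh (x + t) - c * t)
  (df x d y - c).
Proof.
have h1 := is_derive_shift (is_derive_lcosh (x + d + y)).
have h2 := is_derive_shift (is_derive_lcosh (x + y)).
exact: (is_deriveB (is_deriveB h1 h2) (is_derive_scale c y)).
Qed.

(** Global bound, used to dominate the shifted integrand far from the minimiser; [mixed_diff_taylor]
    is the sharp local counterpart. *)
Lemma mixed_diff_lip x d y :
  `|lcosh (x + d + y) - lcosh (x + y) - lcosh (x + d) + lcosh x| <= `|d| * `|y|.
Proof.
have [th _] := mvt_scaled y (dE x d 0); rewrite !mul0r !subr0 !addr0 => e.
have -> : lcosh (x + d + y) - lcosh (x + y) - lcosh (x + d) + lcosh x = y * df x d (th * y).
  by rewrite -e; ring.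
rewrite normrM mulrC ler_wpM2r// /df.
by rewrite (addrAC x d) tanhR_lip.
Qed.

(** The mixed difference couples the shift [d] of the field with the displacement [y]: terms
    depending on one of them alone cancel. What remains to leading order becomes the linear term of
    a tilted Gaussian. *)
Lemma mixed_diff_taylor x d y :
  `|lcosh (x + d + y) - lcosh (x + y) - lcosh (x + d) + lcosh x - d * sech2 x * y| <=
  `|y| * (2 * d ^+ 2 + 2 * `|d| * `|y|).
Proof.
have [th th01] := mvt_scaled y (dE x d (d * sech2 x)); rewrite mulr0 !subr0 !addr0.
set D := df _ _ _ - _ => e.
have -> : lcosh (x + d + y) - lcosh (x + y) - lcosh (x + d) + lcosh x - d * sech2 x * y = y * D.
  by rewrite -e; ring.
rewrite normrM ler_wpM2l// /D /df (addrAC x d).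
have h1 := tanhR_taylor2 (x + th * y) d.
have h2 : `|d * (sech2 (x + th * y) - sech2 x)| <= 2 * `|d| * `|y|.
  rewrite normrM (mulrC 2) -mulrA ler_wpM2l//.
  by rewrite (le_trans (sech2_lip _ _))// ler_wpM2l// norm_ths.
apply: le_trans (lerD h1 h2); apply: le_trans (ler_normD _ _).
by rewrite le_eqVlt; apply/orP; left; apply/eqP; congr `|_|; ring.
Qed.

End MixedDifference.

(** * Ratio of two partition functions whose fields differ by [b / sqrt n] *)

Section LaplaceRatio.
Variables (R : realType) (n : nat) (beta : R) (a : 'I_n -> R) (U c : R).
Hypotheses (n0 : (0 < n)%N) (b0 : 0 < beta) (g0 : grad beta a U = 0).
Hypotheses (c0 : 0 < c) (cH : c <= hess beta a U / 2).
Hypothesis growth : forall u, c * (u - U) ^+ 2 <= field_obj beta a u - field_obj beta a U.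
Let nR : 0 < n%:R :> R. Proof. by rewrite ltr0n. Qed.
Let rt := Num.sqrt n%:R : R.
Let rt0 : 0 < rt. Proof. by rewrite sqrtr_gt0. Qed.
Let rt2 : rt ^+ 2 = n%:R. Proof. by rewrite sqr_sqrtr// ltW. Qed.
Let s2 := hess beta a U.
Let s20 : 0 < s2.
Proof. by have := lt_le_trans c0 cH; rewrite pmulr_lgt0. Qed.
Let F := field_obj beta a.

Section Tilt.
Variables (b : 'I_n -> R) (M : R).
Hypotheses (b1 : avg (fun i => `|b i|) <= M) (b2 : avg (fun i => b i ^+ 2) <= M).
Let M0 : 0 <= M. Proof. by apply: le_trans b1; exact: avg_ge0. Qed.
Let a' i : R := a i + b i / rt.
Let kap : R := beta * avg (fun i => b i * sech2 (beta * U + a i)).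
Let A : R := n%:R * (avg (fun i => lcosh (beta * U + a' i)) - avg (fun i => lcosh (beta * U + a i))).
(** Exponent of the shifted weight, normalised to vanish at [U]. Its Gaussian approximation is [H],
    whose linear term comes from the shift of the field. *)
Let G u : R := - (n%:R * field_obj beta a' u) + n%:R * F U - A.
Let H u : R := - (n%:R * s2) * (u - U) ^+ 2 / 2 + rt * kap * (u - U).
Let tau u : R := `|rt * (u - U)|.
Let D u i : R := lcosh (beta * U + a i + b i / rt + beta * (u - U)) -
  lcosh (beta * U + a i + beta * (u - U)) - lcosh (beta * U + a i + b i / rt) +
  lcosh (beta * U + a i).

Let GE u : G u = - (n%:R * (F u - F U)) + n%:R * avg (D u).
Proof.
rewrite /G /D avgD !avgB /A /F !field_objE.
have -> : (fun i => lcosh (beta * U + a i + b i / rt + beta * (u - U))) =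
   (fun i => lcosh (beta * u + a' i)) by apply/funext => i; congr lcosh; rewrite /a'; ring.
have -> : (fun i => lcosh (beta * U + a i + beta * (u - U))) =
   (fun i => lcosh (beta * u + a i)) by apply/funext => i; congr lcosh; ring.
have -> : (fun i => lcosh (beta * U + a i + b i / rt)) =
   (fun i => lcosh (beta * U + a' i)) by apply/funext => i; congr lcosh; rewrite /a'; ring.
by move: (avg _) (avg _) (avg _) (avg _) => p q r s; ring.
Qed.

Let kapM : `|kap| <= beta * M.
Proof.
rewrite normrM (gtr0_norm b0) ler_wpM2l ?(ltW b0)//.
apply: le_trans (avg_norm _) _; apply: le_trans b1; apply: avg_le => i.
by rewrite normrM ler_piMr// ger0_norm ?sech2_le1//; exact/ltW/sech2_gt0.
Qed.

Let tau2 u : n%:R * (u - U) ^+ 2 = tau u ^+ 2.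
Proof. by rewrite /tau real_normK ?num_real// exprMn rt2. Qed.

Let tauE u : `|u - U| = tau u / rt.
Proof. by rewrite /tau normrM (gtr0_norm rt0) mulrC mulKf// lt0r_neq0. Qed.

(** Common majorant of [G] and [H], so that [expR_diff_le] bounds the difference of the exponentials
    by [|G - H|] times an integrable function. *)
Let env u : R := - c * tau u ^+ 2 + beta * M * tau u.

Let G_le u : G u <= env u.
Proof.
rewrite GE /env; apply: lerD.
  have := ler_wpM2l (ltW nR) (growth u); rewrite mulrCA tau2 -/F; lra.
apply: (@le_trans _ _ (n%:R * avg (fun i => `|b i / rt| * `|beta * (u - U)|))).
  rewrite ler_wpM2l ?(ltW nR)// (le_trans (ler_norm _))//.
  by apply: le_trans (avg_norm _) _; apply: avg_le => i; exact: mixed_diff_lip.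
have -> : (fun i => `|b i / rt| * `|beta * (u - U)|) =
    (fun i => beta * tau u / n%:R * `|b i|).
  apply/funext => i; rewrite !normrM normfV (gtr0_norm rt0) (gtr0_norm b0) tauE -rt2.
  by field; rewrite lt0r_neq0.
rewrite avgZ; have -> : n%:R * (beta * tau u / n%:R * avg (fun i => `|b i|)) =
    beta * tau u * avg (fun i => `|b i|) by field; rewrite lt0r_neq0.
by rewrite mulrAC ler_wpM2r ?normr_ge0// ler_wpM2l// ltW.
Qed.

Let H_le u : H u <= env u.
Proof.
rewrite /H /env; apply: lerD.
  rewrite -tau2; have := ler_wpM2r (sqr_ge0 (u - U)) cH; rewrite -/s2.
  by move=> /(ler_wpM2l (ltW nR)); lra.
apply: le_trans (ler_norm _) _; rewrite mulrAC normrM mulrC.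
by rewrite ler_wpM2r ?normr_ge0.
Qed.

Let P u : R := 2 * beta ^+ 3 * tau u ^+ 3 + 2 * beta * M * tau u + 2 * beta ^+ 2 * M * tau u ^+ 2.

Let GH u : `|G u - H u| <= P u / rt.
Proof.
have e1 : `|n%:R * (F u - F U) - n%:R * s2 * (u - U) ^+ 2 / 2| <= 2 * beta ^+ 3 * tau u ^+ 3 / rt.
  have := field_obj_taylor a n0 b0 U u; rewrite g0 mul0r subr0 -/F -/s2 => h.
  have -> : n%:R * (F u - F U) - n%:R * s2 * (u - U) ^+ 2 / 2 =
    n%:R * (F u - F U - s2 * (u - U) ^+ 2 / 2) by ring.
  rewrite normrM (gtr0_norm nR); apply: le_trans (ler_wpM2l (ltW nR) h) _.
  rewrite tauE -rt2 le_eqVlt; apply/orP; left; apply/eqP; field.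
  exact: lt0r_neq0.
have e2 : `|n%:R * avg (D u) - rt * kap * (u - U)| <=
    (2 * beta * M * tau u + 2 * beta ^+ 2 * M * tau u ^+ 2) / rt.
  have -> : rt * kap * (u - U) =
      n%:R * avg (fun i => b i / rt * sech2 (beta * U + a i) * (beta * (u - U))).
    have -> : (fun i => b i / rt * sech2 (beta * U + a i) * (beta * (u - U))) =
      (fun i => beta * (u - U) / rt * (b i * sech2 (beta * U + a i))).
      by apply/funext => i; ring.
    by rewrite avgZ /kap -rt2; move: (avg _) => k; field; exact: lt0r_neq0.
  rewrite -mulrBr normrM (gtr0_norm nR).
  apply: (@le_trans _ _ (n%:R * avg (fun i => 2 * beta * tau u / (n%:R * rt) * b i ^+ 2 +
      2 * beta ^+ 2 * tau u ^+ 2 / (n%:R * rt) * `|b i|))).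
    rewrite ler_wpM2l ?(ltW nR)//; apply: avg_close => i.
    apply: le_trans (mixed_diff_taylor _ _ _) _.
    rewrite !normrM normfV (gtr0_norm rt0) (gtr0_norm b0) tauE -rt2 -[b i ^+ 2]real_normK ?num_real//.
    rewrite -[(b i / rt) ^+ 2]real_normK ?num_real// normrM normfV (gtr0_norm rt0).
    rewrite le_eqVlt; apply/orP; left; apply/eqP; field.
    exact: lt0r_neq0.
  rewrite avgD !avgZ; have t0 : 0 <= tau u by exact: normr_ge0.
  have -> : n%:R * (2 * beta * tau u / (n%:R * rt) * avg (fun i => b i ^+ 2) +
      2 * beta ^+ 2 * tau u ^+ 2 / (n%:R * rt) * avg (fun i => `|b i|)) =
     (2 * beta * tau u * avg (fun i => b i ^+ 2) +
      2 * beta ^+ 2 * tau u ^+ 2 * avg (fun i => `|b i|)) / rt.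
    by move: (avg _) (avg _) => p q; field; rewrite !lt0r_neq0.
  rewrite ler_wpM2r ?invr_ge0 ?(ltW rt0)//; apply: lerD.
    by rewrite (mulrAC _ M) ler_wpM2l// !mulr_ge0// ltW.
  by rewrite (mulrAC _ M) ler_wpM2l// !mulr_ge0 ?exprn_ge0// ltW.
rewrite GE /H.
have -> : - (n%:R * (F u - F U)) + n%:R * avg (D u) -
    (- (n%:R * s2) * (u - U) ^+ 2 / 2 + rt * kap * (u - U)) =
  - (n%:R * (F u - F U) - n%:R * s2 * (u - U) ^+ 2 / 2) +
  (n%:R * avg (D u) - rt * kap * (u - U)) by ring.
apply: le_trans (ler_normD _ _) _; rewrite normrN.
apply: le_trans (lerD e1 e2) _; rewrite -mulrDl.
by rewrite le_eqVlt; apply/orP; left; apply/eqP; rewrite /P; ring.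
Qed.

(** By [cubic_le_expR], [P] is at most the first factor times [exp tau]. Completing the square gives
    [- c tau ^ 2 + (beta M + 1) tau <= - c tau ^ 2 / 2 + (beta M + 1) ^ 2 / (2 c)]. *)
Definition tilt_const := (54 * beta ^+ 3 + 2 * beta * M + 8 * beta ^+ 2 * M) *
  expR ((beta * M + 1) ^+ 2 / (2 * c)).

Lemma tilt_const_ge0 : 0 <= tilt_const.
Proof. by rewrite mulr_ge0 ?expR_ge0// !addr_ge0 ?mulr_ge0 ?exprn_ge0// ltW. Qed.

Let pointwise u : `|expR (G u) - expR (H u)| <=
  tilt_const / rt * expR (- (n%:R * c) * (u - U) ^+ 2 / 2).
Proof.
apply: le_trans (expR_diff_le (G_le u) (H_le u)) _.
apply: le_trans (ler_wpM2r (expR_ge0 _) (GH u)) _.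
rewrite mulrAC [leRHS]mulrAC ler_wpM2r ?invr_ge0 ?(ltW rt0)//.
have t0 : 0 <= tau u by exact: normr_ge0.
have [q1 q2 q3] := cubic_le_expR t0.
have -> : - (n%:R * c) * (u - U) ^+ 2 / 2 = - c * tau u ^+ 2 / 2 by rewrite -tau2; ring.
have PP : P u <= (54 * beta ^+ 3 + 2 * beta * M + 8 * beta ^+ 2 * M) * expR (tau u).
  have -> : (54 * beta ^+ 3 + 2 * beta * M + 8 * beta ^+ 2 * M) * expR (tau u) =
    2 * beta ^+ 3 * (27 * expR (tau u)) + 2 * beta * M * expR (tau u) +
    2 * beta ^+ 2 * M * (4 * expR (tau u)) by move: (expR _) => e; ring.
  have b3 : 0 <= 2 * beta ^+ 3 by rewrite mulr_ge0// exprn_ge0// ltW.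
  have bM : 0 <= 2 * beta * M by rewrite !mulr_ge0// ltW.
  have bM2 : 0 <= 2 * beta ^+ 2 * M by rewrite !mulr_ge0// ?exprn_ge0// ltW.
  by rewrite /P; apply: lerD; [apply: lerD|]; apply: ler_wpM2l.
apply: le_trans (ler_wpM2r (expR_ge0 _) PP) _.
rewrite /tilt_const -!mulrA; apply: ler_wpM2l.
  by rewrite !addr_ge0 ?mulr_ge0 ?exprn_ge0// ltW.
rewrite -!expRD ler_expR /env.
have : 0 <= (c * tau u - (beta * M + 1)) ^+ 2 / (2 * c).
  by rewrite divr_ge0 ?sqr_ge0// mulr_ge0// ltW.
have -> : (c * tau u - (beta * M + 1)) ^+ 2 / (2 * c) =
   c * tau u ^+ 2 / 2 - (beta * M + 1) * tau u + (beta * M + 1) ^+ 2 / (2 * c).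
  by field; rewrite lt0r_neq0.
by lra.
Qed.

Lemma laplace_tilted :
  `|expR (n%:R * F U - A) * L (field_wt beta a') -
    expR (kap ^+ 2 / (2 * s2)) * Num.sqrt (2 * pi / (n%:R * s2))| <=
  tilt_const / rt * Num.sqrt (2 * pi / (n%:R * c)).
Proof.
have nc0 : 0 < n%:R * c by exact: mulr_gt0.
have ns0 : 0 < n%:R * s2 by exact: mulr_gt0.
have [ig Lg] := L_gauss U nc0; have [iH LH] := L_gauss_tilt U (rt * kap) ns0.
have ib : integ (field_wt beta a') by exact: field_wt_integ.
rewrite -Lg -LZ//; have -> : expR (kap ^+ 2 / (2 * s2)) * Num.sqrt (2 * pi / (n%:R * s2)) =
    L (fun u => expR (H u)).
  rewrite LH; congr (expR _ * _); rewrite -rt2; move: (kap) => k.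
  by field; rewrite !lt0r_neq0.
have EG : (fun u => expR (n%:R * F U - A) * field_wt beta a' u) = (fun u => expR (G u)).
  apply/funext => u; rewrite field_wtE// -expRD; congr expR.
  by rewrite /G; ring.
have iG : integ (fun u => expR (G u)) by rewrite -EG; exact: integZ.
rewrite EG -[leRHS]LZ//.
have -> : L (fun u => expR (G u)) - L (fun u => expR (H u)) =
    L (fun u => expR (G u) + -1 * expR (H u)).
  by rewrite LD//; [rewrite LZ// mulN1r|exact: integZ].
have iGH : integ (fun u => expR (G u) + -1 * expR (H u)) by apply: integD => //; exact: integZ.
apply: le_trans (L_norm iGH) _; apply: L_le; [exact: integ_norm|exact: integZ|].
by move=> u; rewrite mulN1r.
Qed.

End Tilt.

Lemma laplace_untilted :
  `|expR (n%:R * F U) * L (field_wt beta a) - Num.sqrt (2 * pi / (n%:R * s2))| <=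
  tilt_const 0 / rt * Num.sqrt (2 * pi / (n%:R * c)).
Proof.
have e0 : avg (fun i : 'I_n => `|0 : R|) <= 0 by rewrite avg_cst// normr0.
have e2 : avg (fun i : 'I_n => (0 : R) ^+ 2) <= 0 by rewrite avg_cst// expr0n.
have := laplace_tilted e0 e2.
have -> : (fun i => a i + 0 / rt) = a by apply/funext => i; rewrite mul0r addr0.
have -> : (fun i => lcosh (beta * U + (a i + 0 / rt))) = (fun i => lcosh (beta * U + a i)).
  by apply/funext => i; rewrite mul0r addr0.
by rewrite subrr mulr0 subr0 avgZ mul0r mulr0 expr0n/= mul0r expR0 mul1r.
Qed.

Section LogRatio.
Variables (b : 'I_n -> R) (M : R).
Hypotheses (b1 : avg (fun i => `|b i|) <= M) (b2 : avg (fun i => b i ^+ 2) <= M).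
Hypothesis b3 : avg (fun i => `|b i| ^+ 3) <= M.
Let M0 : 0 <= M. Proof. by apply: le_trans b1; exact: avg_ge0. Qed.
Let a' i : R := a i + b i / rt.
Let kap : R := beta * avg (fun i => b i * sech2 (beta * U + a i)).
(** Relative error of the Laplace approximation. The factor [sqrt (beta / c)] compares the Gaussian
    integral of precision [n c] in the error with the one of precision [n s2] in the main term,
    where [s2 <= beta]. *)
Let E := tilt_const M * Num.sqrt (beta / c) / rt.
Hypothesis small : E <= 2^-1.

Lemma hess_le : s2 <= beta.
Proof.
rewrite /s2 /hess gerBl; apply: mulr_ge0; first by rewrite exprn_ge0// ltW.
by apply: avg_ge0 => i; exact/ltW/sech2_gt0.
Qed.

(** The first two main terms expand [A], the change of the log weight at [U], with error [2 M / rt];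
    the third is the log of the ratio of tilted to untilted Gaussian integrals. Two logarithms
    [ln (1 + e)] with [|e| <= E] cost [2 E] each. *)
Lemma log_laplace_ratio :
  `|ln (L (field_wt beta a') / L (field_wt beta a)) -
    (rt * avg (fun i => b i * tanhR (beta * U + a i)) +
     avg (fun i => b i ^+ 2 * sech2 (beta * U + a i)) / 2 + kap ^+ 2 / (2 * s2))| <=
  4 * E + 2 * M / rt.
Proof.
pose A : R := n%:R * (avg (fun i => lcosh (beta * U + a' i)) -
  avg (fun i => lcosh (beta * U + a i))).
have rtn : rt != 0 by exact: lt0r_neq0.
have hA : `|A - (rt * avg (fun i => b i * tanhR (beta * U + a i)) +
     avg (fun i => b i ^+ 2 * sech2 (beta * U + a i)) / 2)| <= 2 * M / rt.
  have E1 : rt * avg (fun i => b i * tanhR (beta * U + a i)) +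
      avg (fun i => b i ^+ 2 * sech2 (beta * U + a i)) / 2 =
      n%:R * avg (fun i => rt^-1 * (b i * tanhR (beta * U + a i)) +
        (2 * n%:R)^-1 * (b i ^+ 2 * sech2 (beta * U + a i))).
    rewrite avgD !avgZ -rt2; move: (avg _) (avg _) => p q.
    by field.
  rewrite E1 /A -avgB -mulrBr normrM (gtr0_norm nR).
  apply: (@le_trans _ _ (n%:R * avg (fun i => 2 / rt ^+ 3 * `|b i| ^+ 3))).
    rewrite ler_wpM2l ?(ltW nR)//; apply: avg_close => i.
    have := lcosh_taylor3 (beta * U + a i) (b i / rt).
    rewrite normrM normfV (gtr0_norm rt0) /a' (addrA (beta * U)).
    have -> : 2 * (`|b i| / rt) ^+ 3 = 2 / rt ^+ 3 * `|b i| ^+ 3 by field.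
    apply: le_trans; rewrite le_eqVlt; apply/orP; left; apply/eqP; congr `|_|.
    by rewrite -rt2; move: (lcosh _) (lcosh _) (tanhR _) (sech2 _) => p q r s; field.
  rewrite avgZ -rt2; have -> : rt ^+ 2 * (2 / rt ^+ 3 * avg (fun i => `|b i| ^+ 3)) =
    2 * avg (fun i => `|b i| ^+ 3) / rt by move: (avg _) => p; field.
  by rewrite ler_wpM2r ?invr_ge0 ?(ltW rt0)// ler_wpM2l.
have h1 := laplace_tilted b1 b2; have h0 := laplace_untilted.
pose S := Num.sqrt (2 * pi / (n%:R * s2)).
have S0 : 0 < S by rewrite sqrtr_gt0 divr_gt0 ?mulr_gt0// pi_gt0.
have SS : Num.sqrt (2 * pi / (n%:R * c)) <= Num.sqrt (beta / c) * S.
  have bc0 : 0 <= beta / c by rewrite divr_ge0// ltW.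
  rewrite /S -sqrtrM// ler_wsqrtr//.
  have -> : beta / c * (2 * pi / (n%:R * s2)) = beta / s2 * (2 * pi / (n%:R * c)).
    by field; rewrite !lt0r_neq0.
  rewrite ler_peMl//; last by rewrite ler_pdivlMr// mul1r hess_le.
  by rewrite divr_ge0 ?mulr_ge0 ?pi_ge0// ltW.
have tc0 : tilt_const 0 <= tilt_const M.
  rewrite /tilt_const ler_pM ?expR_ge0//.
  - by rewrite !mulr0 !addr0 mulr_ge0// exprn_ge0// ltW.
  - by rewrite !mulr0 !addr0 -addrA lerDl addr_ge0// !mulr_ge0// ?exprn_ge0// ltW.
  - rewrite ler_expR ler_wpM2r ?invr_ge0 ?mulr_ge0 ?(ltW c0)//.
    by rewrite mulr0 add0r lerXn2r ?nnegrE ?addr_ge0 ?mulr_ge0 ?(ltW b0)// lerDr mulr_ge0// ltW.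
have tM0 : 0 <= tilt_const M by exact: (tilt_const_ge0 b1).
pose q := kap ^+ 2 / (2 * s2).
have q0 : 0 <= q by rewrite divr_ge0 ?sqr_ge0// mulr_ge0// ltW.
have E0 : 0 <= E.
  by rewrite /E; apply: divr_ge0; [apply: mulr_ge0 => //; exact: sqrtr_ge0|exact: ltW].
have gen t : 0 <= t -> t <= tilt_const M ->
    t / rt * Num.sqrt (2 * pi / (n%:R * c)) <= E * S.
  move=> t0 tM; rewrite /E; move: (tilt_const M) tM => T tT.
  have -> : T * Num.sqrt (beta / c) / rt * S = T / rt * (Num.sqrt (beta / c) * S) by ring.
  rewrite ler_pM ?sqrtr_ge0//; first by rewrite divr_ge0// ltW.
  by rewrite ler_wpM2r// invr_ge0 ltW.
have k1 : `|expR (n%:R * F U - A) * L (field_wt beta a') - expR q * S| <= E * S.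
  by apply: le_trans h1 _; exact: gen.
have k0 : `|expR (n%:R * F U) * L (field_wt beta a) - S| <= E * S.
  apply: le_trans h0 _; apply: gen => //.
  by apply: (@tilt_const_ge0 (fun=> 0)); rewrite avg_cst// normr0.
have L0 := L_field_wt_gt0 n0 b0 g0.
set Lb := L (field_wt beta a') in k1 *; set La := L (field_wt beta a) in k0 L0 *.
pose e1 := (expR (n%:R * F U - A) * Lb / S - expR q) / expR q.
pose e0 := expR (n%:R * F U) * La / S - 1.
have Sn := lt0r_neq0 S0; have Qn := lt0r_neq0 (expR_gt0 q).
have nS (x : R) : `|x * S| = `|x| * S by rewrite normrM (gtr0_norm S0).
have e1E : `|e1| <= E.
  rewrite /e1 normrM normfV (gtr0_norm (expR_gt0 q)) ler_pdivrMr ?expR_gt0//.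
  apply: (@le_trans _ _ E); last first.
    by apply: ler_peMr => //; rewrite -expR0 ler_expR.
  by rewrite -(ler_pM2r S0) -nS mulrBl divfK.
have e0E : `|e0| <= E.
  by rewrite -(ler_pM2r S0) -nS mulrBl divfK// mul1r.
have l1 := ln1D_norm_le (le_trans e1E small).
have l0 := ln1D_norm_le (le_trans e0E small).
have p1 : 0 < 1 + e1 by have := le_trans e1E small; rewrite ler_norml; lra.
have p0 : 0 < 1 + e0 by have := le_trans e0E small; rewrite ler_norml; lra.
have R1 : Lb / La = expR A * expR q * (1 + e1) / (1 + e0).
  have -> : 1 + e0 = expR (n%:R * F U) * La / S by rewrite /e0; ring.
  have -> : 1 + e1 = expR (n%:R * F U) * Lb / (S * expR q * expR A).
    rewrite /e1 expRD expRN; move: (expR _) (expR_gt0 A) => x.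
    by move: (expR A) => y y0; field; rewrite Sn Qn lt0r_neq0.
  have := lt0r_neq0 (expR_gt0 A); have := lt0r_neq0 (expR_gt0 (n%:R * F U)).
  by move: (expR A) (expR (n%:R * _)) => x y x0 y0; field; rewrite Sn Qn x0 y0 lt0r_neq0.
have -> : ln (Lb / La) = A + q + ln (1 + e1) - ln (1 + e0).
  rewrite R1 ln_div ?posrE ?mulr_gt0 ?expR_gt0//.
  by rewrite lnM ?posrE ?mulr_gt0 ?expR_gt0// lnM ?posrE ?expR_gt0// !expRK.
rewrite -/q; move: l1 l0 hA; rewrite !ler_norml.
move: (ln _) (ln _) (rt * _) (avg _ / 2) => x1 x0 y z.
move=> /andP[? ?] /andP[? ?] /andP[? ?]; apply/andP; split; lra.
Qed.

End LogRatio.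
End LaplaceRatio.

(** * The population objective *)

Section Population.
Variables (R : realType) (d : nat) (beta m : R) (th : 'rV[R]_d).
Hypotheses (b1 : 1 < beta) (m0 : 0 < m) (mE : m = tanhR (beta * m)).
Hypothesis th0 : 0 < sqnorm th.
Let b0 : 0 < beta. Proof. exact: lt_trans b1. Qed.
Let m1 : m < 1. Proof. exact: (meanfield_lt1 m0 mE). Qed.
Implicit Types (g f : 'rV[R]_d -> R) (u v y : R).
Local Notation mix := (mix_expect m th).

Lemma mixD f g : nice f -> nice g -> mix (fun X => f X + g X) = mix f + mix g.
Proof.
move=> nf ng; rewrite !mix_expectE//; last exact: niceD.
rewrite !gED//; move: (gE _ _) (gE _ _) (gE _ _) (gE _ _) => p q r s; ring.
Qed.

Lemma mixZ c g : nice g -> mix (fun X => c * g X) = c * mix g.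
Proof.
move=> ng; rewrite !mix_expectE ?gEZ//; last exact: niceZ.
by move: (gE _ _) (gE _ _) => p q; ring.
Qed.

Lemma mix_cst c : mix (fun=> c) = c.
Proof. by rewrite mix_expectE ?gE_cst; [field|exact: nice_cst]. Qed.

Lemma nice_sub f g : nice f -> nice g -> nice (fun X => f X - g X).
Proof.
move=> nf ng; have -> : (fun X => f X - g X) = (fun X => f X + (-1) * g X).
  by apply/funext => X; rewrite mulN1r.
by apply: niceD => //; exact: niceZ.
Qed.

Lemma mixB f g : nice f -> nice g -> mix (fun X => f X - g X) = mix f - mix g.
Proof.
move=> nf ng; have -> : (fun X => f X - g X) = (fun X => f X + (-1) * g X).
  by apply/funext => X; rewrite mulN1r.
by rewrite mixD ?mixZ ?mulN1r//; exact: niceZ.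
Qed.

Lemma mix_le f g : nice f -> nice g -> (forall X, f X <= g X) -> mix f <= mix g.
Proof.
move=> nf ng fg; rewrite !mix_expectE// lerD// ler_wpM2l ?gE_le//.
- by have := m0; lra.
- by have := m1; lra.
Qed.

Lemma mix_close f g h : nice f -> nice g -> nice h ->
  (forall X, `|f X - g X| <= h X) -> `|mix f - mix g| <= mix h.
Proof.
move=> nf ng nh fg; rewrite ler_norml; apply/andP; split.
- have -> : - mix h = mix (fun X => -1 * h X) by rewrite mixZ// mulN1r.
  rewrite -mixB//; apply: mix_le => [||X]; [exact: niceZ|exact: nice_sub|].
  by have := fg X; rewrite ler_norml mulN1r => /andP[].
- rewrite -mixB//; apply: mix_le => // [|X]; first exact: nice_sub.
  by have := fg X; rewrite ler_norml => /andP[].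
Qed.

Lemma nice_comp_lip (k : R -> R) (c A : R) w : continuous k -> 0 <= A ->
  (forall t, `|k t| <= A + `|t|) -> nice (fun X : 'rV[R]_d => k (c + dotv w X)).
Proof.
move=> ck A0 kA.
have nd : nice (fun X : 'rV[R]_d => c + dotv w X).
  by apply: niceD; [exact: nice_cst|exact: nice_dotv].
have [_ [C [C0 hC]]] := niceD (nice_cst d A) (nice_norm nd).
split; first by apply: (cmeas_comp (g := k)) => //; exact: nd.1.
exists C; split => // X; apply: le_trans (hC X).
by rewrite (@ger0_norm _ (A + _)) ?addr_ge0.
Qed.

Lemma lcosh0 : lcosh (0 : R) = 0.
Proof. by rewrite /lcosh /coshR oppr0 expR0 -[1 + 1]/(2%:R) divff ?ln1// pnatr_eq0. Qed.

Lemma nice_lcosh c : nice (fun X => lcosh (c + dotv th X)).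
Proof.
apply: (@nice_comp_lip _ _ 0) => // [|t]; first exact: continuous_lcosh.
by have := lcosh_lip 0 t; rewrite add0r lcosh0 subr0 add0r.
Qed.

Lemma nice_tanh c : nice (fun X => tanhR (c + dotv th X)).
Proof.
by apply: (@nice_comp_dotv _ _ (@tanhR R) _ 1) => [|t]; [exact: continuous_tanhR|
  exact/ltW/tanhR_norm_lt1].
Qed.

Lemma nice_sech2 c : nice (fun X => sech2 (c + dotv th X)).
Proof.
apply: (@nice_comp_dotv _ _ (@sech2 R) _ 1) => [|t]; first exact: continuous_sech2.
by rewrite ger0_norm ?sech2_le1//; exact/ltW/sech2_gt0.
Qed.

Lemma coshRE (x : R) : coshR x = expR (lcosh x).
Proof. by rewrite lnK// posrE coshR_gt0. Qed.

(* The law of one observation when the latent field equals [u]. *)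
Definition tilted u g := (expR (beta * u) * gE th g + expR (- (beta * u)) * gE (- th) g) /
  (2 * coshR (beta * u)).

Lemma tilted_m g : nice g -> tilted m g = mix g.
Proof.
move=> ng; rewrite mix_expectE// /tilted /coshR; have := mE; rewrite /tanhR.
have := expR_gt0 (beta * m); have := expR_gt0 (- (beta * m)).
move: (expR _) (expR _) (gE _ _) (gE _ _) => x y p q x0 y0 me; rewrite me; field.
by apply: lt0r_neq0; lra.
Qed.

(** Tilting each component back to the centred Gaussian gives all fields a common reference law;
    likelihood ratios become quotients of [cosh]. *)
Lemma tilted_gauss u g : nice g -> tilted u g =
  expR (- (sqnorm th / 2)) * gE 0 (fun X => coshR (beta * u + dotv th X) * g X) / coshR (beta * u).
Proof.
move=> ng.
have nP := niceM (nice_exp_dotv th) ng; have nN := niceM (nice_exp_dotv (- th)) ng.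
have -> : (fun X => coshR (beta * u + dotv th X) * g X) =
   (fun X => expR (beta * u) / 2 * (expR (dotv th X) * g X) +
             expR (- (beta * u)) / 2 * (expR (dotv (- th) X) * g X)).
  by apply/funext => X; rewrite /coshR opprD dotvNl !expRD; ring.
rewrite gED ?gEZ//; [|exact: niceZ|exact: niceZ].
rewrite !gE_tilt// !add0r sqnormN.
have z0 w : dotv w (0 : 'rV[R]_d) = 0 by exact: dotvr0.
rewrite !z0 !add0r /tilted (expRN (sqnorm th / 2)); have := lt0r_neq0 (coshR_gt0 (beta * u)).
have := lt0r_neq0 (expR_gt0 (sqnorm th / 2)).
move: (expR (sqnorm th / 2)) (expR _) (expR _) (gE _ _) (gE _ _) (coshR _) => x y z p q c x0 c0.
by field; rewrite x0 c0.
Qed.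

(** Log likelihood ratio of one observation [X], with [y = dotv th X], between the latent fields [u]
    and [m]. *)
Definition llr u y := lcosh (beta * u + y) - lcosh (beta * m + y) - lcosh (beta * u) + lcosh (beta * m).

Lemma continuous_llr u : continuous (llr u).
Proof.
have c k : continuous (fun y : R => lcosh (k + y)).
  by move=> y; exact: (@differentiable_continuous _ _ _ _ _ (proj1 (derivable1_diffP _ _) (@ex_derive _ _ _ _ _ _ _ (is_derive_shift (is_derive_lcosh (k + y)))))).
move=> y; apply: cvgD; last exact: cvg_cst.
by apply: cvgB; [apply: cvgB; exact: c|exact: cvg_cst].
Qed.

Lemma llr_bound u y : `|llr u y| <= 2 * (beta * `|u - m|).
Proof.
have e : forall y, `|lcosh (beta * u + y) - lcosh (beta * m + y)| <= beta * `|u - m|.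
  move=> t; have := lcosh_lip (beta * m + t) (beta * (u - m)).
  by rewrite normrM (gtr0_norm b0) (_ : beta * m + t + _ = beta * u + t)//; ring.
have := e y; have := e 0; rewrite !addr0 /llr => h1 h2.
have -> : lcosh (beta * u + y) - lcosh (beta * m + y) - lcosh (beta * u) + lcosh (beta * m) =
  (lcosh (beta * u + y) - lcosh (beta * m + y)) - (lcosh (beta * u) - lcosh (beta * m)) by ring.
by apply: le_trans (ler_normB _ _) _; lra.
Qed.

Lemma nice_expllr (c u : R) : nice (fun X => expR (c * llr u (dotv th X))).
Proof.
have ck : continuous (fun y => expR (c * llr u y)).
  move=> y; apply: (@continuous_comp _ _ _ (fun y => c * llr u y) expR); last exact: continuous_expR.
  by apply: cvgM; [exact: cvg_cst|exact: continuous_llr].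
have -> : (fun X => expR (c * llr u (dotv th X))) = (fun X => expR (c * llr u (0 + dotv th X))).
  by apply/funext => X; rewrite add0r.
apply: (@nice_comp_dotv _ d _ 0 (expR (`|c| * (2 * (beta * `|u - m|)))) th ck) => t.
rewrite ger0_norm ?expR_ge0// ler_expR (le_trans (ler_norm _))// normrM.
by rewrite ler_wpM2l// llr_bound.
Qed.

Lemma coshR_llr u y :
  coshR (beta * m + y) * expR (llr u y) = coshR (beta * m) / coshR (beta * u) * coshR (beta * u + y).
Proof.
rewrite !coshRE /llr; move: (lcosh _) (lcosh _) (lcosh _) (lcosh _) => p q r s.
by rewrite -(expRN q) -!expRD; congr (expR _); ring.
Qed.

Lemma mix_tilt u g : nice g -> mix (fun X => expR (llr u (dotv th X)) * g X) = tilted u g.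
Proof.
move=> ng; have nl : nice (fun X => expR (llr u (dotv th X))).
  have -> : (fun X => expR (llr u (dotv th X))) = (fun X => expR (1 * llr u (dotv th X))).
    by apply/funext => X; rewrite (mul1r (llr _ _)).
  exact: nice_expllr.
rewrite -tilted_m; last exact: niceM.
rewrite !tilted_gauss//; last exact: niceM.
have -> : (fun X => coshR (beta * m + dotv th X) * (expR (llr u (dotv th X)) * g X)) =
  (fun X => coshR (beta * m) / coshR (beta * u) * (coshR (beta * u + dotv th X) * g X)).
  apply/funext => X; have := coshR_llr u (dotv th X).
  move: (coshR _) (expR _) (coshR _) (coshR _) (coshR _) (g X) => p q r s t x e.
  by rewrite mulrA e -mulrA.
rewrite gEZ; last first.
  apply: niceM => //; have -> : (fun X => coshR (beta * u + dotv th X)) =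
    (fun X => 2^-1 * (expR (beta * u) * expR (dotv th X) + expR (- (beta * u)) * expR (dotv (- th) X))).
    by apply/funext => X; rewrite /coshR opprD dotvNl !expRD; ring.
  by apply: niceZ; apply: niceD; apply: niceZ; exact: nice_exp_dotv.
have := lt0r_neq0 (coshR_gt0 (beta * u)); have := lt0r_neq0 (coshR_gt0 (beta * m)).
move: (gE _ _) (coshR _) (coshR _) (expR _) => p x y z x0 y0.
by field; rewrite x0 y0.
Qed.

Lemma tilted_cst u : tilted u (fun=> 1) = 1.
Proof.
rewrite /tilted !gE_cst !mulr1 /coshR; have := expR_gt0 (beta * u); have := expR_gt0 (- (beta * u)).
by move: (expR _) (expR _) => x y x0 y0; field; rewrite lt0r_neq0// addr_gt0.
Qed.

(** Stationarity of the population objective at [m]. Relative to the centred Gaussian the density is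
    proportional to [cosh], which turns [tanh] into [sinh], a difference of exponentials. *)
Lemma mix_tanh : mix (fun X => tanhR (beta * m + dotv th X)) = m.
Proof.
rewrite -tilted_m; last exact: nice_tanh.
rewrite tilted_gauss; last exact: nice_tanh.
have -> : (fun X => coshR (beta * m + dotv th X) * tanhR (beta * m + dotv th X)) =
   (fun X => expR (beta * m) / 2 * (expR (dotv th X) * 1) +
             (- (expR (- (beta * m)) / 2)) * (expR (dotv (- th) X) * 1)).
  apply/funext => X; rewrite tanhRE mulrC divfK ?lt0r_neq0 ?coshR_gt0//.
  by rewrite opprD dotvNl !expRD; ring.
have n1 w : nice (fun X => expR (dotv w X) * 1) by apply: niceM; [exact: nice_exp_dotv|exact: nice_cst].
rewrite gED ?gEZ//; [|exact: niceZ|exact: niceZ].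
rewrite !gE_tilt; [|exact: nice_cst|exact: nice_cst].
have z0 w : dotv w (0 : 'rV[R]_d) = 0 by exact: dotvr0.
rewrite !gE_cst !z0 !add0r sqnormN (expRN (sqnorm th / 2)) [RHS]mE tanhRE.
have := lt0r_neq0 (expR_gt0 (sqnorm th / 2)); have := lt0r_neq0 (coshR_gt0 (beta * m)).
move: (expR _) (expR _) (coshR _) (expR _) => p q x y x0 p0.
by field; rewrite x0.
Qed.

Definition pop_obj u := beta * u ^+ 2 / 2 - mix (fun X => lcosh (beta * u + dotv th X)).

Let nl u : nice (fun X => llr u (dotv th X)).
Proof.
apply: niceD; last exact: nice_cst; apply: nice_sub; last exact: nice_cst.
by apply: nice_sub; exact: nice_lcosh.
Qed.

Lemma pop_objE u : pop_obj u - pop_obj m =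
  mf_obj beta u - mf_obj beta m - mix (fun X => llr u (dotv th X)).
Proof.
rewrite /llr mixD; [|by apply: nice_sub; [apply: nice_sub; exact: nice_lcosh|exact: nice_cst]|exact: nice_cst].
rewrite mixB; [|by apply: nice_sub; exact: nice_lcosh|exact: nice_cst].
rewrite mixB; [|exact: nice_lcosh|exact: nice_lcosh].
by rewrite !mix_cst /pop_obj /mf_obj; ring.
Qed.

(** Its mixture mean is the squared Hellinger distance between the laws of one observation at the
    fields [u] and [m]. *)
Definition sqrt_lr_dev u y : R := (expR (2^-1 * llr u y) - 1) ^+ 2.

Lemma nice_sqrt_lr_dev u : nice (fun X => sqrt_lr_dev u (dotv th X)).
Proof.
have n3 := nice_sub (nice_expllr 2^-1 u) (nice_cst d (1 : R)).
exact: (niceM n3 n3).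
Qed.

(* With the half likelihood ratio [s], [ln s ^+ 2 <= 2 (s - 1) = (s ^+ 2 - 1) - (s - 1) ^+ 2]
   and [s ^+ 2 - 1] has mean zero. *)
Lemma mix_llr_le u : mix (fun X => llr u (dotv th X)) <=
  - mix (fun X => sqrt_lr_dev u (dotv th X)).
Proof.
have n1 := nice_expllr 1 u; have nc := nice_cst d (1 : R); have ns := nice_sqrt_lr_dev u.
have e1 : mix (fun X => expR (1 * llr u (dotv th X))) = 1.
  have := mix_tilt u nc; rewrite tilted_cst => e.
  by rewrite -[RHS]e; congr mix_expect; apply/funext => X; rewrite mul1r mulr1.
rewrite -subr_ge0 -opprD oppr_ge0.
have -> : (0 : R) = mix (fun X => expR (1 * llr u (dotv th X)) - 1).
  by rewrite mixB// e1 mix_cst subrr.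
rewrite -mixD//; apply: mix_le => [||X]; [exact: niceD|exact: nice_sub|].
have -> : 1 * llr u (dotv th X) = 2^-1 * llr u (dotv th X) + 2^-1 * llr u (dotv th X) by field.
rewrite expRD /sqrt_lr_dev; have := expR_ge1Dx (2^-1 * llr u (dotv th X)).
by move: (llr _ _) => y; move: (expR _) => x; nra.
Qed.

(** The function [exp (th . X)] has different means at the fields [m] and [- m], by [D > 0].
    Cauchy-Schwarz, in additive form with a free parameter [a], bounds [D] through the Hellinger
    term, which therefore cannot vanish. *)
Lemma sqrt_lr_dev_gt0 : 0 < mix (fun X => sqrt_lr_dev (- m) (dotv th X)).
Proof.
pose g (X : 'rV[R]_d) := expR (dotv th X); have ng : nice g by exact: nice_exp_dotv.
have n1 := nice_expllr 1 (- m); have nh := nice_expllr 2^-1 (- m).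
have nc := nice_cst d (1 : R).
pose s X := expR (2^-1 * llr (- m) (dotv th X)).
have nq : nice (fun X => ((s X + 1) * g X) ^+ 2).
  have n3 := niceM (niceD nh nc) ng; exact: (niceM n3 n3).
have nl1 : nice (fun X => expR (llr (- m) (dotv th X))).
  have -> : (fun X => expR (llr (- m) (dotv th X))) = (fun X => expR (1 * llr (- m) (dotv th X))).
    by apply/funext => X; rewrite (mul1r (llr _ _)).
  exact: nice_expllr.
pose D := mix (fun X => g X - expR (llr (- m) (dotv th X)) * g X).
have D0 : 0 < D.
  have ez w : gE w (fun X => expR (dotv th X)) = expR (dotv th w + sqnorm th / 2).
    have e : (fun X => expR (dotv th X)) = (fun X => expR (dotv th X) * 1) by apply/funext => X; rewrite mulr1.
    by rewrite e gE_tilt// gE_cst mulr1.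
  rewrite /D mixB//; last exact: niceM.
  rewrite mix_tilt// -(tilted_m ng) /tilted !ez.
  have -> : dotv th (- th) = - sqnorm th by rewrite dotvC dotvNl.
  rewrite mulrN opprK /coshR opprK.
  have : expR (- sqnorm th + sqnorm th / 2) < expR (dotv th th + sqnorm th / 2).
    by rewrite ltr_expR /sqnorm; move: th0; rewrite /sqnorm; lra.
  have : expR (- (beta * m)) < expR (beta * m).
    by rewrite ltr_expR; have : 0 < beta * m; [exact: mulr_gt0|lra].
  have := expR_gt0 (- (beta * m)).
  move: (expR _) (expR _) (expR _) (expR _) => x y p q q0 qp yx.
  have -> : (p * x + q * y) / (2 * ((p + q) / 2)) - (q * x + p * y) / (2 * ((q + p) / 2)) =
    (p - q) * (x - y) / (q + p) by field; rewrite lt0r_neq0//; lra.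
  by rewrite divr_gt0 ?mulr_gt0//; lra.
set V := mix _; pose B := mix (fun X => ((s X + 1) * g X) ^+ 2).
have hB (a : R) : 0 < a -> D <= a / 2 * V + (2 * a)^-1 * B.
  move=> a0; have nV := nice_sqrt_lr_dev (- m).
  have nV' := niceZ (a / 2) nV; have nB' := niceZ (2 * a)^-1 nq.
  rewrite /V /B -(mixZ (a / 2) nV) -(mixZ (2 * a)^-1 nq) -mixD//.
  apply: mix_le => [||X]; [by apply: nice_sub => //; exact: niceM|exact: niceD|].
  have -> : llr (- m) (dotv th X) = 2^-1 * llr (- m) (dotv th X) + 2^-1 * llr (- m) (dotv th X) by field.
  rewrite expRD /sqrt_lr_dev -/(s X); move: (s X) (g X) => t y.
  rewrite -subr_ge0; have -> : a / 2 * (t - 1) ^+ 2 + (2 * a)^-1 * ((t + 1) * y) ^+ 2 - (y - t * t * y) =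
    (a * (t - 1) + (t + 1) * y) ^+ 2 / (2 * a) by field; rewrite lt0r_neq0.
  by rewrite divr_ge0 ?sqr_ge0// mulr_ge0// ltW.
have B0 : 0 <= B.
  have e0 : mix (fun=> 0) = 0 by rewrite mix_cst.
  by rewrite -[leLHS]e0; apply: mix_le => [||X]; [exact: nice_cst|by []|exact: sqr_ge0].
(* With this parameter the second term of [hB] is at most [D / 2], so [V <= 0] would give
   [D <= D / 2]. *)
have a0 : 0 < (B + 1) / D by rewrite divr_gt0//; lra.
have := hB _ a0; rewrite ltNge; apply: contraTN => V0; rewrite -ltNge.
have : (B + 1) / D / 2 * V <= 0 by rewrite mulr_ge0_le0// divr_ge0// ltW.
have -> : (2 * ((B + 1) / D))^-1 * B = D / 2 * (B / (B + 1)) by field; rewrite !lt0r_neq0//; lra.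
have : D / 2 * (B / (B + 1)) <= D / 2.
  by rewrite ler_piMr ?divr_ge0 ?(ltW D0)// ler_pdivrMr; lra.
by lra.
Qed.

Lemma pop_obj_gt u : u != m -> pop_obj m < pop_obj u.
Proof.
move=> um; rewrite -subr_gt0 pop_objE.
have hq := mix_llr_le u; have ns := nice_sqrt_lr_dev u.
have q0 : 0 <= mix (fun X => sqrt_lr_dev u (dotv th X)).
  by rewrite -(mix_cst 0); apply: mix_le => [||X]; [exact: nice_cst|by []|exact: sqr_ge0].
have [->|um'] := eqVneq u (- m).
  by rewrite mf_objN subrr sub0r oppr_gt0 (le_lt_trans (mix_llr_le _))// oppr_lt0 sqrt_lr_dev_gt0.
suff : mf_obj beta m < mf_obj beta u by move: q0 hq; move: (mix _) (mix _) => p q; lra.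
have [u0|u0] := leP 0 u; first exact: (mf_obj_min b1 m0 mE).
rewrite -(mf_objN beta u); apply: (mf_obj_min b1 m0 mE); first by rewrite oppr_ge0 ltW.
by rewrite eqr_oppLR.
Qed.

Lemma continuous_pop_obj : continuous pop_obj.
Proof.
pose M (u : R) := mix (fun X => lcosh (beta * u + dotv th X)).
have lipM u v : `|M u - M v| <= beta * `|u - v|.
  rewrite /M; rewrite -(mix_cst (beta * `|u - v|)); apply: mix_close => [|||X];
    [exact: nice_lcosh|exact: nice_lcosh|exact: nice_cst|].
  have := lcosh_lip (beta * v + dotv th X) (beta * (u - v)).
  by rewrite normrM (gtr0_norm b0) (_ : beta * v + dotv th X + _ = beta * u + dotv th X)//; ring.
move=> u; apply: cvgB.
  by apply: cvgMl; apply: cvgM; [exact: cvg_cst|apply: cvgM; exact: cvg_id].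
apply/cvgrPdist_le => e e0; near=> v.
rewrite (le_trans (lipM u v))// -ler_pdivlMl//.
near: v; apply: cvgr_dist_le; first exact: cvg_id.
by rewrite mulr_gt0// invr_gt0.
Unshelve. all: by end_near. Qed.

Lemma pop_gap delta : 0 < delta ->
  exists2 eta, 0 < eta & forall u, `|u| <= 1 -> delta <= `|u - m| -> pop_obj m + eta <= pop_obj u.
Proof.
move=> d0; have [eta e0 h] := minimum_gap continuous_pop_obj d0
  (fun u (_ : -1 <= u <= 1) => @pop_obj_gt u).
by exists eta => // u; rewrite ler_norml; exact: h.
Qed.

(** Since [sech2 = 1 - tanh ^ 2] and [tanh] has mean [m], Jensen's inequality bounds the mean of
    [sech2] by [1 - m ^ 2 = sech2 (beta m)]; then [meanfield_slope] applies. *)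
Lemma gamma11_gt0 : 0 < gamma11 beta m th.
Proof.
have nt := nice_tanh (beta * m); have nc := nice_cst d.
have h : mix (fun X => sech2 (beta * m + dotv th X)) <= sech2 (beta * m).
  have -> : sech2 (beta * m) = mix (fun X => 1 + m ^+ 2 + (- (2 * m)) * tanhR (beta * m + dotv th X)).
    rewrite mixD ?mixZ ?mix_tanh ?mix_cst//; [|exact: niceZ].
    by rewrite sech2E -mE; ring.
  apply: mix_le => [||X]; [exact: nice_sech2|by apply: niceD => //; exact: niceZ|].
  rewrite sech2E; move: (tanhR _) => t; rewrite -subr_ge0.
  have -> : 1 + m ^+ 2 + - (2 * m) * t - (1 - t ^+ 2) = (m - t) ^+ 2 by ring.
  exact: sqr_ge0.
rewrite /gamma11; have := meanfield_slope b1 m0 mE => h1.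
have : beta ^+ 2 * mix (fun X => sech2 (beta * m + dotv th X)) <= beta * (beta * sech2 (beta * m)).
  by rewrite expr2 -mulrA !ler_pM2l.
have : beta * (beta * sech2 (beta * m)) < beta * 1 by rewrite ltr_pM2l.
by lra.
Qed.

End Population.

(** * Localisation of the minimiser *)

Section Localization.
Variables (R : realType) (n : nat) (beta m : R) (a : 'I_n -> R) (U : R).
Variables (F : R -> R) (g eta delta : R).
Hypotheses (n0 : (0 < n)%N) (b1 : 1 < beta) (m0 : 0 < m).
Let b0 : 0 < beta. Proof. exact: lt_trans b1. Qed.
Hypotheses (g0 : 0 < g) (eta0 : 0 < eta) (d0 : 0 < delta).
Hypotheses (d1 : 2 * delta <= 1 - m) (d2 : 32 * beta ^+ 3 * delta <= g).
Hypotheses (U1 : `|U| <= 1)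
  (Umin : forall u, `|u| <= 1 -> field_obj beta a U <= field_obj beta a u).
Hypotheses (gap : forall u, `|u| <= 1 -> delta <= `|u - m| -> F m + eta <= F u)
  (close : forall u, `|u| <= 1 -> `|field_obj beta a u - F u| <= eta / 4)
  (hclose : `|hess beta a m - g| <= g / 4).
Let Fn := field_obj beta a.
Let b3 : 0 < beta ^+ 3. Proof. exact: exprn_gt0. Qed.
Let m1 : `|m| <= 1.
Proof. by rewrite gtr0_norm//; move: d1 d0; lra. Qed.

(** Two errors of [eta / 4], at [u] and at [m], leave half of the population gap. *)
Let away u : `|u| <= 1 -> delta <= `|u - m| -> Fn U + eta / 2 <= Fn u.
Proof.
move=> u1 du; have := gap u1 du; have := close u1; have := close m1; have := Umin m1.
by rewrite -/Fn !ler_norml; move: (Fn u) (Fn m) (Fn U) (F u) (F m) => *; lra.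
Qed.

Let near_m : `|U - m| < delta.
Proof.
by rewrite ltNge; apply/negP => h; have := away U1 h; move: (Fn U) eta0 => *; lra.
Qed.

Let hess_lip u v : `|hess beta a u - hess beta a v| <= 2 * beta ^+ 3 * `|u - v|.
Proof.
rewrite /hess (_ : _ - _ = beta ^+ 2 * (avg (fun i => sech2 (beta * v + a i)) -
  avg (fun i => sech2 (beta * u + a i)))); last by ring.
rewrite normrM (@ger0_norm _ (beta ^+ 2)) ?sqr_ge0//.
rewrite (_ : 2 * beta ^+ 3 * `|u - v| = beta ^+ 2 * (2 * (beta * `|u - v|))); last by ring.
rewrite ler_wpM2l ?sqr_ge0// -(avg_cst (2 * (beta * `|u - v|)) n0).
apply: avg_close => i; have := sech2_lip (beta * u + a i) (beta * (v - u)).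
rewrite (_ : beta * u + a i + beta * (v - u) = beta * v + a i); last by ring.
by rewrite normrM (gtr0_norm b0) (distrC u v).
Qed.

Let hess_U : g / 2 <= hess beta a U.
Proof.
have h1 := hess_lip U m; have : 2 * beta ^+ 3 * `|U - m| <= 2 * beta ^+ 3 * delta.
  by rewrite ler_wpM2l ?(ltW near_m)// mulr_ge0// ltW.
move: h1 hclose d2; rewrite !ler_norml.
by move: (hess _ _ _) (hess _ _ _) (beta ^+ 3) (`|_|) => p q r s; lra.
Qed.

(** [U] is interior because it is close to [m < 1]. If the gradient did not vanish, a step along it
    would decrease the objective by [field_obj_upper]. *)
Let grad_U : grad beta a U = 0.
Proof.
apply/eqP; apply: contraT => gn.
have gp : 0 < `|grad beta a U| by rewrite normr_gt0.
have Ui : `|U| < 1.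
  have := ler_normD (U - m) m; rewrite subrK (gtr0_norm m0).
  by move: near_m d1 d0; lra.
(* The first bound makes the quadratic term at most half of the linear gain, the second keeps the
   new point in [[-1, 1]]. *)
pose t := Num.min beta^-1 ((1 - `|U|) / `|grad beta a U|).
have t0 : 0 < t by rewrite lt_min invr_gt0 b0 divr_gt0 ?subr_gt0.
have tb : beta * t <= 1.
  by rewrite mulrC -ler_pdivlMr// mul1r ge_min lexx.
have tg : t * `|grad beta a U| <= 1 - `|U| by rewrite -ler_pdivlMr// ge_min lexx orbT.
have u1 : `|U - t * grad beta a U| <= 1.
  by apply: le_trans (ler_normB _ _) _; rewrite normrM (gtr0_norm t0); lra.
have := Umin u1; rewrite -subr_ge0 => /le_trans/(_ (field_obj_upper beta a U (U - t * grad beta a U))).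
apply: contraTT => _; rewrite -ltNge.
have -> : U - t * grad beta a U - U = - (t * grad beta a U) by ring.
rewrite normr_gt0 in gp; have G2 : 0 < grad beta a U ^+ 2 by rewrite exprn_even_gt0.
have -> : grad beta a U * - (t * grad beta a U) + beta * (- (t * grad beta a U)) ^+ 2 / 2 =
  - (t * grad beta a U ^+ 2) + (beta * t) * (t * grad beta a U ^+ 2) / 2 by ring.
have p0 := mulr_gt0 t0 G2; by move: p0 tb; move: (t * _) (beta * t) => p q; nra.
Qed.

Let lcoshN (t : R) : lcosh (- t) = lcosh t.
Proof. by rewrite /lcosh coshRN. Qed.

(** The comparison is with the endpoint of the same sign as [u], itself at distance at least [delta]
    from [m]; negative [u] is handled by reflecting the field. *)
Let tail u : 1 < `|u| -> exists2 v, `|v| = 1 /\ delta <= `|v - m| & Fn v + beta * (`|u| - 1) ^+ 2 / 2 <= Fn u.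
Proof.
have tailp (b : 'I_n -> R) (t : R) : 1 < t ->
    field_obj beta b 1 + beta * (t - 1) ^+ 2 / 2 <= field_obj beta b t.
  move=> t1; rewrite !field_objE.
  have : avg (fun i => lcosh (beta * t + b i)) <=
         avg (fun i => lcosh (beta * 1 + b i)) + beta * (t - 1).
    rewrite -[X in _ + X](avg_cst _ n0) -avgD; apply: avg_le => i.
    by rewrite (mulr1 beta); apply: lcosh_tail => //; exact: (ltW t1).
  by move: (avg _) (avg _) => p q; lra.
move=> u1; have [u0|u0] := leP 0 u.
  exists 1; first by rewrite normr1; split => //; rewrite ger0_norm; move: d1 d0 m0; lra.
  by move: u1; rewrite ger0_norm//; exact: tailp.
have flip v : field_obj beta (fun i => - a i) (- v) = Fn v.
  rewrite /Fn !field_objE sqrrN; congr (_ - avg _); apply/funext => i.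
  by rewrite -lcoshN; congr lcosh; ring.
exists (-1).
  by rewrite normrN normr1; split => //; rewrite ler0_norm; move: d1 d0 m0; lra.
by move: u1; rewrite ltr0_norm// -!flip opprK; exact: tailp.
Qed.

Let c := Num.min (g / 8) (Num.min (eta / 16) (beta / 4)).

Lemma local_growth :
  [/\ grad beta a U = 0, 0 < c, g / 2 <= hess beta a U &
    forall u, c * (u - U) ^+ 2 <= field_obj beta a u - field_obj beta a U].
Proof.
have c0 : 0 < c by rewrite !lt_min !divr_gt0.
(* The radius around [U] is [2 delta]: as [|U - m| < delta], points outside are still at distance at
   least [delta] from [m], where [away] applies. *)
split => // u; apply: (@quadratic_growth _ _ u U (2 * delta) (g / 8) (eta / 2) beta c) => //.
- by rewrite ge_min lexx.
- by rewrite !ge_min (_ : eta / 2 / 8 = eta / 16) ?lexx ?orbT//; field.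
- by rewrite !ge_min lexx !orbT.
- move=> du; have := field_obj_taylor a n0 b0 U u; rewrite grad_U mul0r subr0.
  have : 2 * beta ^+ 3 * `|u - U| ^+ 3 <= g / 8 * (u - U) ^+ 2.
    rewrite (exprS `|_| 2) -[in leRHS]real_normK ?num_real// (mulrA _ `|_|) ler_wpM2r ?sqr_ge0//.
    have : 2 * beta ^+ 3 * `|u - U| <= 2 * beta ^+ 3 * (2 * delta) by rewrite ler_wpM2l// mulr_ge0// ltW.
    by move: d2; move: (beta ^+ 3) (`|_|) => p q; lra.
  have : g / 2 * (u - U) ^+ 2 <= hess beta a U * (u - U) ^+ 2 by rewrite ler_wpM2r ?sqr_ge0.
  rewrite ler_norml -/Fn; move: (Fn u - Fn U) (_ ^+ 3) (_ ^+ 2) => p q r; lra.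
- move=> u1 du; suff : delta <= `|u - m| by move/(away u1); rewrite -/Fn; move: (Fn u) (Fn U) => *; lra.
  have := ler_normD (u - m) (m - U); have -> : u - m + (m - U) = u - U by ring.
  by rewrite (distrC m); move: near_m du; lra.
- move=> /tail[v [v1 dv]]; have := away _ dv; rewrite v1 => /(_ (lexx _)).
  by rewrite -/Fn; move: (Fn v) (Fn u) (Fn U) (_ ^+ 2) => *; lra.
Qed.

(** The stationarity equation at [U] is linearised at [m], where the slope is at least [3 g / 4].
    The quadratic remainder is at most [g / 16 * |U - m|] because [|U - m| < delta], and is
    absorbed. *)
Lemma argmin_close : `|U - m| <= 2 * beta / g * `|avg (fun i => tanhR (beta * m + a i)) - m|.
Proof.
have aU : avg (fun i => tanhR (beta * U + a i)) = U.
  by move/eqP: grad_U; rewrite mulf_eq0 (gt_eqF b0)/= subr_eq0 => /eqP.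
have tay : `|avg (fun i => tanhR (beta * U + a i)) - avg (fun i => tanhR (beta * m + a i)) -
    beta * (U - m) * avg (fun i => sech2 (beta * m + a i))| <= 2 * (beta * (U - m)) ^+ 2.
  rewrite -avgZ -!avgB -[leRHS](avg_cst _ n0); apply: le_trans (avg_norm _) _; apply: avg_le => i.
  have := tanhR_taylor2 (beta * m + a i) (beta * (U - m)).
  by rewrite (_ : beta * m + a i + beta * (U - m) = beta * U + a i)//; ring.
set T := avg (fun i => tanhR (beta * m + a i)); rewrite aU -/T in tay.
have e : (U - m) * hess beta a m = beta * (T - m) + beta * (U - T -
    beta * (U - m) * avg (fun i => sech2 (beta * m + a i))) by rewrite /hess; ring.
have h1 : 3 / 4 * g <= hess beta a m by move: hclose; rewrite ler_norml; lra.
have h2 : `|U - m| * (3 / 4 * g) <= `|(U - m) * hess beta a m|.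
  by rewrite normrM ler_wpM2l// (le_trans h1)// ler_norm.
have h3 : `|(U - m) * hess beta a m| <= beta * `|T - m| + 2 * beta ^+ 3 * `|U - m| ^+ 2.
  rewrite e (le_trans (ler_normD _ _))// !normrM (gtr0_norm b0) lerD2l.
  apply: le_trans (ler_wpM2l (ltW b0) tay) _.
  by rewrite real_normK ?num_real// le_eqVlt; apply/orP; left; apply/eqP; ring.
have h4 : 2 * beta ^+ 3 * `|U - m| ^+ 2 <= g / 16 * `|U - m|.
  rewrite expr2 mulrA ler_wpM2r//.
  have : 2 * beta ^+ 3 * `|U - m| <= 2 * beta ^+ 3 * delta.
    by rewrite ler_wpM2l ?(ltW near_m)// mulr_ge0// ltW.
  by move: d2; move: (beta ^+ 3) (`|_|) => p q; lra.
rewrite mulrAC ler_pdivlMr//.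
have : 0 <= beta * `|T - m| by rewrite mulr_ge0 ?(ltW b0).
have := le_trans (le_trans h2 h3) (lerD (lexx _) h4).
by move: (`|U - m|) (`|T - m|) => p q; lra.
Qed.

End Localization.

Lemma ratio_close (R : realType) (s0 s t B p q : R) : 0 < s0 -> s0 <= s -> s0 <= t ->
  `|p| <= B -> `|q| <= B ->
  `|p ^+ 2 / (2 * s) - q ^+ 2 / (2 * t)| <= B / s0 * `|p - q| + B ^+ 2 / (2 * s0 ^+ 2) * `|s - t|.
Proof.
move=> s00 ss st pB qB; have B0 : 0 <= B := le_trans (normr_ge0 _) pB.
have s1 := lt_le_trans s00 ss; have t1 := lt_le_trans s00 st.
have -> : p ^+ 2 / (2 * s) - q ^+ 2 / (2 * t) =
  (p + q) / (2 * s) * (p - q) + q ^+ 2 / (2 * (s * t)) * (t - s).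
  by field; rewrite !lt0r_neq0.
apply: le_trans (ler_normD _ _) _; rewrite !normrM (distrC t); apply: lerD; rewrite ler_wpM2r//.
  have i1 : 0 < (2 * s)^-1 by rewrite invr_gt0 mulr_gt0.
  rewrite (gtr0_norm i1) ler_pdivrMr ?mulr_gt0//; have := ler_normD p q; have : B <= B / s0 * s by rewrite mulrAC ler_pdivlMr// ler_wpM2l.
  by move: pB qB; move: (B / s0) => k; move: (`|p|) (`|q|) (`|_|) => *; lra.
have i2 : 0 < (2 * (s * t))^-1 by rewrite invr_gt0 !mulr_gt0.
rewrite (gtr0_norm i2) expr2; apply: ler_pM; [exact: mulr_ge0|exact: ltW|exact: ler_pM|].
rewrite lef_pV2 ?posrE ?mulr_gt0 ?exprn_gt0//.
by rewrite ler_pM2l// expr2 ler_pM// ltW.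
Qed.

Lemma eventually_small (R : realType) (K e : R) : 0 <= K -> 0 < e ->
  exists N, forall n, (N <= n)%N -> (0 < n)%N /\ K / Num.sqrt n%:R <= e.
Proof.
move=> K0 e0; exists (Num.truncn ((K / e) ^+ 2)).+1 => n Nn.
have n0 : (0 < n)%N by exact: leq_trans Nn.
have nR : 0 < n%:R :> R by rewrite ltr0n.
split=> //; rewrite ler_pdivrMr ?sqrtr_gt0// mulrC -ler_pdivrMr//.
rewrite -(ger0_norm (divr_ge0 K0 (ltW e0))) -sqrtr_sqr ler_sqrt ?(ltW nR)//.
apply/ltW/(lt_le_trans (truncnS_gt _)); by rewrite ler_nat.
Qed.

Lemma chain_norm_le (R : realType) (l w p q r s t y z : R) :
  `|l - (w + r + p)| <= t -> `|p - q| <= z -> `|r - s| <= y ->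
  `|l - (w + (s + q))| <= t + (y + z).
Proof. by rewrite !ler_norml; lra. Qed.

Lemma avg_sum (R : realType) n (J : finType) (c : J -> R) (f : J -> 'I_n -> R) :
  avg (fun i => \sum_j c j * f j i) = \sum_j c j * avg (f j).
Proof.
rewrite /avg exchange_big mulr_sumr; apply: eq_bigr => j _.
by rewrite -mulr_sumr mulrCA.
Qed.

Lemma dotv_norm_le (R : realType) d (h X : 'rV[R]_d) : `|dotv h X| <= l1norm h * l1norm X.
Proof.
apply: le_trans (ler_norm_sum _ _ _) _; rewrite /l1norm mulr_suml ler_sum// => j _.
by rewrite normrM ler_wpM2l// (bigD1 j)//= lerDl sumr_ge0.
Qed.

Lemma sumr_close (R : realType) (J : finType) (c p q : J -> R) e :
  (forall j, `|p j - q j| <= e) ->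
  `|\sum_j c j * p j - \sum_j c j * q j| <= (\sum_j `|c j|) * e.
Proof.
move=> pq; rewrite -sumrB (le_trans (ler_norm_sum _ _ _))// mulr_suml ler_sum// => j _.
by rewrite -mulrBr normrM ler_wpM2l.
Qed.

(** * Deterministic expansion on the good event *)

Section RightGood.
Variables (R : realType) (d : nat) (beta m : R) (th : 'rV[R]_d).
Hypotheses (b1 : 1 < beta) (m0 : 0 < m) (mE : m = tanhR (beta * m)).
Hypothesis th0 : 0 < sqnorm th.
Let b0 : 0 < beta. Proof. exact: lt_trans b1. Qed.
Let m1 : m < 1. Proof. exact: (meanfield_lt1 m0 mE). Qed.
Implicit Types (h X : 'rV[R]_d).
Local Notation mix := (mix_expect m th).

Definition grid N (k : 'I_N.+1) : R := -1 + 2 * k%:R / N%:R.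
(** One moment statistic that dominates, up to a constant depending on [h], the powers [|h . X| ^ k]
    with [k <= 3] of the Taylor errors. *)
Definition envelope X : R := (1 + l1norm X) ^+ 3.
(** Finitely many statistics, none depending on [h]: log cosh on a grid for uniform control of the
    objective, the entries of the information matrix, [tanh] and [sech2] for the location and
    curvature of the minimum, and [envelope] for the remainders. *)
Definition stat N (j : 'I_N.+1 + ('I_d + 'I_d * 'I_d + 'I_3)) X : R :=
  match j with
  | inl k => lcosh (beta * grid k + dotv th X)
  | inr (inl (inl j)) => X 0 j * sech2 (beta * m + dotv th X)
  | inr (inl (inr jk)) => X 0 jk.1 * X 0 jk.2 * sech2 (beta * m + dotv th X)
  | inr (inr i) => nth 0 [:: tanhR (beta * m + dotv th X);
      sech2 (beta * m + dotv th X); envelope X] i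
  end.

Lemma stat_tanh N : @stat N (inr (inr (inord 0))) = (fun X => tanhR (beta * m + dotv th X)).
Proof. by apply/funext => X; rewrite /stat inordK. Qed.

Lemma stat_sech2 N : @stat N (inr (inr (inord 1))) = (fun X => sech2 (beta * m + dotv th X)).
Proof. by apply/funext => X; rewrite /stat inordK. Qed.

Lemma stat_envelope N : @stat N (inr (inr (inord 2))) = envelope.
Proof. by apply/funext => X; rewrite /stat inordK. Qed.

Lemma nice_envelope : nice envelope.
Proof.
have n1 : nice (fun X => 1 + l1norm X).
  apply: niceD; first exact: nice_cst.
  by apply: nice_sum => j; apply: nice_norm; exact: nice_coord.
have n2 := niceM n1 (niceM n1 n1).
by have -> : envelope = (fun X => (1 + l1norm X) * ((1 + l1norm X) * (1 + l1norm X))).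
Qed.

Lemma nice_stat N j : nice (@stat N j).
Proof.
case: j => [k|[[j|[j k]]|[[|[|[|//]]] ?]]] /=.
- exact: nice_lcosh.
- by apply: niceM; [exact: nice_coord|exact: nice_sech2].
- by apply: niceM; [apply: niceM; exact: nice_coord|exact: nice_sech2].
- exact: nice_tanh.
- exact: nice_sech2.
- exact: nice_envelope.
Qed.

Definition good N (K : R) n (x : sample R n d) :=
  forall j, `|dev (@stat N j) (mix (@stat N j)) x| <= K / Num.sqrt n%:R.

Let field n (x : sample R n d) i := dotv th (obs x i).

(** Once the common quadratic term cancels, both sides are [beta]-Lipschitz in [u], and some grid
    point is within [2 / N] of [u]; this is paid twice, for the sample and for the population. *)
Lemma obj_uniform N (K : R) n (x : sample R n d) u : (0 < n)%N -> (0 < N)%N ->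
  good N K x -> `|u| <= 1 ->
  `|field_obj beta (field x) u - pop_obj beta m th u| <= 4 * beta / N%:R + K / Num.sqrt n%:R.
Proof.
move=> n0 N0 gx u1; have NR : 0 < N%:R :> R by rewrite ltr0n.
have [k ku] : exists k : 'I_N.+1, `|u - grid k| <= 2 / N%:R.
  have v0 : 0 <= (u + 1) / 2 * N%:R.
    by rewrite mulr_ge0// divr_ge0//; move: u1; rewrite ler_norml; lra.
  have /andP[tl tu] := truncn_itv v0.
  have kN : (Num.truncn ((u + 1) / 2 * N%:R) < N.+1)%N.
    rewrite ltnS -(ler_nat R) (le_trans tl)// ler_piMl//.
    by move: u1; rewrite ler_norml; lra.
  exists (Ordinal kN); rewrite /grid /=; move: (Num.truncn _) tl tu => t tl tu.
  have -> : u - (-1 + 2 * t%:R / N%:R) = 2 * (((u + 1) / 2 * N%:R) - t%:R) / N%:R.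
    by field; rewrite lt0r_neq0.
  move: tu; rewrite -addn1 natrD => tu.
  by rewrite ger0_norm ?divr_ge0 ?mulr_ge0 ?subr_ge0// ler_pM2r ?invr_gt0//; lra.
have lip v X : `|lcosh (beta * u + dotv th X) - lcosh (beta * grid k + dotv th X)| <= 2 * beta / N%:R.
  have := lcosh_lip (beta * grid k + dotv th X) (beta * (u - grid k)).
  have -> : beta * grid k + dotv th X + beta * (u - grid k) = beta * u + dotv th X by ring.
  move/le_trans; apply; rewrite normrM (gtr0_norm b0) (_ : 2 * beta / N%:R = beta * (2 / N%:R)); last by ring.
  by rewrite ler_pM2l.
have h1 : `|avg (fun i => lcosh (beta * u + field x i)) -
            avg (fun i => lcosh (beta * grid k + field x i))| <= 2 * beta / N%:R.
  by rewrite -[leRHS](avg_cst _ n0); apply: avg_close => i; exact: lip.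
have h2 : `|mix (fun X => lcosh (beta * u + dotv th X)) -
            mix (fun X => lcosh (beta * grid k + dotv th X))| <= 2 * beta / N%:R.
  rewrite -[leRHS](mix_cst m th); apply: (mix_close _ m0 mE) => [|||X]; [exact: nice_lcosh|exact: nice_lcosh|exact: nice_cst|exact: lip].
have := gx (inl k); rewrite /dev -/(avg (fun i => lcosh (beta * grid k + field x i))) /=.
rewrite field_objE /pop_obj.
rewrite (_ : beta * u ^+ 2 / 2 - avg (fun i => lcosh (beta * u + field x i)) - _ =
 mix (fun X => lcosh (beta * u + dotv th X)) - avg (fun i => lcosh (beta * u + field x i))); last by ring.
move: h1 h2; move: (avg _) (avg _) (mix _) (mix _) (K / _) => p q r s t; rewrite !ler_norml.
by rewrite (_ : 4 * beta / N%:R = 2 * beta / N%:R + 2 * beta / N%:R); [move: (2 * beta / _) => *; lra|field; rewrite lt0r_neq0].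
Qed.

Let g := gamma11 beta m th.
Let g0 : 0 < g. Proof. exact: (gamma11_gt0 th b1 m0 mE). Qed.

Definition minimizer n (a : 'I_n -> R) (U : R) :=
  `|U| <= 1 /\ forall u, `|u| <= 1 -> field_obj beta a U <= field_obj beta a u.

(** The order of quantifiers matters: [N] and [c] depend on the population only, and [K] merely
    affects how large [n] must be, because [K] is later chosen in terms of [N]. *)
Lemma right_good_localize : exists N, exists2 c, 0 < c & forall K, 0 <= K ->
  exists n1, forall n, (n1 <= n)%N -> forall (x : sample R n d) U,
    minimizer (field x) U -> good N K x ->
  [/\ (0 < n)%N /\ K / Num.sqrt n%:R <= 1, grad beta (field x) U = 0, g / 2 <= hess beta (field x) U /\ c <= hess beta (field x) U / 2,
    forall u, c * (u - U) ^+ 2 <= field_obj beta (field x) u - field_obj beta (field x) U &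
    `|U - m| <= 2 * beta / g * (K / Num.sqrt n%:R)].
Proof.
have b3 : 0 < 32 * beta ^+ 3 by rewrite mulr_gt0// exprn_gt0.
have b2 : 0 < beta ^+ 2 by rewrite exprn_gt0.
pose delta := Num.min ((1 - m) / 2) (g / (32 * beta ^+ 3)).
have d0 : 0 < delta by rewrite lt_min (divr_gt0 _ (ltr0n R 2)) ?subr_gt0 //= divr_gt0.
have d1 : 2 * delta <= 1 - m by rewrite mulrC -ler_pdivlMr// ge_min lexx.
have d2 : 32 * beta ^+ 3 * delta <= g by rewrite mulrC -ler_pdivlMr// ge_min lexx orbT.
have [eta e0 gap] := pop_gap b1 m0 mE th0 d0.
(* The grid error is made at most [eta / 8]; the sampling error takes the other half of the
   tolerance [eta / 4]. *)
pose N := (Num.truncn (32 * beta / eta)).+1.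
have N0 : 0 < N%:R :> R by rewrite ltr0n.
have gN : 4 * beta / N%:R <= eta / 8.
  have : 32 * beta / eta <= N%:R by exact/ltW/truncnS_gt.
  by rewrite !ler_pdivrMr//; move: (N%:R : R) => *; lra.
exists N, (Num.min (g / 8) (Num.min (eta / 16) (beta / 4))); first by rewrite !lt_min !divr_gt0.
move=> K K0; pose e := Num.min 1 (Num.min (eta / 8) (g / (4 * beta ^+ 2))).
have ep : 0 < e by rewrite !lt_min ltr01 !divr_gt0// mulr_gt0.
have [n1 hn1] := eventually_small K0 ep.
exists n1 => n /hn1[n0 Ke] x U [U1 Umin] gx.
move: Ke; rewrite !le_min => /and3P[Ke1 Ke2 Ke3].
have close u : `|u| <= 1 -> `|field_obj beta (field x) u - pop_obj beta m th u| <= eta / 4.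
  by move=> u1; have := obj_uniform n0 _ gx u1 => /(_ isT); move: gN Ke2; move: (_ / N%:R) (K / _) (`|_|) => *; lra.
have hclose : `|hess beta (field x) m - g| <= g / 4.
  have := gx (inr (inr (inord 1))); rewrite stat_sech2 /dev.
  rewrite -/(avg (fun i => sech2 (beta * m + field x i))) => h.
  rewrite /hess /g /gamma11 (_ : _ - _ = beta ^+ 2 * (mix (fun X => sech2 (beta * m + dotv th X)) -
    avg (fun i => sech2 (beta * m + field x i)))); last by ring.
  rewrite normrM (gtr0_norm b2) -/g distrC; move: h => /le_trans/(_ Ke3)/(ler_wpM2l (ltW b2)).
  rewrite (_ : beta ^+ 2 * (g / (4 * beta ^+ 2)) = g / 4); first by move/le_trans; apply.
  by field; rewrite lt0r_neq0.
have [h1 h2 h3 h4] := local_growth n0 b1 m0 g0 e0 d0 d1 d2 U1 Umin gap close hclose.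
split=> //; first by split=> //; apply: le_trans (_ : g / 4 <= _); [rewrite ge_min; apply/orP; left|]; move: g0 h3; lra.
have := argmin_close n0 b1 m0 g0 e0 d0 d1 d2 U1 Umin gap close hclose.
move/le_trans; apply; rewrite ler_wpM2l ?divr_ge0 ?mulr_ge0 ?(ltW g0) ?(ltW b0)//.
have := gx (inr (inr (inord 0))); rewrite stat_tanh /dev -/(avg (fun i => tanhR (beta * m + field x i))).
by rewrite (mix_tanh th mE).
Qed.

(** Expectation of [dotv h X * sech2], expanded in coordinates because the good event controls
    coordinate statistics only. *)
Definition S1mean h := \sum_j h 0 j * mix (fun X => X 0 j * sech2 (beta * m + dotv th X)).
Definition S2mean h := \sum_(p : 'I_d * 'I_d) h 0 p.1 * h 0 p.2 *
  mix (fun X => X 0 p.1 * X 0 p.2 * sech2 (beta * m + dotv th X)).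

Lemma qform_Ibeta h : qform h (Ibeta beta m th) =
  sqnorm h - S2mean h - (beta * S1mean h) ^+ 2 / g.
Proof.
have e1 : \sum_j h 0 j * gamma12 beta m th 0 j = - (beta * S1mean h).
  rewrite mulr_sumr -sumrN; apply: eq_bigr => j _; rewrite mxE.
  by move: (mix_expect _ _ _) => t; ring.
rewrite /qform /Ibeta mulmxBr mulmxBl mxE [X in _ + X]mxE; congr (_ - _).
  rewrite mxE (eq_bigr (fun k => h 0 k ^+ 2 - \sum_j h 0 j * h 0 k *
    mix (fun X => X 0 j * X 0 k * sech2 (beta * m + dotv th X)))); last first.
    move=> k _; rewrite !mxE mulr_suml.
    rewrite (eq_bigr (fun j => h 0 j * (j == k)%:R * h 0 k - h 0 j * h 0 k *
      mix (fun X => X 0 j * X 0 k * sech2 (beta * m + dotv th X)))); last first.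
      by move=> j _; rewrite mxE; move: (mix_expect _ _ _) => t; ring.
    rewrite sumrB (bigD1 k)//= eqxx mulr1 big1 ?addr0// => j /negPf jk.
    by rewrite jk mulr0 mul0r.
  rewrite sumrB; congr (_ - _); rewrite exchange_big /S2mean pair_bigA.
  exact: eq_bigr.
rewrite -scalemxAr -scalemxAl mxE (mulmxA h) -(mulmxA (h *m _)) mxE big_ord1.
have -> : (h *m (gamma12 beta m th)^T) 0 0 = - (beta * S1mean h).
  by rewrite -e1 mxE; apply: eq_bigr => j _; rewrite mxE.
have -> : (gamma12 beta m th *m h^T) 0 0 = - (beta * S1mean h).
  by rewrite -e1 [LHS]mxE; apply: eq_bigr => j _; rewrite [h^T _ _]mxE; exact: mulrC.
by rewrite mulrC mulrNN.
Qed.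

Lemma envelope_bounds h X : [/\ `|dotv h X| <= (1 + l1norm h) ^+ 3 * envelope X,
  dotv h X ^+ 2 <= (1 + l1norm h) ^+ 3 * envelope X &
  `|dotv h X| ^+ 3 <= (1 + l1norm h) ^+ 3 * envelope X].
Proof.
have H := dotv_norm_le h X; have p0 := l1norm_ge0 h; have q0 := l1norm_ge0 X.
have t0 : 0 <= `|dotv h X| by [].
rewrite -(real_normK (num_real (dotv h X))) /envelope -exprMn.
have : `|dotv h X| <= (1 + l1norm h) * (1 + l1norm X) by move: H p0 q0; nra.
have : 1 <= (1 + l1norm h) * (1 + l1norm X) by move: p0 q0; nra.
move: (_ * _) (`|_|) t0 => y t t0 y1 ty; have y0 : 0 <= y by lra.
have h2 : t ^+ 2 <= y ^+ 2 by rewrite lerXn2r ?nnegrE.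
have h3 : y ^+ 2 <= y ^+ 3 by rewrite (exprS y 2) ler_peMl ?sqr_ge0.
by split; [move: h2 h3; rewrite !expr2; nra|exact: le_trans h3|rewrite lerXn2r ?nnegrE].
Qed.

(** Averages at [U] are replaced by averages at [m], at a cost proportional to [|U - m|], and then
    by expectations, at cost [K / sqrt n]. The bound [B] on the posterior mean precedes [h], since
    it does not involve the shift. *)
Lemma deterministic_expansion : exists N, forall K, 0 <= K -> exists B, forall h, exists C n1,
  forall n, (n1 <= n)%N -> forall (x : sample R n d) U, minimizer (field x) U -> good N K x ->
  (forall j, `|\sum_(i < n) obs x i 0 j *
      (post_tanh beta (field x) i - tanhR (beta * U + field x i))| <= B) /\
  `|ln (L (field_wt beta (fun i => field x i + dotv h (obs x i) / Num.sqrt n%:R)) /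
        L (field_wt beta (field x))) -
    (Num.sqrt n%:R * avg (fun i => dotv h (obs x i) * tanhR (beta * U + field x i)) +
     (sqnorm h - qform h (Ibeta beta m th)) / 2)| <= C / Num.sqrt n%:R.
Proof.
have [N [c c0 loc]] := right_good_localize; exists N => K K0.
have [n2 {}loc] := loc _ K0.
(* On the good event the average of [envelope] exceeds its expectation by at most
   [K / sqrt n <= 1]. *)
pose Mq := mix envelope + 1.
exists ((2 * beta ^+ 4 / (g / 2) + 2 * beta ^+ 2) *
  (4 / c * Num.sqrt (beta / (2 * c))) * Mq) => h.
pose M := (1 + l1norm h) ^+ 3 * Mq.
pose l2 := \sum_(p : 'I_d * 'I_d) `|h 0 p.1 * h 0 p.2|.
(* [C0 / sqrt n] bounds [|U - m|], and [T / sqrt n] is the relative Laplace error. [BB] bounds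
   [beta * k1] and its limit, and [CC] collects the cost of replacing sample quantities at [U] by
   their limits. *)
pose C0 := 2 * beta / g * K; pose T := tilt_const beta c M * Num.sqrt (beta / c).
pose BB := beta * M + `|beta * S1mean h|.
pose CC := (2 * beta * C0 * M + l2 * K) / 2 +
  (BB / (g / 2) * (beta * (2 * beta * C0 * M + l1norm h * K)) +
   BB ^+ 2 / (2 * (g / 2) ^+ 2) * (beta ^+ 2 * (2 * beta * C0 + K))).
have [n3 hn3] : exists n3, forall n, (n3 <= n)%N -> (0 < n)%N /\ `|T| / Num.sqrt n%:R <= 2^-1.
  exact: eventually_small.
exists (4 * T + 2 * M + CC), (maxn n2 n3) => n; rewrite geq_max => /andP[/loc{}loc /hn3[n0 Tn]] x U mU gx.
have [[_ e1] gU [hU cU] growth near] := loc x U mU gx.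
pose e := (Num.sqrt n%:R)^-1 : R; have e0 : 0 <= e by rewrite invr_ge0 sqrtr_ge0.
have {}near : `|U - m| <= C0 * e by apply: le_trans near _; rewrite /C0 /e mulrA.
have envq : avg (fun i => envelope (obs x i)) <= Mq.
  have := gx (inr (inr (inord 2))); rewrite stat_envelope /dev -/(avg (fun i => envelope (obs x i))).
  by move=> /le_trans/(_ e1); rewrite /Mq ler_norml; move: (avg _) (mix _) => *; lra.
have env0 X : 0 <= envelope X by rewrite exprn_ge0// addr_ge0// l1norm_ge0.
have Hh0 : 0 <= (1 + l1norm h) ^+ 3 by rewrite exprn_ge0// addr_ge0// l1norm_ge0.
have bnd (f : 'I_n -> R) : (forall i, f i <= (1 + l1norm h) ^+ 3 * envelope (obs x i)) -> avg f <= M.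
  move=> fe; apply: le_trans (avg_le fe) _; rewrite avgZ.
  by apply: ler_wpM2l.
have B1 : avg (fun i => `|dotv h (obs x i)|) <= M.
  by apply: bnd => i; have [] := envelope_bounds h (obs x i).
have B2 : avg (fun i => dotv h (obs x i) ^+ 2) <= M.
  by apply: bnd => i; have [] := envelope_bounds h (obs x i).
have B3 : avg (fun i => `|dotv h (obs x i)| ^+ 3) <= M.
  by apply: bnd => i; have [] := envelope_bounds h (obs x i).
have g20 : 0 < g / 2 by rewrite divr_gt0.
split=> [j|].
  have := post_mean_close n0 b0 gU c0 g20 hU growth (fun i => obs x i 0 j).
  move/le_trans; apply; rewrite ler_wpM2l//.
    by rewrite mulr_ge0 ?addr_ge0 ?divr_ge0 ?mulr_ge0 ?exprn_ge0 ?sqrtr_ge0 ?invr_ge0 ?mulr_ge0 ?(ltW b0) ?(ltW c0) ?(ltW g20) ?(ltW g0)//.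
  apply: le_trans envq; apply: avg_le => i; rewrite /envelope.
  have p0 := l1norm_ge0 (obs x i).
  have : `|obs x i 0 j| <= l1norm (obs x i) by rewrite /l1norm (bigD1 j)//= lerDl sumr_ge0.
  by move: (`|_|) (l1norm _) p0 => t y y0 ty; rewrite exprS expr2; nra.
have small : T / Num.sqrt n%:R <= 2^-1.
  by apply: le_trans Tn; rewrite ler_wpM2r// ler_norm.
have main := log_laplace_ratio n0 b0 gU c0 cU growth B1 B2 B3 small.
set k1 := avg (fun i => dotv h (obs x i) * sech2 (beta * U + field x i)) in main.
set A2 := avg (fun i => dotv h (obs x i) ^+ 2 * sech2 (beta * U + field x i)) in main.
have C0e : 0 <= 2 * beta * (C0 * e).
  by apply: mulr_ge0; [rewrite mulr_ge0 ?(ltW b0)|exact: le_trans near].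
have lipU i : `|sech2 (beta * U + field x i) - sech2 (beta * m + field x i)| <= 2 * beta * (C0 * e).
  have := sech2_lip (beta * m + field x i) (beta * (U - m)).
  rewrite (_ : beta * m + field x i + beta * (U - m) = beta * U + field x i); last by ring.
  move/le_trans; apply; rewrite normrM (gtr0_norm b0) (mulrA 2 beta) ler_wpM2l//.
  by rewrite mulr_ge0 ?(ltW b0).
have avg_lip (f : 'I_n -> R) : avg (fun i => `|f i|) <= M ->
    `|avg (fun i => f i * sech2 (beta * U + field x i)) -
      avg (fun i => f i * sech2 (beta * m + field x i))| <= 2 * beta * (C0 * e) * M.
  move=> fM; apply: le_trans (ler_wpM2l C0e fM); rewrite -avgZ; apply: avg_close => i.
  by rewrite -mulrBr normrM mulrC ler_wpM2r.
have KE : K / Num.sqrt n%:R = K * e by [].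
have dk : `|k1 - S1mean h| <= (2 * beta * C0 * M + l1norm h * K) * e.
  have h1 := avg_lip _ B1.
  have h2 : `|avg (fun i => dotv h (obs x i) * sech2 (beta * m + field x i)) - S1mean h| <= l1norm h * (K * e).
    have -> : (fun i => dotv h (obs x i) * sech2 (beta * m + field x i)) =
       (fun i => \sum_j h 0 j * (obs x i 0 j * sech2 (beta * m + field x i))).
      by apply/funext => i; rewrite mulr_suml; apply: eq_bigr => j _; rewrite mulrA.
    rewrite avg_sum; apply: sumr_close => j; rewrite -KE; exact: (gx (inr (inl (inl j)))).
  have := ler_distD (avg (fun i => dotv h (obs x i) * sech2 (beta * m + field x i))) k1 (S1mean h).
  move/le_trans; apply; apply: le_trans (lerD h1 h2) _.
  by rewrite le_eqVlt; apply/orP; left; apply/eqP; ring.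
have dA : `|A2 - S2mean h| <= (2 * beta * C0 * M + l2 * K) * e.
  have h1 : `|A2 - avg (fun i => dotv h (obs x i) ^+ 2 * sech2 (beta * m + field x i))| <= 2 * beta * (C0 * e) * M.
    apply: avg_lip; apply: le_trans B2; apply: avg_le => i.
    by rewrite ger0_norm ?sqr_ge0.
  have h2 : `|avg (fun i => dotv h (obs x i) ^+ 2 * sech2 (beta * m + field x i)) - S2mean h| <= l2 * (K * e).
    have -> : (fun i => dotv h (obs x i) ^+ 2 * sech2 (beta * m + field x i)) =
       (fun i => \sum_(p : 'I_d * 'I_d) h 0 p.1 * h 0 p.2 *
           (obs x i 0 p.1 * obs x i 0 p.2 * sech2 (beta * m + field x i))).
      apply/funext => i; rewrite expr2 /dotv big_distrlr pair_bigA mulr_suml; apply: eq_bigr => p _ /=.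
      by rewrite [RHS]mulrA; congr (_ * _); rewrite mulrACA.
    rewrite avg_sum; apply: sumr_close => p; rewrite -KE; exact: (gx (inr (inl (inr p)))).
  have := ler_distD (avg (fun i => dotv h (obs x i) ^+ 2 * sech2 (beta * m + field x i))) A2 (S2mean h).
  move/le_trans; apply; apply: le_trans (lerD h1 h2) _.
  by rewrite le_eqVlt; apply/orP; left; apply/eqP; ring.
have dh : `|hess beta (field x) U - g| <= beta ^+ 2 * (2 * beta * C0 + K) * e.
  have b2 : 0 <= beta ^+ 2 by exact: sqr_ge0.
  have h2 := gx (inr (inr (inord 1))); rewrite stat_sech2 in h2.
  have h1 : `|avg (fun i => sech2 (beta * U + field x i)) - avg (fun i => sech2 (beta * m + field x i))| <= 2 * beta * (C0 * e).
    by rewrite -[leRHS](avg_cst _ n0); apply: avg_close => i; exact: lipU.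
  rewrite /hess /g /gamma11 (_ : _ - _ = - (beta ^+ 2 * (avg (fun i => sech2 (beta * U + field x i)) -
     mix (fun X => sech2 (beta * m + dotv th X))))); last by ring.
  rewrite normrN normrM (ger0_norm b2) -mulrA ler_wpM2l//.
  have := ler_distD (avg (fun i => sech2 (beta * m + field x i))) (avg (fun i => sech2 (beta * U + field x i)))
    (mix (fun X => sech2 (beta * m + dotv th X))).
  move/le_trans; apply; apply: le_trans (lerD h1 h2) _.
  by rewrite KE le_eqVlt; apply/orP; left; apply/eqP; ring.
have k1M : `|beta * k1| <= BB.
  rewrite normrM (gtr0_norm b0) /BB ler_wpDr// ler_wpM2l ?(ltW b0)//.
  apply: le_trans B1; apply: le_trans (avg_norm _) _; apply: avg_le => i.
  by rewrite normrM ler_piMr// ger0_norm ?sech2_le1//; exact/ltW/sech2_gt0.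
have M0 : 0 <= M by apply: le_trans B1; exact: avg_ge0.
have ksM : `|beta * S1mean h| <= BB by rewrite /BB ler_wpDl// mulr_ge0// ltW.
have BB0 : 0 <= BB by exact: le_trans k1M.
have gg : g / 2 <= g by rewrite ler_pdivrMr//; move: g0; lra.
have dq := ratio_close g20 hU gg k1M ksM.
have dk' : `|beta * k1 - beta * S1mean h| <= beta * (2 * beta * C0 * M + l1norm h * K) * e.
  by rewrite -mulrBr normrM (gtr0_norm b0) -mulrA ler_wpM2l// ltW.
have dq2 : `|(beta * k1) ^+ 2 / (2 * hess beta (field x) U) - (beta * S1mean h) ^+ 2 / (2 * g)| <=
   (BB / (g / 2) * (beta * (2 * beta * C0 * M + l1norm h * K)) +
   BB ^+ 2 / (2 * (g / 2) ^+ 2) * (beta ^+ 2 * (2 * beta * C0 + K))) * e.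
  have a1 : 0 <= BB / (g / 2) by rewrite divr_ge0 ?(ltW g20).
  have a2 : 0 <= BB ^+ 2 / (2 * (g / 2) ^+ 2) by rewrite divr_ge0 ?sqr_ge0// mulr_ge0// sqr_ge0.
  apply: le_trans dq _; apply: le_trans (lerD (ler_wpM2l a1 dk') (ler_wpM2l a2 dh)) _.
  move: (BB / _) (BB ^+ 2 / _) (2 * beta * C0 * M + _) (2 * beta * C0 + _) => p q r s.
  by rewrite le_eqVlt; apply/orP; left; apply/eqP; ring.
have -> : (sqnorm h - qform h (Ibeta beta m th)) / 2 = S2mean h / 2 + (beta * S1mean h) ^+ 2 / (2 * g).
  by rewrite qform_Ibeta; field; rewrite lt0r_neq0.
have dA2 : `|A2 / 2 - S2mean h / 2| <= (2 * beta * C0 * M + l2 * K) / 2 * e.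
  rewrite -mulrBl normrM (@ger0_norm _ 2^-1)// mulrAC ler_wpM2r//.
set l0 := ln _ in main *; set w := Num.sqrt _ * avg _ in main *.
have -> : (4 * T + 2 * M + CC) / Num.sqrt n%:R = 4 * (T / Num.sqrt n%:R) + 2 * M / Num.sqrt n%:R + CC * e.
  by rewrite /e; ring.
move: main dq2 dA2; rewrite -/T /CC.
move: ((beta * k1) ^+ 2 / _) ((beta * S1mean h) ^+ 2 / _) (A2 / 2) (S2mean h / 2) (4 * (T / _) + _) => p q r s t.
set z1 := (_ + _ * _) / 2; set z2 := _ + _ * (_ ^+ 2 * _).
by rewrite (mulrDl z1 z2) => h1 h2 h3; exact: (chain_norm_le h1 h2 h3).
Qed.

End RightGood.

(** * Likelihood ratios and reflection *)

Section Density.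
Variables (R : realType) (n d : nat) (beta : R).
Hypotheses (n0 : (0 < n)%N) (b0 : 0 < beta).
Implicit Types (th h : 'rV[R]_d) (x : sample R n d) (z w : {ffun 'I_n -> bool}) (U : R).
Let nR : 0 < n%:R :> R. Proof. by rewrite ltr0n. Qed.

Definition field th x (i : 'I_n) := dotv th (obs x i).

Lemma pdf_spin th v b : std_gauss_pdf (v - spin R b *: th) =
  std_gauss_pdf v * expR (spin R b * dotv th v - sqnorm th / 2).
Proof.
have := std_gauss_pdf_tilt (spin R b *: th) v 0.
rewrite subr0 add0r dotvZl dotvZl => e.
have d0 : dotv th (0 : 'rV[R]_d) = 0 by exact: dotvr0.
have s1 : spin R b ^+ 2 = 1 by case: b {e}; rewrite /= ?sqrrN expr1n.
move: e; rewrite d0 mulr0 add0r sqnormZ s1 mul1r => e.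
rewrite expRD expRN mulrA [std_gauss_pdf v * _]mulrC e mulrC mulrA mulVf ?mul1r//.
exact/lt0r_neq0/expR_gt0.
Qed.

Let Z := \sum_(w : {ffun 'I_n -> bool}) cw_weight beta w.

Lemma cw_weight_sum_gt0 : 0 < Z.
Proof.
rewrite /Z (bigD1 [ffun=> true])//= ltr_wpDr ?expR_gt0//.
by apply: sumr_ge0 => w _; exact: expR_ge0.
Qed.

Lemma cw_prior_ge0 z : 0 <= cw_prior beta z.
Proof. by rewrite divr_ge0 ?expR_ge0// ltW// cw_weight_sum_gt0. Qed.

Lemma cw_prior_sum : \sum_(z : {ffun 'I_n -> bool}) cw_prior beta z = 1.
Proof. by rewrite -mulr_suml divff// lt0r_neq0// cw_weight_sum_gt0. Qed.

Let Q := Num.sqrt (2 * pi / (n%:R * beta)) : R.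
Let Q0 : 0 < Q. Proof. by rewrite sqrtr_gt0 divr_gt0 ?mulr_gt0// pi_gt0. Qed.

Lemma L_field_gt0 (a : 'I_n -> R) : 0 < L (field_wt beta a).
Proof.
have p2 : 0 < 2 ^+ n :> R by rewrite exprn_gt0.
rewrite -(pmulr_rgt0 _ p2) -hs_partition// mulr_gt0//.
rewrite (bigD1 [ffun=> true])//= ltr_wpDr ?expR_gt0//.
by apply: sumr_ge0 => w _; exact: expR_ge0.
Qed.

(** The factors of the density that do not depend on [th], which cancel in likelihood ratios. *)
Definition base_density x := Z^-1 * (\prod_(i < n) std_gauss_pdf (obs x i)) * (2 ^+ n / Q).

Lemma base_density_gt0 x : 0 < base_density x.
Proof.
rewrite !mulr_gt0 ?invr_gt0 ?cw_weight_sum_gt0 ?exprn_gt0//.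
by apply: prodr_gt0 => i _; exact: std_gauss_pdf_gt0.
Qed.

Lemma cw_densityE th x : cw_density beta th x =
  base_density x * (expR (- (n%:R * sqnorm th / 2)) * L (field_wt beta (field th x))).
Proof.
have -> : base_density x * (expR (- (n%:R * sqnorm th / 2)) * L (field_wt beta (field th x))) =
  Z^-1 * (\prod_(i < n) std_gauss_pdf (obs x i)) * expR (- (n%:R * sqnorm th / 2)) *
  \sum_(w : {ffun 'I_n -> bool}) cw_wt beta (field th x) w.
  rewrite /base_density; have := hs_partition (field th x) n0 b0; rewrite -/Q => e.
  have -> : \sum_(w : {ffun 'I_n -> bool}) cw_wt beta (field th x) w = 2 ^+ n * L (field_wt beta (field th x)) / Q.
    by rewrite -e mulrAC divff ?mul1r// lt0r_neq0.
  move: (L _) (expR _) Z^-1 (\prod_(_ < _) _) (2 ^+ n) Q^-1 => p q r s t u; ring.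
rewrite /cw_density mulr_sumr; apply: eq_bigr => z _.
under [X in _ * X]eq_bigr do rewrite pdf_spin.
rewrite big_split/= -expR_sum sumrB sumr_const card_ord.
rewrite -[sqnorm th / 2 *+ n]mulr_natl /cw_prior -/Z /cw_weight /cw_wt expRD.
rewrite expRD (mulrA n%:R (sqnorm th)) /field.
move: (expR _) (expR _) (expR _) Z^-1 (\prod_(_ < _) _) => p q r s t; ring.
Qed.

Lemma cw_density_gt0 th x : 0 < cw_density beta th x.
Proof.
rewrite cw_densityE; apply: mulr_gt0; first exact: base_density_gt0.
by apply: mulr_gt0; [exact: expR_gt0|exact: L_field_gt0].
Qed.

Let rt := Num.sqrt n%:R : R.
Let rt0 : 0 < rt. Proof. by rewrite sqrtr_gt0. Qed.
Let rt2 : rt ^+ 2 = n%:R. Proof. by rewrite sqr_sqrtr// ltW. Qed.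

Lemma log_lrE th h x : log_lr beta (th + rt^-1 *: h) th x =
  ln (L (field_wt beta (fun i => field th x i + dotv h (obs x i) / rt)) /
      L (field_wt beta (field th x))) - (rt * dotv h th + sqnorm h / 2).
Proof.
rewrite /log_lr !cw_densityE.
have -> : field (th + rt^-1 *: h) x = (fun i => field th x i + dotv h (obs x i) / rt).
  by apply/funext => i; rewrite /field dotvDl dotvZl mulrC [_ / rt]mulrC.
have -> : sqnorm (th + rt^-1 *: h) = sqnorm th + 2 * (dotv h th / rt) + sqnorm h / n%:R.
  rewrite sqnormD sqnormZ dotvZr (dotvC th) exprVn rt2; ring.
have l1 := L_field_gt0 (fun i => field th x i + dotv h (obs x i) / rt).
have l0 := L_field_gt0 (field th x).
have kx := base_density_gt0 x; move: (L _) (L _) (base_density x) l1 l0 kx => q p k p0 q0 k0.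
have -> : - (n%:R * (sqnorm th + 2 * (dotv h th / rt) + sqnorm h / n%:R) / 2) =
  - (n%:R * sqnorm th / 2) + - (rt * dotv h th + sqnorm h / 2).
  by rewrite -rt2; field; rewrite lt0r_neq0.
rewrite expRD.
have -> : k * (expR (- (n%:R * sqnorm th / 2)) * expR (- (rt * dotv h th + sqnorm h / 2)) * p) /
   (k * (expR (- (n%:R * sqnorm th / 2)) * q)) = p / q * expR (- (rt * dotv h th + sqnorm h / 2)).
  have := lt0r_neq0 (expR_gt0 (- (n%:R * sqnorm th / 2))).
  move: (expR _) (expR _) => r s r0; field.
  by rewrite (lt0r_neq0 q0) (lt0r_neq0 k0) r0.
by rewrite lnM ?posrE ?divr_gt0 ?expR_gt0// expRK.
Qed.

Lemma post_meanE th x i : post_mean beta th x i = post_tanh beta (field th x) i.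
Proof.
have e1 := hs_partition (field th x) n0 b0; have e2 := hs_spin (field th x) n0 b0 i.
rewrite -/Q in e1 e2; have p2 : 2 ^+ n != 0 :> R by rewrite expf_neq0.
rewrite /post_mean /post_tanh.
have -> : \sum_(w : {ffun 'I_n -> bool}) spin R (w i) * post_weight beta th x w =
  2 ^+ n * L (fun u => tanhR (beta * u + field th x i) * field_wt beta (field th x) u) / Q.
  by rewrite -e2 mulrAC divff ?mul1r// lt0r_neq0.
have -> : \sum_(w : {ffun 'I_n -> bool}) post_weight beta th x w = 2 ^+ n * L (field_wt beta (field th x)) / Q.
  by rewrite -e1 mulrAC divff ?mul1r// lt0r_neq0.
have := lt0r_neq0 (L_field_gt0 (field th x)); have := lt0r_neq0 Q0.
by move: (L _) (L _) Q (2 ^+ n) p2 => p q r s s0 r0 q0; field; rewrite q0 r0.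
Qed.

End Density.

Section Reflection.
Variables (R : realType) (n d : nat) (beta : R).
Implicit Types (th h : 'rV[R]_d) (x : sample R n d) (z w : {ffun 'I_n -> bool}) (U : R).

Lemma flipzK : involutive (@flipz n).
Proof. by move=> z; apply/ffunP => i; rewrite !ffunE negbK. Qed.

Lemma field_opps th x : field th (opps x) = (fun i => - field th x i).
Proof. by apply/funext => i; rewrite /field obs_opps dotvNr. Qed.

Lemma field_objN (a : 'I_n -> R) u : field_obj beta (fun i => - a i) (- u) = field_obj beta a u.
Proof.
rewrite /field_obj sqrrN; congr (_ - _ * _); apply: eq_bigr => i _.
by rewrite /lcosh -coshRN; congr (ln (coshR _)); ring.
Qed.

Lemma minimizer_opps th x U : minimizer beta (field th x) U ->
  minimizer beta (field th (opps x)) (- U).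
Proof.
move=> [U1 Umin]; split; first by rewrite normrN.
move=> u u1; rewrite field_opps field_objN -[u in leRHS]opprK field_objN.
by apply: Umin; rewrite normrN.
Qed.

Lemma cw_weight_flipz z : cw_weight beta (flipz z) = cw_weight beta z :> R.
Proof. by rewrite /cw_weight spin_mean_flipz sqrrN. Qed.

Lemma cw_density_opps th x : cw_density beta th (opps x) = cw_density beta th x.
Proof.
rewrite /cw_density (reindex_inj (inv_inj flipzK)); apply: eq_bigr => z _.
have := zpdf_flipz th (flipz z) x; rewrite flipzK => e.
by rewrite -[X in _ * X]/(zpdf th (flipz z) (opps x)) -e /cw_prior cw_weight_flipz.
Qed.

Lemma post_mean_opps th x i : post_mean beta th (opps x) i = - post_mean beta th x i.
Proof.
have e w : post_weight beta th (opps x) (flipz w) = post_weight beta th x w.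
  rewrite /post_weight spin_mean_flipz sqrrN; congr (expR (_ + _)).
  by apply: eq_bigr => k _; rewrite ffunE spin_neg obs_opps dotvNr mulrNN.
rewrite /post_mean (reindex_inj (inv_inj flipzK)) [X in _ / X](reindex_inj (inv_inj flipzK)).
under eq_bigr do rewrite e ffunE spin_neg mulNr.
by under [X in _ / X]eq_bigr do rewrite e; rewrite sumrN mulNr.
Qed.

Lemma tanh_score_opps th x U : tanh_score beta th (opps x) (- U) = tanh_score beta th x U.
Proof.
apply: eq_bigr => i _; rewrite obs_opps dotvNr scalerN -scaleNr -tanhRN; congr (tanhR _ *: _).
by ring.
Qed.

End Reflection.

Section Expansion.
Variables (R : realType) (d : nat) (beta m : R) (th : 'rV[R]_d).
Hypotheses (b1 : 1 < beta) (m0 : 0 < m) (mE : m = tanhR (beta * m)).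
Hypothesis th0 : 0 < sqnorm th.
Let b0 : 0 < beta. Proof. exact: lt_trans b1. Qed.
Implicit Types h : 'rV[R]_d.

Definition good_up_to_sign N K n (x : sample R n d) :=
  good beta m th N K x \/ good beta m th N K (opps x).

Let mean_error n (x : sample R n d) U : 'rV[R]_d :=
  \sum_(i < n) post_mean beta th x i *: obs x i - tanh_score beta th x U.
Let lan_error h n (x : sample R n d) U : R :=
  log_lr beta (th + (Num.sqrt n%:R)^-1 *: h) th x
  - (dotv h (Delta_tilde beta th x U) - 2^-1 * qform h (Ibeta beta m th)).

(** Density, score and mean error are unchanged when [x] and [U] both change sign, so being good up
    to sign is enough. *)
Lemma expansion : exists N, forall K, 0 <= K -> exists B, forall h, exists C n1,
  forall n, (n1 <= n)%N -> (0 < n)%N /\ forall (x : sample R n d) U, minimizer beta (field th x) U ->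
    good_up_to_sign N K x ->
    (forall j, `|mean_error x U 0 j| <= B) /\ `|lan_error h x U| <= C / Num.sqrt n%:R.
Proof.
have [N det] := deterministic_expansion b1 m0 mE th0; exists N => K K0.
have [B {}det] := det _ K0; exists B => h; have [C [n1 {}det]] := det h.
(* The successor guarantees [0 < n]. *)
exists C, n1.+1 => n nn; have n0 : (0 < n)%N by exact: leq_trans nn.
split=> // x U mU.
have right (y : sample R n d) V : minimizer beta (field th y) V -> good beta m th N K y ->
    (forall j, `|mean_error y V 0 j| <= B) /\ `|lan_error h y V| <= C / Num.sqrt n%:R.
  move=> mV gy; have [h1 h2] := det n (ltnW nn) y V mV gy; split=> [j|].
    apply: le_trans (h1 j); rewrite le_eqVlt; apply/orP; left; apply/eqP; congr `|_|.
    rewrite /mean_error /tanh_score -sumrB summxE; apply: eq_bigr => i _.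
    by rewrite (post_meanE n0 b0) -scalerBl mxE mulrC.
  apply: le_trans h2; rewrite le_eqVlt; apply/orP; left; apply/eqP; congr `|_|.
  rewrite /lan_error (log_lrE n0 b0).
  have -> : dotv h (Delta_tilde beta th y V) = Num.sqrt n%:R *
      avg (fun i => dotv h (obs y i) * tanhR (beta * V + dotv th (obs y i))) - Num.sqrt n%:R * dotv h th.
    rewrite /Delta_tilde dotvZr dotvDr dotvNr dotvZr dotv_sumr mulrBr; congr (_ * (_ * _) - _).
    by apply: eq_bigr => i _; rewrite dotvZr mulrC.
  rewrite -[X in ln X]/(L (field_wt beta (fun i => field th y i + dotv h (obs y i) / Num.sqrt n%:R)) /
      L (field_wt beta (field th y))).
  move: (ln _) (Num.sqrt _ * avg _) (Num.sqrt _ * dotv h th) (qform _ _) (sqnorm h) => p q r s t.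
  by field.
move=> [|gx]; first exact: right.
have [h1 h2] := right _ _ (minimizer_opps mU) gx; split=> [j|].
  apply: le_trans (h1 j); rewrite le_eqVlt; apply/orP; left; apply/eqP; congr `|_ 0 j|.
  rewrite /mean_error tanh_score_opps.
  have -> : \sum_(i < n) post_mean beta th (opps x) i *: obs (opps x) i =
     \sum_(i < n) post_mean beta th x i *: obs x i; last by [].
  by apply: eq_bigr => i _; rewrite post_mean_opps obs_opps scalerN scaleNr opprK.
by move: h2; rewrite /lan_error /log_lr !cw_density_opps /Delta_tilde tanh_score_opps.
Qed.

End Expansion.

(** * The exceptional event *)

Section Probability.
Variables (R : realType) (n d : nat) (beta : R).
Implicit Types (th h : 'rV[R]_d) (x : sample R n d) (z w : {ffun 'I_n -> bool}).

Lemma cw_density_zpdf th x : cw_density beta th x = \sum_(z : {ffun 'I_n -> bool}) cw_prior beta z * zpdf th z x.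
Proof. by []. Qed.

Let dens_term th z : cmeas (fun x => cw_prior beta z * zpdf th z x) /\
  fint (fun x => cw_prior beta z * zpdf th z x).
Proof.
split; first by apply: cmeasM; [exact: cmeas_cst|exact: cmeas_zpdf].
by apply: fintZ; [exact: cmeas_zpdf|exact: fint_zpdf].
Qed.

Lemma cmeas_cw_density th : cmeas (@cw_density R n d beta th).
Proof. by apply: cmeas_sum => z; have [] := dens_term th z. Qed.

Lemma fint_cw_density th : fint (@cw_density R n d beta th).
Proof. by apply: fint_sum => z; have [] := dens_term th z. Qed.

Lemma intF_real_cw_density th : intF_real (@cw_density R n d beta th) = 1.
Proof.
rewrite intF_real_sum => [|z|z]; [|by have [] := dens_term th z|by have [] := dens_term th z].
rewrite -[RHS](cw_prior_sum n beta); apply: eq_bigr => z _.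
by rewrite intF_realZ ?intF_real_zpdf ?mulr1//; [exact: cmeas_zpdf|exact: fint_zpdf].
Qed.

Lemma cw_density_ge0 th x : 0 <= cw_density beta th x.
Proof.
by apply: sumr_ge0 => z _; rewrite mulr_ge0 ?cw_prior_ge0//; exact: zpdf_ge0.
Qed.

(** The event may be non-measurable, as it is allowed to depend on the minimisers; only the
    dominating function is later integrated term by term. *)
Lemma cw_prob_le th (A : sample R n d -> Prop) (G : sample R n d -> R) :
  (forall x, 0 <= G x) -> (forall x, A x -> cw_density beta th x <= G x) -> fint G ->
  0 <= cw_prob beta th A <= intF_real G.
Proof.
move=> G0 AG iG; pose F x := (if `[< A x >] then 1 else 0) * cw_density beta th x.
have F0 x : 0 <= F x by rewrite /F mulr_ge0 ?cw_density_ge0//; case: ifP.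
have FG x : F x <= G x.
  by rewrite /F; case: asboolP => Ax; rewrite ?mul1r ?mul0r//; exact: AG.
apply/andP; split; first by apply: fine_ge0; apply: intF_ge0 => x; rewrite lee_fin; exact: F0.
rewrite /cw_prob -[leLHS](intF_real_ge0 F0); apply: intF_real_le => //.
by apply: fint_le iG => x; rewrite !ger0_norm.
Qed.

End Probability.

Section BadEvent.
Variables (R : realType) (d : nat) (beta m : R) (th : 'rV[R]_d).
Hypotheses (b1 : 1 < beta) (m0 : 0 < m) (mE : m = tanhR (beta * m)).
Implicit Types (h : 'rV[R]_d).

(** Chebyshev's inequality kept inside the integral: at a bad sample, every [z] has a statistic [j]
    with [n * dev ^ 2 / K ^ 2 > 1], so this sum dominates the density. The sign is read off the
    labels [z], hence never has to be guessed from [x]. *)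
Definition bad_weight N K n (x : sample R n d) := \sum_(z : {ffun 'I_n -> bool})
  cw_prior beta z * (n%:R / K ^+ 2) * \sum_j
   (dev (stat beta m th (N := N) j) (mix_expect m th (stat beta m th (N := N) j)) (signed z x) ^+ 2 * zpdf th z x).

Lemma bad_weight_ge0 N K n (x : sample R n d) : 0 <= bad_weight N K x.
Proof.
apply: sumr_ge0 => z _; apply: mulr_ge0.
  by apply: mulr_ge0; [exact: cw_prior_ge0|rewrite divr_ge0 ?sqr_ge0].
by apply: sumr_ge0 => j _; apply: mulr_ge0; [exact: sqr_ge0|exact: zpdf_ge0].
Qed.

Lemma cw_density_le_bad_weight N K n (x : sample R n d) : (0 < n)%N -> 0 < K ->
  ~ good_up_to_sign beta m th N K x -> cw_density beta th x <= bad_weight N K x.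
Proof.
move=> n0 K0 bad; have nR : 0 < n%:R :> R by rewrite ltr0n.
apply: ler_sum => z _; rewrite -mulrA ler_wpM2l ?cw_prior_ge0//.
have ng : ~ good beta m th N K (signed z x).
  by rewrite /signed; case: ifP => _ gx; apply: bad; [left|right].
have [j nj] : exists j, ~ `|dev (stat beta m th (N := N) j) (mix_expect m th (stat beta m th (N := N) j)) (signed z x)| <= K / Num.sqrt n%:R.
  by apply/existsNP.
rewrite -mulr_suml mulrA ler_peMl ?zpdf_ge0// (bigD1 j)//= mulrDr ler_wpDr//.
  rewrite mulr_ge0 ?divr_ge0 ?sqr_ge0//; apply: sumr_ge0 => k _; exact: sqr_ge0.
move/negP: nj; rewrite -ltNge; move: (dev _ _ _) => t Kt.
rewrite -[leLHS](_ : n%:R / K ^+ 2 * (K / Num.sqrt n%:R) ^+ 2 = 1); last first.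
  rewrite exprMn exprVn sqr_sqrtr ?(ltW nR)//; field.
  by rewrite !lt0r_neq0.
rewrite ler_wpM2l ?divr_ge0 ?sqr_ge0// -(real_normK (num_real t)).
by rewrite lerXn2r ?nnegrE ?divr_ge0 ?(ltW K0) ?(ltW Kt)// sqrtr_ge0.
Qed.

Let cterm N n z (j : 'I_N.+1 + ('I_d + 'I_d * 'I_d + 'I_3)) :
  cmeas (fun x : sample R n d => dev (stat beta m th j) (mix_expect m th (stat beta m th j)) (signed z x) ^+ 2 * zpdf th z x).
Proof.
apply: cmeasM; last exact: cmeas_zpdf.
have cd := cmeas_dev (n := n) (mix_expect m th (stat beta m th j)) (nice_stat beta m th j).
have cs : cmeas (fun x : sample R n d => dev (stat beta m th j) (mix_expect m th (stat beta m th j)) (signed z x)).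
  rewrite /signed; case: (0 <= spin_mean R z); first exact: cd.
  move=> d' T X mX; have := cd _ _ (fun t k => - X t k); apply => k.
  by apply: measurableT_comp => //; exact: mX.
exact: (cmeasM cs cs).
Qed.

(** The factor [n] cancels against the [1 / n] of the conditional variances and of
    [prior_concentration], leaving a bound uniform in [n]. *)
Lemma bad_weight_int N : exists2 C, 0 <= C & forall K n, 0 < K -> (0 < n)%N ->
  [/\ cmeas (@bad_weight N K n), fint (@bad_weight N K n) & intF_real (@bad_weight N K n) <= C / K ^+ 2].
Proof.
have [C C0 hC] := prior_concentration b1 m0 mE.
pose cc := \sum_j cheb_const (stat beta m th (N := N) j) th.
have cc0 : 0 <= cc by apply: sumr_ge0 => j _; exact: cheb_const_ge0 (nice_stat _ _ _ _).
exists (cc * (1 + C)); first by rewrite mulr_ge0// addr_ge0.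
move=> K n K0 n0; have nR : 0 < n%:R :> R by rewrite ltr0n.
have ch z j := chebyshev_z th m (nice_stat beta m th (N := N) j) n0 z.
pose S z (x : sample R n d) := \sum_j
   (dev (stat beta m th (N := N) j) (mix_expect m th (stat beta m th (N := N) j)) (signed z x) ^+ 2 * zpdf th z x).
have cS z : cmeas (S z) by apply: cmeas_sum => j; exact: cterm.
have iS z : fint (S z) by apply: fint_sum => j; [exact: cterm|exact: (ch z j).1].
have JS z : intF_real (S z) <= cc * (n%:R^-1 + (`|spin_mean R z| - m) ^+ 2).
  rewrite intF_real_sum => [|j|j]; [|exact: cterm|exact: (ch z j).1].
  by rewrite mulr_suml; apply: ler_sum => j _; exact: (ch z j).2.
have c1 z : cmeas (fun x => cw_prior beta z * (n%:R / K ^+ 2) * S z x).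
  by apply: cmeasM => //; exact: cmeas_cst.
have i1 z : fint (fun x => cw_prior beta z * (n%:R / K ^+ 2) * S z x) by exact: fintZ.
split; [exact: cmeas_sum|exact: fint_sum|].
rewrite intF_real_sum//.
have nK : 0 <= n%:R / K ^+ 2 by rewrite divr_ge0 ?sqr_ge0.
apply: (@le_trans _ _ (\sum_(z : {ffun 'I_n -> bool}) cw_prior beta z * (n%:R / K ^+ 2) *
   (cc * (n%:R^-1 + (`|spin_mean R z| - m) ^+ 2)))).
  apply: ler_sum => z _; rewrite (intF_realZ _ (cS z) (iS z)).
  by apply: ler_wpM2l; [apply: mulr_ge0; first exact: cw_prior_ge0|exact: JS].
have -> : \sum_(z : {ffun 'I_n -> bool}) cw_prior beta z * (n%:R / K ^+ 2) *
   (cc * (n%:R^-1 + (`|spin_mean R z| - m) ^+ 2)) = n%:R / K ^+ 2 * cc *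
   (n%:R^-1 + \sum_(z : {ffun 'I_n -> bool}) cw_prior beta z * (`|spin_mean R z| - m) ^+ 2).
  have e : n%:R^-1 = \sum_(z : {ffun 'I_n -> bool}) cw_prior beta z * n%:R^-1.
    by rewrite -mulr_suml cw_prior_sum mul1r.
  rewrite [X in _ = _ * (X + _)]e -big_split mulr_sumr.
  by apply: eq_bigr => z _ /=; ring.
apply: le_trans (_ : n%:R / K ^+ 2 * cc * (n%:R^-1 + C / n%:R) <= _).
  by apply: ler_wpM2l; [exact: mulr_ge0|rewrite lerD2l; exact: hC].
rewrite le_eqVlt; apply/orP; left; apply/eqP; field.
by rewrite !lt0r_neq0.
Qed.

End BadEvent.

(* Square-root trick: with likelihood ratio [r] given the labels, [r <= eta * r ^+ 2 + 1 / (4 * eta)],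
   and [r ^+ 2] is up to a constant the ratio for the doubled shift. *)
Lemma contiguity_bound (R : realType) n d (beta eta : R) (th h : 'rV[R]_d) (x : sample R n d) :
  (0 < n)%N -> 0 < eta ->
  cw_density beta (th + (Num.sqrt n%:R)^-1 *: h) x <=
  eta * expR (sqnorm h) * cw_density beta (th + (Num.sqrt n%:R)^-1 *: (2 *: h)) x +
  (4 * eta)^-1 * cw_density beta th x.
Proof.
move=> n0 e0; have nR : 0 < n%:R :> R by rewrite ltr0n.
set s := (Num.sqrt n%:R)^-1; have s2 : s ^+ 2 = n%:R^-1 by rewrite exprVn sqr_sqrtr// ltW.
have shift k z : zpdf (th + s *: k) z x = zpdf th z x *
    expR (s * \sum_(i < n) spin R (z i) * dotv k (obs x i - spin R (z i) *: th) - sqnorm k / 2).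
  have -> : expR (s * \sum_(i < n) spin R (z i) * dotv k (obs x i - spin R (z i) *: th) - sqnorm k / 2) =
    \prod_(i < n) expR (spin R (z i) * dotv (s *: k) (obs x i - spin R (z i) *: th) - sqnorm (s *: k) / 2).
    rewrite -expR_sum; apply: (f_equal expR).
    rewrite sumrB sumr_const card_ord -[sqnorm (s *: k) / 2 *+ n]mulr_natl sqnormZ s2.
    apply: (f_equal2 (fun p q => p - q)).
      rewrite mulr_sumr; apply: eq_bigr => i _; rewrite dotvZl.
      exact: mulrCA.
    by field; rewrite lt0r_neq0.
  rewrite -big_split; apply: eq_bigr => i _ /=.
  by rewrite -pdf_spin scalerDr opprD addrA.
rewrite !cw_density_zpdf !mulr_sumr -big_split; apply: ler_sum => z _ /=.
rewrite !shift; set S := \sum_(i < n) spin R (z i) * dotv h _.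
have -> : s * \sum_(i < n) spin R (z i) * dotv (2 *: h) (obs x i - spin R (z i) *: th) = 2 * (s * S).
  rewrite /S !mulr_sumr; apply: eq_bigr => i _; rewrite dotvZl.
  move: (dotv h (obs x i - _)) => p; move: (spin _ _) => r; ring.
have -> : 2 * (s * S) - sqnorm (2 *: h) / 2 = (s * S - sqnorm h / 2) + (s * S - sqnorm h / 2) - sqnorm h.
  by rewrite sqnormZ; field.
set E := s * S - sqnorm h / 2.
have -> : expR (E + E - sqnorm h) = expR E * expR E / expR (sqnorm h) by rewrite (expRD (E + E)) (expRD E E) expRN.
have q0 := cw_prior_ge0 beta z; have z0 := zpdf_ge0 th z x.
have p0 := expR_gt0 (sqnorm h); move: (expR _) (expR _) p0 => r p p0.
have -> : eta * p * (cw_prior beta z * (zpdf th z x * (r * r / p))) + (4 * eta)^-1 * (cw_prior beta z * zpdf th z x) =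
  cw_prior beta z * zpdf th z x * (eta * r ^+ 2 + (4 * eta)^-1).
  by move: (cw_prior _ _) (zpdf _ _ _) => a b; field; rewrite !lt0r_neq0.
rewrite mulrA; apply: ler_wpM2l; first exact: mulr_ge0.
rewrite -subr_ge0 (_ : _ - r = (2 * eta * r - 1) ^+ 2 / (4 * eta)).
  by rewrite divr_ge0 ?sqr_ge0// mulr_ge0// ltW.
by field; rewrite lt0r_neq0.
Qed.

(** * Approximation of continuous functions by exponential sums *)

Section SeriesTail.
Variable R : realType.
Implicit Types s t : R.

(** For [i >= n], [|s| ^ i <= 2 ^- n * (2 |s|) ^ i]. The tail is thus a small multiple of an
    exponential, the kind of error that [approx] admits. *)
Lemma exp_series_tail s (u : R^nat) n : (forall i, `|u i| <= `|s| ^+ i / i`!%:R) ->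
  cvgn (series u) -> `|limn (series u) - series u n| <= 2 ^- n * expR (2 * `|s|).
Proof.
move=> us cu.
have cv : (fun N => `|series u N - series u n|) @ \oo --> `|limn (series u) - series u n|.
  by apply: cvg_norm; apply: cvgB; [exact: cu|exact: cvg_cst].
rewrite -(cvg_lim _ cv)//; apply: limr_le; first by apply/cvg_ex; exists (`|limn (series u) - series u n|).
near=> N; have nN : (n <= N)%N by near: N; exact: nbhs_infty_ge.
have p2 k : 0 < 2 ^+ k :> R by exact: exprn_gt0.
rewrite sub_series_geq// (le_trans (ler_norm_sum _ _ _))//.
have pos (i : nat) : 0 <= exp_coeff (2 * `|s|) i by apply: exp_coeff_ge0; rewrite mulr_ge0.
apply: (@le_trans _ _ (2 ^- n * \sum_(n <= i < N) exp_coeff (2 * `|s|) i)).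
  rewrite mulr_sumr big_nat_cond [leRHS]big_nat_cond; apply: ler_sum => i /andP[/andP[ni _] _].
  apply: le_trans (us i) _; rewrite /exp_coeff /= exprMn.
  have -> : 2 ^- n * (2 ^+ i * `|s| ^+ i / i`!%:R) = 2 ^- n * 2 ^+ i * (`|s| ^+ i / i`!%:R) by rewrite !mulrA.
  have y0 : 0 <= `|s| ^+ i / i`!%:R by rewrite divr_ge0.
  by rewrite ler_peMl// ler_pdivlMl// mulr1 ler_weXn2l// ler1n.
rewrite ler_wpM2l ?invr_ge0 ?(ltW (p2 n))//.
apply: (@le_trans _ _ (series (exp_coeff (2 * `|s|)) N)).
  by rewrite /series /= (@big_cat_nat _ _ _ n 0 N)//= lerDr sumr_ge0.
by apply: nondecreasing_cvgn_le; [apply: nondecreasing_series => i _ _; exact: pos|exact: is_cvg_series_exp_coeff].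
Unshelve. all: by end_near. Qed.

Lemma cos_tail s n : `|cos s - series (cos_coeff s) n| <= 2 ^- n * expR (2 * `|s|).
Proof.
rewrite unlock; apply: exp_series_tail; last exact: is_cvg_series_cos_coeff.
move=> i; rewrite /cos_coeff /= !normrM normfV !normr_nat !normrX normrN normr1 expr1n mulr1.
by case: odd; rewrite ?mul0r ?mul1r// divr_ge0.
Qed.

Lemma sin_tail s n : `|sin s - series (sin_coeff s) n| <= 2 ^- n * expR (2 * `|s|).
Proof.
rewrite unlock; apply: exp_series_tail; last exact: is_cvg_series_sin_coeff.
move=> i; rewrite /sin_coeff /= !normrM normfV !normr_nat !normrX normrN normr1 expr1n mulr1.
by case: odd; rewrite ?mul0r ?mul1r// divr_ge0.
Qed.

Lemma expR_taylor1 s : `|expR s - 1| <= `|s| * expR `|s|.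
Proof.
have := @expR_diff_le R s 0 `|s|; rewrite expR0 subr0; apply => //; exact: ler_norm.
Qed.

Lemma expR_taylor2 s : `|expR s - 1 - s| <= s ^+ 2 * expR `|s|.
Proof.
have h1 := expR_ge1Dx s; have h2 := expR_ge1Dx (- s); have e0 := expR_gt0 s.
have h3 : expR s - 1 - s <= s * (expR s - 1).
  have : expR s * (1 - s) <= expR s * expR (- s) by rewrite ler_pM2l.
  by rewrite expRN divff ?lt0r_neq0//; lra.
rewrite ger0_norm; last by lra.
apply: le_trans h3 _; apply: le_trans (ler_norm _) _; rewrite normrM.
rewrite -(real_normK (num_real s)) expr2 -mulrA ler_wpM2l//; exact: expR_taylor1.
Qed.

Definition diff_quot t s := (expR (t * s) - 1) / t.

(** Powers of [s] are limits of polynomials in [exp (t * s)]. The error is again exponential in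
    [|s|], by induction on [a ^ k.+1 - b ^ k.+1 = a (a ^ k - b ^ k) + b ^ k (a - b)]. *)
Lemma diff_quot_pow t s k : 0 < t <= 1 ->
  `|diff_quot t s ^+ k - s ^+ k| <= k%:R * t * expR ((2 * k + 1)%:R * `|s|).
Proof.
move=> /andP[t0 t1]; have s_le : `|s| <= expR `|s| by have := expR_ge1Dx `|s|; lra.
have e0 := expR_gt0 `|s|.
have ets : expR `|t * s| <= expR `|s| by rewrite ler_expR normrM (gtr0_norm t0) ler_piMl.
have a1 : `|diff_quot t s| <= expR `|s| ^+ 2.
  rewrite normrM normfV (gtr0_norm t0) ler_pdivrMr//; apply: le_trans (expR_taylor1 _) _.
  rewrite normrM (gtr0_norm t0) -mulrA mulrC ler_wpM2r ?(ltW t0)// expr2.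
  by apply: ler_pM; rewrite ?expR_ge0// -(gtr0_norm t0) -normrM.
have a2 : `|diff_quot t s - s| <= t * expR `|s| ^+ 3.
  have -> : diff_quot t s - s = (expR (t * s) - 1 - t * s) / t.
    by rewrite /diff_quot; field; rewrite lt0r_neq0.
  rewrite normrM normfV (gtr0_norm t0) ler_pdivrMr//; apply: le_trans (expR_taylor2 _) _.
  have -> : t * expR `|s| ^+ 3 * t = t ^+ 2 * (expR `|s| ^+ 2 * expR `|s|) by ring.
  rewrite exprMn -mulrA ler_wpM2l ?sqr_ge0//; apply: ler_pM; rewrite ?sqr_ge0 ?expR_ge0//.
  by rewrite -(real_normK (num_real s)) lerXn2r ?nnegrE// ltW.
have -> : expR ((2 * k + 1)%:R * `|s|) = expR `|s| ^+ (2 * k + 1).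
  by rewrite expRM_natl.
elim: k => [|k IH]; first by rewrite !expr0 subrr normr0 !mul0r.
have -> : diff_quot t s ^+ k.+1 - s ^+ k.+1 =
  diff_quot t s * (diff_quot t s ^+ k - s ^+ k) + s ^+ k * (diff_quot t s - s).
  by rewrite !exprS; ring.
apply: le_trans (ler_normD _ _) _; rewrite (normrM (diff_quot t s)) (normrM (s ^+ k)) normrX.
have h1 : `|diff_quot t s| * `|diff_quot t s ^+ k - s ^+ k| <=
   expR `|s| ^+ 2 * (k%:R * t * expR `|s| ^+ (2 * k + 1)) by apply: ler_pM.
have h2 : `|s| ^+ k * `|diff_quot t s - s| <= expR `|s| ^+ (2 * k) * (t * expR `|s| ^+ 3).
  apply: ler_pM => //; rewrite ?exprn_ge0//.
  apply: le_trans (_ : expR `|s| ^+ k <= _); first by rewrite lerXn2r ?nnegrE// ltW.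
  rewrite ler_weXn2l//; last by rewrite mul2n -addnn leq_addl.
  by have := expR_ge1Dx `|s|; have := normr_ge0 s; lra.
apply: le_trans (lerD h1 h2) _.
have -> : (2 * k.+1 + 1 = 2 * k + 3)%N by rewrite mulnS addnAC addnC -!addnA.
rewrite le_eqVlt; apply/orP; left; apply/eqP; rewrite !exprD -[k.+1%:R]natr1.
by move: (expR _ ^+ k) => p; move: (expR _) (k%:R) => q r; ring.
Qed.

End SeriesTail.

Section SineInverse.
Variable R : realType.
Implicit Types a b t : R.

Let pi_gt2 : 1 < pi :> R.
Proof. by have := @pi_ge2 R; lra. Qed.

Lemma cos_ge_cos1 t : `|t| <= 1 -> cos 1 <= cos t :> R.
Proof.
move=> t1; have -> : cos t = cos `|t| by have [?|?] := ler0P t; rewrite ?cosN.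
have p := pi_gt2; have t0 := normr_ge0 t.
rewrite leNgt ltr_cos -?leNgt//; rewrite in_itv/=; apply/andP; split; lra.
Qed.

Lemma sin_expand a b : -1 <= b -> b <= a -> a <= 1 -> cos 1 * (a - b) <= sin a - sin b.
Proof.
move=> b1; rewrite le_eqVlt => /predU1P[-> _|ba a1]; first by rewrite !subrr mulr0.
have [c] := MVT ba (fun x _ => is_derive_sin x) (continuous_subspaceT (@continuous_sin R)).
rewrite in_itv/= => /andP[bc ca] ->; rewrite ler_wpM2r ?subr_ge0 ?(ltW ba)//.
by apply: cos_ge_cos1; rewrite ler_norml; apply/andP; split; lra.
Qed.

(** The witness is the arcsine of [t] clamped to [[-1, 1]], so every real [t] is allowed; [cos 1] is
    the least slope of [sin] on that interval. *)
Lemma sin_inverse t : exists2 a, -1 <= a <= 1 &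
  forall b, -1 <= b <= 1 -> cos 1 * `|a - b| <= `|t - sin b|.
Proof.
have c1 := @cos1_gt0 R.
have key a : -1 <= a <= 1 -> (forall b, -1 <= b <= 1 -> `|sin a - sin b| <= `|t - sin b|) ->
    exists2 a, -1 <= a <= 1 & forall b, -1 <= b <= 1 -> cos 1 * `|a - b| <= `|t - sin b|.
  move=> /andP[a0 a1] h; exists a; first by rewrite a0.
  move=> b b01; apply: le_trans (h b b01); move/andP: b01 => [b0 b1].
  have [ab|ba] := leP b a.
    rewrite ger0_norm ?subr_ge0//; apply: le_trans (ler_norm _); exact: sin_expand.
  rewrite distrC (distrC (sin a)) ger0_norm ?subr_ge0 ?(ltW ba)//.
  by apply: le_trans (ler_norm _); apply: sin_expand => //; exact: ltW.
have mono b : -1 <= b <= 1 -> (sin (-1 : R) <= sin b <= sin (1 : R))%R.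
  move=> /andP[b0 b1]; apply/andP; split; rewrite -subr_ge0.
    by apply: le_trans (sin_expand _ b0 b1); rewrite ?mulr_ge0 ?subr_ge0 ?(ltW c1).
  by apply: le_trans (sin_expand b0 b1 _); rewrite ?mulr_ge0 ?subr_ge0 ?(ltW c1).
have [t1|t1] := leP (sin 1) t.
  apply: (key 1) => [|b /mono/andP[_ hb]]; first by lra.
  by rewrite !ger0_norm ?subr_ge0 ?lerD2r//; exact: le_trans t1.
have [t0|t0] := leP t (sin (-1)).
  apply: (key (-1)) => [|b /mono/andP[hb _]]; first by lra.
  rewrite !ler0_norm ?subr_le0//; last exact: le_trans hb.
  by rewrite lerN2 lerD2r.
have l1 : -1 <= 1 :> R by lra.
have range : Num.min (sin (-1)) (sin 1) <= t <= Num.max (sin (-1)) (sin 1).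
  by rewrite ge_min le_max (ltW t0) (ltW t1) orbT.
have [a a01 e] := IVT l1 (continuous_subspaceT (@continuous_sin R)) range.
by apply: (key a) => [|b _]; [rewrite in_itv in a01|rewrite e].
Qed.

End SineInverse.

Section Bernstein.
Variable R : realType.
Implicit Types (F G : nat -> R) (v : R).

(** Bernstein operator: the expectation of [F] at a binomial variable with parameters [N] and [v],
    built one trial at a time. No binomial coefficients occur, and closure of function classes
    follows by induction. *)
Fixpoint bern N F v := if N is N'.+1 then v * bern N' (F \o S) v + (1 - v) * bern N' F v else F 0%N.

Lemma bern_le N F G v : 0 <= v <= 1 -> (forall k, F k <= G k) -> bern N F v <= bern N G v.
Proof.
move=> /andP[v0 v1]; elim: N F G => [|N IH] F G FG //=.
by apply: lerD; apply: ler_wpM2l; rewrite ?subr_ge0//; apply: IH => k /=.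
Qed.

Lemma bern_lin N a F c v : bern N (fun k => a + c * F k) v = a + c * bern N F v.
Proof. by elim: N F => //= N IH F; rewrite (IH F) (IH (F \o S)); ring. Qed.

(** Squared bias plus the variance of the binomial law. *)
Lemma bern_sqr N a v : bern N (fun k => (k%:R - a) ^+ 2) v = (N%:R * v - a) ^+ 2 + N%:R * (v * (1 - v)).
Proof.
elim: N a => [|N IH] a /=; first by ring.
have -> : (fun k => (k%:R - a) ^+ 2) \o S = (fun k : nat => (k%:R - (a - 1)) ^+ 2).
  by apply/funext => k /=; rewrite -natr1; ring.
by rewrite !IH -natr1; ring.
Qed.

Variable J : eqType.
Implicit Types (k : J -> nat) (H : (J -> nat) -> R) (w : J -> R).
Definition upd_nat k j (i : nat) : J -> nat := fun j' => if j' == j then i else k j'.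

Fixpoint mbern N (s : seq J) H w k : R :=
  if s is j :: s' then bern N (fun i => mbern N s' H w (upd_nat k j i)) (w j) else H k.

(** Coordinates are integrated out one at a time; each replaces its squared deviation by the
    variance bound [N / 4], using [v (1 - v) <= 1 / 4]. *)
Lemma mbern_bound N s H w k A M (r : seq J) : uniq s -> {subset s <= r} -> uniq r -> 0 <= M ->
  (forall j, 0 <= w j <= 1) ->
  (forall k, H k <= A + M * \sum_(j <- r) ((k j)%:R - N%:R * w j) ^+ 2) ->
  mbern N s H w k <= A + M * \sum_(j <- r) (if j \in s then N%:R / 4 else ((k j)%:R - N%:R * w j) ^+ 2).
Proof.
move=> us sr ur M0 w01 hH; elim: s us sr k => [|j s IH] /=; first by move=> _ _ k; exact: hH.
move=> /andP[js us] sr k.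
have jr : j \in r by apply: sr; rewrite mem_head.
apply: le_trans (bern_le _ (w01 j) (fun i => IH us _ (upd_nat k j i))) _.
  by move=> _ i si; apply: sr; rewrite inE si orbT.
pose rest := \sum_(i <- r | i != j) (if i \in s then N%:R / 4 else ((k i)%:R - N%:R * w i) ^+ 2).
have -> : (fun i : nat => A + M * \sum_(j0 <- r) (if j0 \in s then N%:R / 4 else
    ((upd_nat k j i j0)%:R - N%:R * w j0) ^+ 2)) =
  (fun i : nat => (A + M * rest) + M * (i%:R - N%:R * w j) ^+ 2).
  apply/funext => i; rewrite (bigD1_seq j)//= (negPf js) /upd_nat eqxx.
  rewrite (eq_bigr (fun i => if i \in s then N%:R / 4 else ((k i)%:R - N%:R * w i) ^+ 2)); last first.
    by move=> j' /negPf ->.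
  by rewrite -/rest; ring.
rewrite (bern_lin N (A + M * rest) (fun i => (i%:R - N%:R * w j) ^+ 2)) bern_sqr subrr expr0n add0r.
rewrite (bigD1_seq j)//= mem_head.
rewrite [X in _ <= _ + _ * (_ + X)](_ : _ = rest); last first.
  by apply: eq_bigr => i /negPf ij; rewrite inE ij.
have h : M * (N%:R * (w j * (1 - w j))) <= M * (N%:R / 4).
  apply: ler_wpM2l => //; apply: ler_wpM2l => //.
  have := sqr_ge0 (w j - 2^-1); have -> : (w j - 2^-1) ^+ 2 = 4^-1 - w j * (1 - w j) by field.
  by rewrite subr_ge0.
apply: le_trans (lerD (lexx (A + M * rest)) h) _.
by move: rest => p; rewrite le_eqVlt; apply/orP; left; apply/eqP; ring.
Qed.

End Bernstein.

Lemma box_modulus (R : realType) d (f : 'rV[R]_d -> R) (B e : R) : continuous f -> 0 < e ->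
  exists2 delta, 0 < delta & forall y p : 'rV[R]_d, (forall j, `|y 0 j| <= B) ->
    (forall j, `|p 0 j - y 0 j| < delta) -> `|f p - f y| <= e.
Proof.
move=> cf e0; pose K := [set y : 'rV[R]_d | forall j, `[- B, B]%classic (y ord0 j)].
have cK : compact K.
  by apply: (@rV_compact R d (fun=> `[- B, B]%classic)) => j; exact: segment_compact.
pose P (delta : R) (y : 'rV[R]_d) := forall p : 'rV[R]_d, (forall j, `|p 0 j - y 0 j| < delta) -> `|f p - f y| <= e.
(* Near each point of the box all small radii work; the near-covering form of compactness makes this
   uniform. *)
have main : \forall delta \near (0 : R)^'+, K `<=` P delta.
  apply: (proj1 (compact_near_coveringP K) cK) => x _; have e2 : 0 < e / 2 by rewrite divr_gt0.
  have /cvgrPdist_le /(_ _ e2) /nbhs_ballP[r /= r0 hr] := cf x.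
  exists (ball x (r / 2), [set t | t < r / 2]) => /=.
    split; first by apply: nbhsx_ballx; rewrite divr_gt0.
    by apply: nbhs_right_lt; rewrite divr_gt0.
  move=> [x' t] /= [bx tr] p hp.
  have bp : ball x r p.
    split=> // i j; rewrite (ord1 i); have := bx.2 ord0 j; have := hp j; rewrite /ball /= => h1 h2.
    have := ler_distD (x' 0 j) (x 0 j) (p 0 j); rewrite (distrC (x' 0 j)).
    by move: h1 h2 tr; move: (`|_|) (`|_|) (`|_|) => a b c; lra.
  have bx' : ball x r x' by apply: le_ball bx; lra.
  have := hr _ bp; have := hr _ bx'; have := ler_distD (f x) (f p) (f x').
  by rewrite (distrC (f p) (f x)) /=; move: (`|_|) (`|_|) (`|_|) => a b c; lra.
have pos : \forall t \near (0 : R)^'+, 0 < t by exact: nbhs_right_gt.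
have both : \forall t \near (0 : R)^'+, (K `<=` P t) /\ 0 < t by near=> t; split; near: t.
have [delta [hd d0]] := @filter_ex _ (0 : R)^'+ (at_right_proper_filter (0 : R)) _ both.
exists delta => // y p hy; apply: hd => j /=.
by rewrite in_itv/= -ler_norml; exact: hy.
Unshelve. all: by end_near. Qed.

Section ExponentialSums.
Variables (R : realType) (d : nat) (Ic : 'M[R]_d).
Implicit Types (l Q W : seq (R * 'rV[R]_d)) (y lam : 'rV[R]_d) (f g : 'rV[R]_d -> R).

Definition expsum l y := \sum_(p <- l) p.1 * expR (dotv p.2 y).
(** Integral of [expsum l] against the centred Gaussian law with covariance [Ic]. The formula makes
    sense before semidefiniteness is known, which for [Ibeta] is derived only later, from these very
    sums. *)
Definition Lam l := \sum_(p <- l) p.1 * expR (qform p.2 Ic / 2).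
Definition expscale (a : R) l := [seq (a * p.1, p.2) | p <- l].

Lemma expsum_cat l l' y : expsum (l ++ l') y = expsum l y + expsum l' y.
Proof. by rewrite /expsum big_cat. Qed.

Lemma Lam_cat l l' : Lam (l ++ l') = Lam l + Lam l'.
Proof. by rewrite /Lam big_cat. Qed.

Lemma expsum_scale a l y : expsum (expscale a l) y = a * expsum l y.
Proof. by rewrite /expsum big_map mulr_sumr; apply: eq_bigr => p _; rewrite mulrA. Qed.

Lemma Lam_scale a l : Lam (expscale a l) = a * Lam l.
Proof. by rewrite /Lam big_map mulr_sumr; apply: eq_bigr => p _; rewrite mulrA. Qed.

(* [f] is an L1-limit of exponential sums for the Gaussian law with covariance [Ic],
   with errors that are themselves dominated by exponential sums. *)
Definition approx f := forall e, 0 < e -> exists Q W,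
  (forall y, `|f y - expsum Q y| <= expsum W y) /\ Lam W <= e.

Lemma approx_close f : (forall e, 0 < e -> exists g W,
  [/\ approx g, forall y, `|f y - g y| <= expsum W y & Lam W <= e]) -> approx f.
Proof.
move=> H e e0; have e2 : 0 < e / 2 by rewrite divr_gt0.
have [g [W [ag fg LW]]] := H _ e2; have [Q [W' [gQ LW']]] := ag _ e2.
exists Q, (W ++ W'); split => [y|]; last by rewrite Lam_cat; lra.
by rewrite expsum_cat (le_trans (ler_distD (g y) _ _))// lerD.
Qed.

Lemma approxD f g : approx f -> approx g -> approx (fun y => f y + g y).
Proof.
move=> af ag e e0; have e2 : 0 < e / 2 by rewrite divr_gt0.
have [Q [W [fQ LW]]] := af _ e2; have [Q' [W' [gQ LW']]] := ag _ e2.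
exists (Q ++ Q'), (W ++ W'); split => [y|]; last by rewrite Lam_cat; lra.
rewrite !expsum_cat; have := fQ y; have := gQ y.
by move: (f y) (g y) (expsum _ _) (expsum _ _) (expsum _ _) (expsum _ _) => *; rewrite opprD addrACA (le_trans (ler_normD _ _))// lerD.
Qed.

Lemma approxZ a f : approx f -> approx (fun y => a * f y).
Proof.
move=> af e e0; have a1 : 0 < `|a| + 1 by rewrite ltr_wpDl.
have [Q [W [fQ LW]]] := af _ (divr_gt0 e0 a1).
exists (expscale a Q), (expscale (`|a| + 1) W); split => [y|].
  rewrite !expsum_scale -mulrBr normrM; apply: ler_pM => //.
  by rewrite lerDl.
by rewrite Lam_scale mulrC -ler_pdivlMr.
Qed.

Lemma approx0 : approx (fun=> 0).
Proof.
move=> e e0; exists [::], [::]; split => [y|]; last by rewrite /Lam big_nil ltW.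
by rewrite /expsum !big_nil subr0 normr0.
Qed.

Lemma approx_sum (J : Type) (s : seq J) (c : J -> R) (F : J -> 'rV[R]_d -> R) :
  (forall j, approx (F j)) -> approx (fun y => \sum_(j <- s) c j * F j y).
Proof.
move=> aF; elim: s => [|j s IH].
  have -> : (fun y => \sum_(j <- [::]) c j * F j y) = (fun=> 0) by apply/funext => y; rewrite big_nil.
  exact: approx0.
have -> : (fun y => \sum_(j <- j :: s) c j * F j y) =
   (fun y => c j * F j y + \sum_(j <- s) c j * F j y) by apply/funext => y; rewrite big_cons.
by apply: approxD => //; exact: approxZ.
Qed.

Lemma diff_quot_expsum t lam k : exists Q, forall y, expsum Q y = diff_quot t (dotv lam y) ^+ k.
Proof.
elim: k => [|k [Q hQ]].
  by exists [:: (1, 0)] => y; rewrite /expsum big_seq1 /= -(scale0r lam) dotvZl mul0r expR0 mulr1.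
exists ([seq (p.1 / t, p.2 + t *: lam) | p <- Q] ++ expscale (- t^-1) Q) => y.
rewrite expsum_cat expsum_scale exprS -hQ /diff_quot.
have -> : expsum [seq (p.1 / t, p.2 + t *: lam) | p <- Q] y = expR (t * dotv lam y) / t * expsum Q y.
  rewrite /expsum big_map mulr_sumr; apply: eq_bigr => p _ /=.
  by rewrite dotvDl dotvZl expRD; move: (expR _) (expR _) => a b; ring.
by move: (expR _) (expsum _ _) => a b; ring.
Qed.

(** Exponential sum dominating [c * exp |lam . y|]; it converts error bounds with absolute values
    into the form required by [approx]. *)
Definition cosh_pair (c : R) lam := [:: (c, lam); (c, - lam)].

Lemma expsum_cosh_pair c lam y : 0 <= c -> c * expR `|dotv lam y| <= expsum (cosh_pair c lam) y.
Proof.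
move=> c0; rewrite /expsum !big_cons big_nil addr0 /= dotvNl -mulrDr ler_wpM2l//.
by have [?|?] := ler0P (dotv lam y); rewrite ?lerDl ?lerDr expR_ge0.
Qed.

Lemma qformN lam : qform (- lam) Ic = qform lam Ic.
Proof. by rewrite /qform !linearN /= mulNmx mulNmx opprK. Qed.

Lemma Lam_cosh_pair c lam : Lam (cosh_pair c lam) = 2 * c * expR (qform lam Ic / 2).
Proof. by rewrite /Lam !big_cons big_nil addr0 /= qformN; ring. Qed.

Lemma approx_pow lam k : approx (fun y => dotv lam y ^+ k).
Proof.
move=> e e0; pose E := expR (qform ((2 * k + 1)%:R *: lam) Ic / 2).
have E0 : 0 < E by exact: expR_gt0.
(* Makes the integral [2 k t E] of the error at most [e]; the added 1 covers [k = 0]. *)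
pose t := Num.min 1 (e / (2 * k%:R * E + 1)).
have D0 : 0 < 2 * k%:R * E + 1 by rewrite ltr_wpDl// !mulr_ge0// ltW.
have t01 : 0 < t <= 1 by rewrite lt_min ltr01 divr_gt0//= ge_min lexx.
have [Q hQ] := diff_quot_expsum t lam k.
exists Q, (cosh_pair (k%:R * t) ((2 * k + 1)%:R *: lam)); split => [y|].
  rewrite hQ distrC; apply: le_trans (diff_quot_pow _ _ t01) _.
  apply: le_trans (expsum_cosh_pair _ _ _); last by rewrite mulr_ge0// ltW//; case/andP: t01.
  by rewrite dotvZl normrM normr_nat.
rewrite Lam_cosh_pair -/E.
have : t * (2 * k%:R * E + 1) <= e by rewrite -ler_pdivlMr// ge_min lexx orbT.
rewrite (_ : 2 * (k%:R * t) * E = t * (2 * k%:R * E)); last by ring.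
by rewrite mulrDr mulr1; apply: le_trans; rewrite lerDl; case/andP: t01 => /ltW.
Qed.

Lemma pow2_small (c e : R) : 0 < e -> exists n, c * 2 ^- n <= e.
Proof.
move=> e0; pose n := (Num.truncn (`|c| / e)).+1; exists n.
have h : `|c| / e <= n%:R by exact/ltW/truncnS_gt.
have h2 : n%:R <= 2 ^+ n :> R by rewrite -natrX ler_nat ltnW// ltn_expl.
rewrite ler_pdivrMr ?exprn_gt0// (le_trans (ler_norm _))//.
by move: (le_trans h h2); rewrite ler_pdivrMr// mulrC.
Qed.

Lemma approx_cos lam c : approx (fun y => cos (dotv lam y + c)).
Proof.
apply: approx_close => e e0; pose E := expR (qform (2 *: lam) Ic / 2).
have [n hn] := pow2_small (4 * E) e0.
exists (fun y => cos c * series (cos_coeff (dotv lam y)) n + (- sin c) * series (sin_coeff (dotv lam y)) n).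
exists (cosh_pair (2 * 2 ^- n) (2 *: lam)); split.
- apply: approxD; apply: approxZ.
    have -> : (fun y => series (cos_coeff (dotv lam y)) n) = (fun y => \sum_(i <- index_iota 0 n)
       ((~~ odd i)%:R * (-1) ^+ i./2 / i`!%:R) * dotv lam y ^+ i).
      by apply/funext => y; apply: eq_bigr => i _; rewrite /cos_coeff /= mulrAC.
    by apply: approx_sum => i; exact: approx_pow.
  have -> : (fun y => series (sin_coeff (dotv lam y)) n) = (fun y => \sum_(i <- index_iota 0 n)
       ((odd i)%:R * (-1) ^+ i.-1./2 / i`!%:R) * dotv lam y ^+ i).
    by apply/funext => y; apply: eq_bigr => i _; rewrite /sin_coeff /= mulrAC.
  by apply: approx_sum => i; exact: approx_pow.
- move=> y; apply: le_trans (expsum_cosh_pair _ _ _); last by rewrite mulr_ge0// invr_ge0 exprn_ge0.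
  rewrite dotvZl normrM (ger0_norm (ler0n R 2)) cosD.
  have h1 := cos_tail (dotv lam y) n; have h2 := sin_tail (dotv lam y) n.
  have c1 := cos_max c; have s1 := sin_max c.
  set s := dotv lam y in h1 h2 *.
  have -> : cos s * cos c - sin s * sin c - (cos c * series (cos_coeff s) n + - sin c * series (sin_coeff s) n) =
    cos c * (cos s - series (cos_coeff s) n) - sin c * (sin s - series (sin_coeff s) n) by ring.
  apply: le_trans (ler_normB _ _) _; rewrite !normrM.
  have := ler_pM (normr_ge0 _) (normr_ge0 _) c1 h1; have := ler_pM (normr_ge0 _) (normr_ge0 _) s1 h2.
  by rewrite -(mulrA 2) !mul1r; move: (2 ^- n * _) => *; lra.
- by rewrite Lam_cosh_pair -/E; move: hn; lra.
Qed.

(** Products are formed inside this class, where product-to-sum formulas reduce them to sums, rather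
    than for [approx] itself. *)
Inductive trig : ('rV[R]_d -> R) -> Prop :=
| trig_cos lam c : trig (fun y => cos (dotv lam y + c))
| trig_add f g : trig f -> trig g -> trig (fun y => f y + g y)
| trig_scale a f : trig f -> trig (fun y => a * f y).

Lemma trig_approx f : trig f -> approx f.
Proof. by elim=> *; [exact: approx_cos|exact: approxD|exact: approxZ]. Qed.

Lemma trig_cst a : trig (fun=> a).
Proof.
have -> : (fun=> a) = (fun y => a * cos (dotv (0 : 'rV[R]_d) y + 0)).
  by apply/funext => y; rewrite -(scale0r 0) dotvZl mul0r addr0 cos0 mulr1.
exact/trig_scale/trig_cos.
Qed.

Lemma trig_mul f g : trig f -> trig g -> trig (fun y => f y * g y).
Proof.
move=> tf; elim: tf g => [lam c|f1 f2 _ IH1 _ IH2|a f1 _ IH] g tg; last 2 first.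
- have -> : (fun y => (f1 y + f2 y) * g y) = (fun y => f1 y * g y + f2 y * g y).
    by apply/funext => y; rewrite mulrDl.
  by apply: trig_add; [exact: IH1|exact: IH2].
- have -> : (fun y => a * f1 y * g y) = (fun y => a * (f1 y * g y)).
    by apply/funext => y; rewrite mulrA.
  by apply: trig_scale; exact: IH.
elim: tg => [mu b|g1 g2 _ IH1 _ IH2|a g1 _ IH].
- have -> : (fun y => cos (dotv lam y + c) * cos (dotv mu y + b)) =
    (fun y => 2^-1 * (cos (dotv (lam + mu) y + (c + b)) + cos (dotv (lam - mu) y + (c - b)))).
    apply/funext => y; rewrite !dotvDl dotvNl.
    have -> : dotv lam y + dotv mu y + (c + b) = (dotv lam y + c) + (dotv mu y + b) by ring.
    have -> : dotv lam y - dotv mu y + (c - b) = (dotv lam y + c) - (dotv mu y + b) by ring.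
    by move: (dotv lam y + c) (dotv mu y + b) => p q; rewrite cosD cosB; field.
  by apply: trig_scale; apply: trig_add; exact: trig_cos.
- have -> : (fun y => cos (dotv lam y + c) * (g1 y + g2 y)) =
    (fun y => cos (dotv lam y + c) * g1 y + cos (dotv lam y + c) * g2 y).
    by apply/funext => y; rewrite mulrDr.
  exact: trig_add.
- have -> : (fun y => cos (dotv lam y + c) * (a * g1 y)) = (fun y => a * (cos (dotv lam y + c) * g1 y)).
    by apply/funext => y; rewrite mulrCA.
  exact: trig_scale.
Qed.

Lemma trig_bern N (F : nat -> 'rV[R]_d -> R) (v : 'rV[R]_d -> R) :
  (forall k, trig (F k)) -> trig v -> trig (fun y => bern N (F^~ y) (v y)).
Proof.
move=> tF tv; elim: N F tF => [|N IH] F tF /=; first exact: tF.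
apply: trig_add; apply: trig_mul => //.
- exact: (IH (fun k => F k.+1)).
- have -> : (fun y => 1 - v y) = (fun y => 1 + (-1) * v y) by apply/funext => y; rewrite mulN1r.
  by apply: trig_add; [exact: trig_cst|exact: trig_scale].
- exact: IH.
Qed.

Lemma trig_mbern N (s : seq 'I_d) H (w : 'I_d -> 'rV[R]_d -> R) k :
  (forall j, trig (w j)) -> trig (fun y => mbern N s H (w^~ y) k).
Proof.
move=> tw; elim: s k => [|j s IH] k /=; first exact: trig_cst.
exact: (@trig_bern N (fun i y => mbern N s H (w^~ y) (upd_nat k j i))).
Qed.

End ExponentialSums.

Lemma mbernN (R : realType) (J : eqType) N (s : seq J) H (w : J -> R) k :
  mbern N s (fun k => - H k) w k = - mbern N s H w k.
Proof.
elim: s k => [|j s IH] k //=.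
have := bern_lin N 0 (fun i => mbern N s H w (upd_nat k j i)) (-1) (w j).
rewrite add0r mulN1r => <-; congr (bern _ _ _); apply/funext => i.
by rewrite IH add0r mulN1r.
Qed.

(** The variable [(1 + sin (y_j / L)) / 2] lies in [[0, 1]] and is injective for [|y_j| <= L], so a
    Bernstein polynomial in it approximates [f] on the box. Being bounded by [C] everywhere, unlike
    a polynomial in [y], it errs by at most [2 C] outside, which is at most [2 C exp (|y_j| - L)]
    for some [j]. *)
Lemma approx_bounded (R : realType) d (Ic : 'M[R]_d) (f : 'rV[R]_d -> R) (C : R) :
  continuous f -> (forall y, `|f y| <= C) -> approx Ic f.
Proof.
move=> cf fC; have C0 : 0 <= C by apply: le_trans (fC 0).
apply: approx_close => e e0; have e4 : 0 < e / 4 by rewrite divr_gt0.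
pose dl j : 'rV[R]_d := delta_mx 0 j.
have dotdl j y : dotv (dl j) y = y 0 j.
  rewrite /dotv (bigD1 j)//= mxE !eqxx mul1r big1 ?addr0// => k /negPf kj.
  by rewrite mxE eqxx kj mul0r.
pose E := \sum_j expR (qform (dl j) Ic / 2); have E0 : 0 <= E by apply: sumr_ge0 => j _; exact: expR_ge0.
(* Large enough for the Gaussian integral of the terms outside the box to be at most [e / 2], by
   [L <= exp L]. *)
pose L := 1 + 4 * (8 * C * E) / e.
have L1 : 1 <= L by rewrite lerDl divr_ge0 ?(ltW e0)// !mulr_ge0.
have L0 : 0 < L by lra.
have eL : 4 * C * expR (- L) * E <= e / 2.
  have h : L <= expR L by have := expR_ge1Dx L; lra.
  have h2 : 8 * C * E <= e * L.
    rewrite /L mulrDr mulr1 [e * (_ / e)]mulrC divfK ?lt0r_neq0//.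
    by have : 0 <= 8 * C * E by [rewrite !mulr_ge0|]; move: e0; move: (8 * C * E) => *; lra.
  rewrite expRN -mulrA mulrCA mulrC ler_pdivrMr ?expR_gt0//.
  have := ler_wpM2l (ltW e0) h; move: h2; rewrite -!mulrA; move: (C * E) (expR L) => p q.
  by move: (e * L) => r; lra.
have [delta d0 mod] := box_modulus L cf e4.
have /choice[P hP] : forall t : R, exists a : R, -1 <= a <= 1 /\
    forall b, -1 <= b <= 1 -> cos 1 * `|a - b| <= `|t - sin b|.
  by move=> t; have [a a1 a2] := sin_inverse t; exists a.
have c1 := @cos1_gt0 R.
(* Chebyshev again: a node at distance at least [delta] costs
   [2 C <= 2 C |node - y| ^ 2 / delta ^ 2], and [nodeE] turns that distance into the deviation of
   [k j] from [N * w j y]. *)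
pose D := 2 * C / delta ^+ 2 * (2 * L / cos 1) ^+ 2.
have D0 : 0 <= D by rewrite mulr_ge0 ?sqr_ge0// divr_ge0 ?sqr_ge0// mulr_ge0.
pose N := (Num.truncn (D * d%:R / e)).+1.
have N0 : 0 < N%:R :> R by rewrite ltr0n.
have hN : D / N%:R ^+ 2 * (d%:R * (N%:R / 4)) <= e / 4.
  have : D * d%:R / e <= N%:R by exact/ltW/truncnS_gt.
  rewrite ler_pdivrMr// => h.
  have -> : D / N%:R ^+ 2 * (d%:R * (N%:R / 4)) = (D * d%:R) / (4 * N%:R) by field; rewrite lt0r_neq0.
  by rewrite ler_pdivrMr ?mulr_gt0//; move: h; move: (D * _) (N%:R : R) => *; lra.
pose w j (y : 'rV[R]_d) := (1 + sin (y 0 j / L)) / 2.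
have w01 y j : 0 <= w j y <= 1.
  have := sin_max (y 0 j / L); rewrite ler_norml /w; move: (sin _) => t /andP[? ?].
  by apply/andP; split; lra.
(* As [P] inverts the sine with clamping, nodes exist for every [k], also for [k j > N]. *)
pose node (k : 'I_d -> nat) : 'rV[R]_d := \row_j (L * P (2 * (k j)%:R / N%:R - 1)).
pose H k := f (node k).
pose g y := mbern N (enum 'I_d) H (w^~ y) (fun=> 0%N).
have gC (y : 'rV[R]_d) : `|g y| <= C.
  have b h : (forall k, h k <= C) -> mbern N (enum 'I_d) h (w^~ y) (fun=> 0%N) <= C.
    move=> hC; have := @mbern_bound R _ N (enum 'I_d) h (w^~ y) (fun=> 0%N) C 0 (enum 'I_d).
    rewrite !mul0r !addr0; apply => //; first exact: enum_uniq.
    - exact: enum_uniq.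
    - by move=> k; rewrite mul0r addr0.
  rewrite ler_norml; apply/andP; split.
    by rewrite lerNl -mbernN; apply: b => k; have := fC (node k); rewrite ler_norml lerNl => /andP[].
  by apply: b => k; have := fC (node k); rewrite ler_norml => /andP[].
have gf (y : 'rV[R]_d) : (forall j, `|y 0 j| <= L) -> `|f y - g y| <= e / 2.
  move=> yL.
  have nodeE k j : `|node k 0 j - y 0 j| <= 2 * L / cos 1 / N%:R * `|(k j)%:R - N%:R * w j y|.
    rewrite mxE; set t := 2 * (k j)%:R / N%:R - 1.
    have yb : -1 <= y 0 j / L <= 1.
      by rewrite -ler_norml normrM normfV (gtr0_norm L0) ler_pdivrMr// mul1r.
    have [_ /(_ _ yb) h] := hP t.
    have -> : L * P t - y 0 j = L * (P t - y 0 j / L) by field; rewrite lt0r_neq0.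
    have e1 : (k j)%:R - N%:R * w j y = N%:R / 2 * (t - sin (y 0 j / L)).
      by rewrite /t /w; field; rewrite lt0r_neq0.
    rewrite e1 !normrM (gtr0_norm L0) normfV !(gtr0_norm N0) (gtr0_norm (ltr0n R 2)).
    have -> : 2 * L / cos 1 / N%:R * (N%:R / 2 * `|t - sin (y 0 j / L)|) = L * (`|t - sin (y 0 j / L)| / cos 1).
      by move: (`|_|) => p; field; rewrite !lt0r_neq0.
    by apply: ler_wpM2l; [exact: ltW|rewrite ler_pdivlMr// mulrC].
  have close k : `|H k - f y| <= e / 4 + D / N%:R ^+ 2 * \sum_(j <- enum 'I_d) ((k j)%:R - N%:R * w j y) ^+ 2.
    have S0 : 0 <= D / N%:R ^+ 2 * \sum_(j <- enum 'I_d) ((k j)%:R - N%:R * w j y) ^+ 2.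
      by rewrite mulr_ge0 ?divr_ge0 ?sqr_ge0// sumr_ge0// => j _; exact: sqr_ge0.
    have [near|] := pselect (forall j, `|node k 0 j - y 0 j| < delta).
      by apply: le_trans (mod _ _ yL near) _; rewrite lerDl.
    move=> /existsNP[j] /negP; rewrite -leNgt => far.
    apply: le_trans (_ : 2 * C <= _).
      by apply: le_trans (ler_normB _ _) _; have := fC y; have := fC (node k); rewrite /H; lra.
    apply: le_trans (_ : 2 * C / delta ^+ 2 * (node k 0 j - y 0 j) ^+ 2 <= _).
      have dd : 0 < delta ^+ 2 by rewrite exprn_gt0.
      rewrite mulrAC ler_pdivlMr// ler_wpM2l ?mulr_ge0// -(real_normK (num_real (_ - _))).
      by rewrite lerXn2r ?nnegrE// ltW.
    apply: le_trans (_ : D / N%:R ^+ 2 * ((k j)%:R - N%:R * w j y) ^+ 2 <= _); last first.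
      rewrite -[leLHS]add0r; apply: lerD; first exact: ltW.
      apply: ler_wpM2l; first by rewrite divr_ge0 ?sqr_ge0.
      rewrite (bigD1_seq j) ?mem_enum ?enum_uniq//= lerDl sumr_ge0// => i _; exact: sqr_ge0.
    rewrite -(real_normK (num_real (node k 0 j - _))) -(real_normK (num_real ((k j)%:R - _))).
    have -> : D / N%:R ^+ 2 * `|(k j)%:R - N%:R * w j y| ^+ 2 =
      2 * C / delta ^+ 2 * (2 * L / cos 1 / N%:R * `|(k j)%:R - N%:R * w j y|) ^+ 2.
      by rewrite /D; move: (`|_|) => p; field; rewrite !lt0r_neq0.
    apply: ler_wpM2l; first by rewrite divr_ge0 ?sqr_ge0 ?mulr_ge0.
    by rewrite lerXn2r ?nnegrE// (le_trans (normr_ge0 _) (nodeE k j)).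
  have b h A : (forall k, h k <= A + D / N%:R ^+ 2 * \sum_(j <- enum 'I_d) ((k j)%:R - N%:R * w j y) ^+ 2) ->
     mbern N (enum 'I_d) h (w^~ y) (fun=> 0%N) <= A + e / 4.
    move=> hA; apply: le_trans (lerD (lexx A) hN).
    have := @mbern_bound R _ N (enum 'I_d) h (w^~ y) (fun=> 0%N) A (D / N%:R ^+ 2) (enum 'I_d).
    have -> : \sum_(j <- enum 'I_d) (if j \in enum 'I_d then N%:R / 4 else (0%:R - N%:R * w j y) ^+ 2) =
      d%:R * (N%:R / 4) :> R.
      rewrite (eq_bigr (fun=> N%:R / 4)); last by move=> j _; rewrite mem_enum.
      by rewrite big_enum sumr_const card_ord -[LHS]mulr_natl.
    apply => //; [exact: enum_uniq|exact: enum_uniq|by rewrite divr_ge0 ?sqr_ge0].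
  have h1 := b H (f y + e / 4); have h2 := b (fun k => - H k) (- f y + e / 4).
  rewrite mbernN -/(g y) in h2; rewrite -/(g y) in h1.
  have {}h1 : g y <= f y + e / 4 + e / 4.
    by apply: h1 => k; have := close k; rewrite ler_norml => /andP[_]; lra.
  have {}h2 : - g y <= - f y + e / 4 + e / 4.
    by apply: h2 => k; have := close k; rewrite ler_norml => /andP[+ _]; lra.
  by rewrite ler_norml; apply/andP; split; lra.
(* The pair with exponent 0 is the constant [e / 2], covering the error inside the box. *)
exists g, ((e / 2, 0) :: flatten [seq cosh_pair (2 * C * expR (- L)) (dl j) | j <- enum 'I_d]).
have K0 : 0 <= 2 * C * expR (- L) by rewrite mulr_ge0 ?expR_ge0// mulr_ge0.
split.
- apply: trig_approx; apply: trig_mbern => j.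
  have -> : w j = (fun y => 2^-1 + 2^-1 * cos (dotv (L^-1 *: dl j) y + - (pi / 2))).
    by apply/funext => y; rewrite dotvZl dotdl cosBpihalf /w (mulrC L^-1); field.
  by apply: trig_add; [exact: trig_cst|apply: trig_scale; exact: trig_cos].
- move=> y; rewrite /expsum big_cons -/(expsum _ y) /= -(scale0r y) dotvZl mul0r expR0 mulr1.
  have pos j : 0 <= expsum (cosh_pair (2 * C * expR (- L)) (dl j)) y.
    by apply: le_trans (expsum_cosh_pair _ _ K0); rewrite mulr_ge0 ?expR_ge0.
  have tailE : expsum (flatten [seq cosh_pair (2 * C * expR (- L)) (dl j) | j <- enum 'I_d]) y =
    \sum_j expsum (cosh_pair (2 * C * expR (- L)) (dl j)) y.
    by rewrite /expsum big_flatten big_map big_enum.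
  rewrite tailE; have [yL|] := pselect (forall j, `|y 0 j| <= L).
    by apply: le_trans (gf _ yL) _; rewrite lerDl sumr_ge0.
  move=> /existsNP[j] /negP; rewrite -ltNge => jL.
  apply: le_trans (_ : 2 * C <= _).
    by apply: le_trans (ler_normB _ _) _; have := fC y; have := gC y; lra.
  rewrite -[leLHS]add0r; apply: lerD; first by rewrite divr_ge0// ltW.
  rewrite (bigD1 j)//= ler_wpDr ?sumr_ge0//.
  apply: le_trans (expsum_cosh_pair _ _ K0); rewrite dotdl -(mulrA (2 * C)) -expRD ler_peMr ?mulr_ge0//.
  by rewrite -expR0 ler_expR; lra.
- rewrite /Lam big_cons -/(Lam _ _) /=.
  have -> : Lam Ic (flatten [seq cosh_pair (2 * C * expR (- L)) (dl j) | j <- enum 'I_d]) =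
    4 * C * expR (- L) * E.
    rewrite /Lam big_flatten big_map big_enum /E mulr_sumr; apply: eq_bigr => j _.
    by rewrite -/(Lam Ic _) Lam_cosh_pair; ring.
  have -> : qform (0 : 'rV[R]_d) Ic = 0 by rewrite /qform !mul0mx mxE.
  by rewrite mul0r expR0 mulr1; move: eL; lra.
Qed.

(** * Integrals of functions of the score *)

Lemma add_norm_ge0 (R : realType) (t : R) : 0 <= t + `|t|.
Proof. by have := ler_norm (- t); rewrite normrN; lra. Qed.

(** Nonnegativity of one summand of the dominating function in [expect_le_Lam] off the good event,
    isolated so that [lra] sees only opaque quantities. *)
Lemma bad_term_ge0 (R : realType) (t w l l2 B k1 k2 D : R) :
  `|t| * w * l <= `|t| * w * (k1 * l2 + D^-1 * B) -> 0 <= (t + `|t|) * w * l ->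
  0 <= `|t| * w * k2 * l ->
  0 <= (t * w + `|t| * w * k2) * l + `|t| * w * k1 * l2 + `|t| * w / D * B.
Proof. by move: D^-1 (`|t|) => k3 s; lra. Qed.

Lemma linear3 (R : realType) (I : finType) (a b c : R) (F G H : (I -> R) -> R) :
  cmeas F -> fint F -> cmeas G -> fint G -> cmeas H -> fint H ->
  [/\ cmeas (fun x => a * F x + b * G x + c * H x), fint (fun x => a * F x + b * G x + c * H x) &
    intF_real (fun x => a * F x + b * G x + c * H x) = a * intF_real F + b * intF_real G + c * intF_real H].
Proof.
move=> mF iF mG iG mH iH.
have mZ (k : R) (K : (I -> R) -> R) : cmeas K -> cmeas (fun x : I -> R => k * K x).
  by move=> mK; apply: cmeasM => //; exact: cmeas_cst.
have mFG : cmeas (fun x => a * F x + b * G x) by apply: cmeasD; exact: mZ.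
have iFG : fint (fun x => a * F x + b * G x) by apply: fintD; [exact: mZ|exact: mZ|exact: fintZ|exact: fintZ].
split; [by apply: cmeasD => //; exact: mZ|by apply: fintD => //; [exact: mZ|exact: fintZ]|].
rewrite intF_realD//; [|exact: mZ|exact: fintZ].
rewrite intF_realD//; [|exact: mZ|exact: mZ|exact: fintZ|exact: fintZ].
by rewrite !intF_realZ.
Qed.

Section UpperBound.
Variables (R : realType) (d : nat) (beta m : R) (th : 'rV[R]_d).
Hypotheses (b1 : 1 < beta) (m0 : 0 < m) (mE : m = tanhR (beta * m)).
Hypothesis th0 : 0 < sqnorm th.
Let b0 : 0 < beta. Proof. exact: lt_trans b1. Qed.
Variable U : forall n, sample R n d -> R.
Hypothesis mU : forall n (x : sample R n d), minimizer beta (field th x) (U x).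
Let T n (x : sample R n d) := Delta_tilde beta th x (U x).
Let Ib := Ibeta beta m th.
Let q h := expR (qform h Ib / 2).

Lemma eventually_seq (J : eqType) (s : seq J) (P : J -> nat -> Prop) :
  (forall j, exists n1, forall n, (n1 <= n)%N -> P j n) ->
  exists n1, forall n, (n1 <= n)%N -> forall j, j \in s -> P j n.
Proof.
move=> H; elim: s => [|j s [n1 IH]]; first by exists 0%N.
have [n2 h2] := H j; exists (maxn n1 n2) => n; rewrite geq_max => /andP[/IH h1 /h2 h3] i.
by rewrite inE => /predU1P[->//|]; exact: h1.
Qed.

Let lr h n : sample R n d -> R := cw_density beta (th + (Num.sqrt n%:R)^-1 *: h).

Let lan_error h n (x : sample R n d) :=
  log_lr beta (th + (Num.sqrt n%:R)^-1 *: h) th x - (dotv h (T x) - 2^-1 * qform h Ib).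

(** The expansion read backwards: [exp (h . T) p_0 = q h * p_h * exp (- r)] with [r] the error of
    the expansion. Since [p_h] integrates to 1, [q h] is the limiting exponential moment. *)
Lemma exp_score_close h n (x : sample R n d) rho : (0 < n)%N -> rho <= 1 ->
  `|lan_error h x| <= rho ->
  `|expR (dotv h (T x)) * cw_density beta th x - q h * lr h x| <= q h * (rho * expR 1) * lr h x.
Proof.
move=> n0 r1; rewrite /lan_error /log_lr -/(lr h x).
have p0 := cw_density_gt0 n0 b0 th x; have ph := cw_density_gt0 n0 b0 (th + (Num.sqrt n%:R)^-1 *: h) x.
rewrite -/(lr h x) in ph; rewrite /q; move: (dotv h _) (qform h _) => s t.
set r := ln _ - _ => rr.
have -> : expR s * cw_density beta th x = expR (t / 2) * lr h x * expR (- r).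
  have e : expR (ln (lr h x / cw_density beta th x)) = lr h x / cw_density beta th x.
    by apply: lnK; rewrite posrE; exact: (divr_gt0 ph p0).
  rewrite mulrAC -expRD; have -> : t / 2 + - r = s - ln (lr h x / cw_density beta th x) by rewrite /r; field.
  rewrite expRD expRN e invf_div -mulrA; congr (_ * _).
  by rewrite divfK// lt0r_neq0.
have -> : expR (t / 2) * lr h x * expR (- r) - expR (t / 2) * lr h x = expR (t / 2) * lr h x * (expR (- r) - 1) by ring.
have hr : `|expR (- r) - 1| <= rho * expR 1.
  apply: le_trans (expR_taylor1 _) _; rewrite normrN; apply: ler_pM; rewrite ?expR_ge0//.
  by rewrite ler_expR; exact: le_trans r1.
have y0 : 0 <= expR (t / 2) * lr h x by apply: mulr_ge0; [exact: expR_ge0|exact: ltW].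
rewrite normrM (ger0_norm y0); apply: le_trans (ler_wpM2l y0 hr) _.
by rewrite le_eqVlt; apply/orP; left; apply/eqP; move: (expR _) (expR _) (lr h x) => *; ring.
Qed.

Lemma lr_ge0 h n (x : sample R n d) : 0 <= lr h x.
Proof. exact: cw_density_ge0. Qed.

(** On the good event the exponential sum times the density is close to a combination of shifted
    densities, whose total integral is [Lam Ib l]. Off it, [f <= C] is used and the shifted
    densities are controlled by contiguity. *)
Lemma expect_le_Lam (f : 'rV[R]_d -> R) (C e : R) (l : seq (R * 'rV[R]_d)) :
  (forall y, `|f y| <= C) -> (forall y, f y <= expsum l y) -> 0 < e ->
  exists n1, forall n, (n1 <= n)%N ->
    cw_expect beta th (fun x : sample R n d => f (T x)) <= Lam Ib l + e.
Proof.
move=> fC fl e0; have C0 : 0 <= C by apply: le_trans (fC 0).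
pose A1 := \sum_(p <- l) `|p.1| * q p.2.
pose A2 := \sum_(p <- l) `|p.1| * q p.2 * expR (sqnorm p.2).
have q0 h : 0 <= q h by exact: expR_ge0.
have A10 : 0 <= A1 by apply: sumr_ge0 => p _; rewrite mulr_ge0.
have A20 : 0 <= A2 by apply: sumr_ge0 => p _; rewrite !mulr_ge0 ?expR_ge0.
have e4 : 0 < e / 4 by rewrite divr_gt0.
(* The free parameter of [contiguity_bound]. It is fixed before [K], because its inverse enters
   [kap]. *)
pose eta := e / 4 / (A2 + 1); have eta0 : 0 < eta by rewrite divr_gt0// ltr_wpDl.
have etaA : eta * A2 <= e / 4.
  by rewrite /eta mulrAC ler_pdivrMr ?ltr_wpDl//; apply: ler_wpM2l; [exact: ltW|rewrite lerDl].
clearbody eta.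
pose rho := Num.min 1 (e / 4 / (expR 1 * A1 + 1)).
have D0 : 0 < expR 1 * A1 + 1 by rewrite ltr_wpDl// mulr_ge0// expR_ge0.
have rho0 : 0 < rho by rewrite lt_min ltr01 divr_gt0.
have rho1 : rho <= 1 by rewrite ge_min lexx.
have rhoA : rho * expR 1 * A1 <= e / 4.
  have : rho * (expR 1 * A1 + 1) <= e / 4 by rewrite -ler_pdivlMr// ge_min lexx orbT.
  by rewrite mulrDr mulr1 mulrA => h; apply: le_trans h; rewrite lerDl ltW.
clearbody rho.
have [N exN] := expansion b1 m0 mE th0.
have [CB CB0 bw] := bad_weight_int th b1 m0 mE N.
(* Total coefficient of the bad weight in the dominating function: [C] from the bound on [f], the
   rest from contiguity. [K] is then chosen so that this contributes at most [e / 4]. *)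
pose kap := C + A1 / (4 * eta).
have kap0 : 0 <= kap by rewrite addr_ge0// divr_ge0// mulr_ge0// ltW.
pose K := 1 + 4 * (kap * CB) / e.
have K1 : 1 <= K by rewrite lerDl divr_ge0 ?(ltW e0)// !mulr_ge0.
have K0 : 0 < K by lra.
have kapK : kap * (CB / K ^+ 2) <= e / 4.
  rewrite mulrA ler_pdivrMr ?exprn_gt0//.
  have h1 : 4 * (kap * CB) <= e * K.
    rewrite /K mulrDr mulr1 [e * (_ / e)]mulrC divfK ?lt0r_neq0//; move: e0; move: (kap * CB) => *; lra.
  have h2 : e * K <= e * K ^+ 2 by rewrite ler_pM2l// expr2 ler_peMl// ltW.
  by move: (le_trans h1 h2); move: (kap * CB) (K ^+ 2) => *; lra.
clearbody K.
have [B exB] := exN _ (ltW K0).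
have ev : exists n1, forall n, (n1 <= n)%N -> forall p, p \in l -> (0 < n)%N /\
    forall x : sample R n d, good_up_to_sign beta m th N K x -> `|lan_error p.2 x| <= rho.
  apply: eventually_seq => p; have [Cp [n1 hn1]] := exB p.2.
  have [n2 hn2] := eventually_small (normr_ge0 Cp) rho0.
  exists (maxn n1 n2) => n; rewrite geq_max => /andP[/hn1[n0 {}hn1] /hn2[_ {}hn2]].
  split=> // x gx; have [_ h] := hn1 x _ (mU x) gx.
  by apply: le_trans h _; apply: le_trans hn2; rewrite ler_wpM2r ?invr_ge0 ?sqrtr_ge0// ler_norm.
have [n1 {}ev] := ev; exists (maxn n1 1) => n; rewrite geq_max => /andP[/ev {}ev n0].
pose BB : sample R n d -> R := @bad_weight R d beta m th N K n.
have [cBB iBB JBB] := bw K n K0 n0; rewrite -/BB in cBB iBB JBB.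
have BB0 x : 0 <= BB x by exact: bad_weight_ge0.
(* [a] majorises on the good event, with relative error [rho * expR 1]. The nonnegative [b] and [c],
   taken from [contiguity_bound], keep the sum nonnegative elsewhere, where negative coefficients
   [p.1] could spoil it. *)
pose a (p : R * 'rV[R]_d) := p.1 * q p.2 + `|p.1| * q p.2 * (rho * expR 1).
pose b (p : R * 'rV[R]_d) := `|p.1| * q p.2 * (eta * expR (sqnorm p.2)).
pose c (p : R * 'rV[R]_d) := `|p.1| * q p.2 / (4 * eta).
pose G (x : sample R n d) := \sum_(p <- l) (a p * lr p.2 x + b p * lr (2 *: p.2) x + c p * BB x) + C * BB x.
have m_lr h : cmeas (lr h (n := n)) by exact: cmeas_cw_density.
have i_lr h : fint (lr h (n := n)) by exact: fint_cw_density.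
have mZ (k : R) (F : sample R n d -> R) : cmeas F -> cmeas (fun x => k * F x).
  by move=> mF; apply: cmeasM => //; exact: cmeas_cst.
have lin p := linear3 (a p) (b p) (c p) (m_lr p.2) (i_lr p.2) (m_lr (2 *: p.2)) (i_lr (2 *: p.2)) cBB iBB.
have m_t p : cmeas (fun x => a p * lr p.2 x + b p * lr (2 *: p.2) x + c p * BB x) by case: (lin p).
have i_t p : fint (fun x => a p * lr p.2 x + b p * lr (2 *: p.2) x + c p * BB x) by case: (lin p).
have m_S : cmeas (fun x => \sum_(p <- l) (a p * lr p.2 x + b p * lr (2 *: p.2) x + c p * BB x)) by exact: cmeas_sum.
have i_S : fint (fun x => \sum_(p <- l) (a p * lr p.2 x + b p * lr (2 *: p.2) x + c p * BB x)) by exact: fint_sum.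
have iG : fint G by apply: fintD => //; [exact: mZ|exact: fintZ].
have J_lr h : intF_real (lr h (n := n)) = 1 by exact: intF_real_cw_density.
have J_t p : intF_real (fun x => a p * lr p.2 x + b p * lr (2 *: p.2) x + c p * BB x) = a p + b p + c p * intF_real BB.
  by have [_ _ ->] := lin p; rewrite (J_lr p.2) (J_lr (2 *: p.2)) (mulr1 (a p)) (mulr1 (b p)).
have JG : intF_real G = \sum_(p <- l) (a p + b p + c p * intF_real BB) + C * intF_real BB.
  rewrite intF_realD//; [|exact: mZ|exact: fintZ].
  by rewrite intF_realZ// intF_real_sum//; congr (_ + _); apply: eq_bigr => p _.
have fG x : f (T x) * cw_density beta th x <= G x.
  have p0 := cw_density_ge0 beta th x.
  have b_ge0 p : 0 <= b p by rewrite /b !mulr_ge0 ?expR_ge0 ?(ltW eta0).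
  have c_ge0 p : 0 <= c p by rewrite /c divr_ge0 ?mulr_ge0 ?(ltW eta0).
  have [gx|bx] := pselect (good_up_to_sign beta m th N K x).
    apply: (@le_trans _ _ (\sum_(p <- l) (a p * lr p.2 x))).
      apply: le_trans (ler_wpM2r p0 (fl _)) _; rewrite /expsum mulr_suml; rewrite big_seq [leRHS]big_seq.
      apply: ler_sum => p pl; have [_ /(_ x gx) h] := ev p pl.
      have := exp_score_close n0 rho1 h; move: (ler_norm p.1) (normr_ge0 p.1) => h1 h2 h3.
      have h4 := ler_wpM2l h2 h3; rewrite -normrM in h4.
      rewrite -(mulrA p.1 (expR _)); have := le_trans (ler_norm _) h4; rewrite /a; move: (expR (dotv _ _) * _) (lr p.2 x) (q p.2) (rho * expR 1) h4.
      by move=> *; lra.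
    rewrite /G -[leLHS]addr0; apply: lerD; last by rewrite mulr_ge0.
    apply: ler_sum => p _; by rewrite -(addrA (a p * _)) lerDl; apply: addr_ge0; apply: mulr_ge0 => //; exact: lr_ge0.
  have pB := cw_density_le_bad_weight n0 K0 bx; rewrite -/(BB x) in pB.
  (* Here the exponential sum is not compared with the score at all: [C * BB x] covers [f], and each
     summand of [G] is nonnegative. *)
  apply: (@le_trans _ _ (0 + C * BB x)).
    rewrite add0r; apply: le_trans (_ : C * cw_density beta th x <= _); last exact: ler_wpM2l.
    by apply: ler_wpM2r => //; apply: le_trans (ler_norm _) (fC _).
  rewrite /G lerD2r; apply: sumr_ge0 => p _.
  have hc := contiguity_bound beta th p.2 x n0 eta0; rewrite -/(lr p.2 x) -/(lr (2 *: p.2) x) in hc.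
  have h5 : lr p.2 x <= eta * expR (sqnorm p.2) * lr (2 *: p.2) x + (4 * eta)^-1 * BB x.
    apply: le_trans hc _; rewrite lerD2l; apply: ler_wpM2l => //.
    by rewrite invr_ge0 mulr_ge0// ltW.
  have w0 : 0 <= `|p.1| * q p.2 by rewrite mulr_ge0.
  have h6 := ler_wpM2l w0 h5.
  have h7 : 0 <= (p.1 + `|p.1|) * q p.2 * lr p.2 x.
    by apply: mulr_ge0; [apply: mulr_ge0 => //; exact: add_norm_ge0|exact: lr_ge0].
  have h8 : 0 <= `|p.1| * q p.2 * (rho * expR 1) * lr p.2 x.
    apply: mulr_ge0; [apply: mulr_ge0 => //|exact: lr_ge0].
    by apply: mulr_ge0; [exact: ltW|exact: expR_ge0].
  exact: (bad_term_ge0 h6 h7 h8).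
have if0 : fint (fun x : sample R n d => f (T x) * cw_density beta th x).
  apply: (@fint_le _ _ _ (fun x => C * cw_density beta th x)).
    by move=> x; rewrite !normrM; apply: ler_wpM2r => //; rewrite (ger0_norm C0).
  by apply: fintZ; [exact: cmeas_cw_density|exact: fint_cw_density].
apply: le_trans (intF_real_le fG if0 iG) _; rewrite JG.
have -> : \sum_(p <- l) (a p + b p + c p * intF_real BB) + C * intF_real BB =
   Lam Ib l + rho * expR 1 * A1 + eta * A2 + kap * intF_real BB.
  have -> : \sum_(p <- l) (a p + b p + c p * intF_real BB) =
      Lam Ib l + rho * expR 1 * A1 + eta * A2 + A1 / (4 * eta) * intF_real BB.
    rewrite /Lam /A1 /A2 !mulr_suml !mulr_sumr -!big_split /=.
    by apply: eq_bigr => p _; rewrite /a /b /c -/(q p.2); move: (q _) (`|_|) => *; ring.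
  by rewrite /kap; ring.
have := ler_wpM2l kap0 JBB; move: rhoA etaA kapK; move: (Lam _ _) (rho * _ * _) (eta * A2) (kap * _) (kap * _) => *; lra.
Qed.

End UpperBound.

(** * Gaussian limit and the theorem *)

Section GaussianExpectation.
Variables (R : realType) (d : nat) (S : 'M[R]_d).
Implicit Types (l : seq (R * 'rV[R]_d)) (f : 'rV[R]_d -> R) (h : 'rV[R]_d).

Lemma nice_expsum l : nice (expsum l).
Proof. by apply: nice_sum => p; apply: niceZ; exact: nice_exp_dotv. Qed.

Lemma dotv_mulmx h y : dotv h (y *m S) = dotv (h *m S^T) y.
Proof.
rewrite /dotv; under eq_bigr do rewrite mxE mulr_sumr.
rewrite exchange_big; apply: eq_bigr => k _; rewrite mxE mulr_suml.
by apply: eq_bigr => j _; rewrite mxE mulrCA mulrC.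
Qed.

Lemma sqnorm_mulmx h : sqnorm (h *m S^T) = qform h (S^T *m S).
Proof.
rewrite /sqnorm -dotv_mulmx /qform /dotv mulmxA mxE.
by apply: eq_bigr => j _; rewrite [h^T _ _]mxE mulrC.
Qed.

Let push l : seq (R * 'rV[R]_d) := [seq (p.1, p.2 *m S^T) | p <- l].

Lemma gauss_expect_expsum l : gauss_expect S (expsum l) = Lam (S^T *m S) l.
Proof.
have gS (s : seq (R * 'rV[R]_d)) : gE 0 (expsum s) = \sum_(p <- s) p.1 * expR (sqnorm p.2 / 2).
  elim: s => [|p s IH].
    have -> : expsum ([::] : seq (R * 'rV[R]_d)) = (fun=> 0) by apply/funext => y; rewrite /expsum big_nil.
    by rewrite gE_cst big_nil.
  have -> : expsum (p :: s) = (fun y => p.1 * (expR (dotv p.2 y) * 1) + expsum s y).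
    by apply/funext => y; rewrite /expsum big_cons mulr1.
  have n1 := nice_cst d (1 : R); have n2 := niceM (nice_exp_dotv p.2) n1.
  rewrite gED ?gEZ ?gE_tilt//; [|exact: niceZ|exact: nice_expsum].
  rewrite gE_cst mulr1 IH big_cons.
  have -> : dotv p.2 (0 : 'rV[R]_d) = 0 by exact: dotvr0.
  by rewrite add0r.
have -> : gauss_expect S (expsum l) = gE 0 (expsum (push l)).
  congr intF_real; apply/funext => y; rewrite /gpdf subr0; congr (_ * _).
  by rewrite /expsum big_map; apply: eq_bigr => p _ /=; rewrite dotv_mulmx.
by rewrite gS big_map; apply: eq_bigr => p _ /=; rewrite sqnorm_mulmx.
Qed.

(** [Q + W] majorises [f] and [Q - W] minorises it, and their Gaussian integrals differ by
    [2 * Lam W <= e]. *)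
Lemma gauss_expect_approx f C e : continuous f -> (forall y, `|f y| <= C) -> 0 < e ->
  exists l, (forall y, f y <= expsum l y) /\ Lam (S^T *m S) l <= gauss_expect S f + e.
Proof.
move=> cf fC e0; have C0 : 0 <= C by apply: le_trans (fC 0).
have e2 : 0 < e / 2 by rewrite divr_gt0.
have [Q [W [fQ LW]]] := approx_bounded (S^T *m S) cf fC e2.
exists (Q ++ W); split => [y|].
  by have := fQ y; rewrite expsum_cat ler_norml; move: (f y) (expsum _ _) (expsum _ _) => *; lra.
have pdf0 (y : 'I_d -> R) : 0 <= std_gauss_pdf (rowv y) by exact: std_gauss_pdf_ge0.
have fp : fint (fun y : 'I_d -> R => std_gauss_pdf (rowv y)).
  by apply: fint_le (fint_gpdf (0 : 'rV[R]_d)) => y; rewrite /gpdf subr0.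
have mp : cmeas (fun y : 'I_d -> R => std_gauss_pdf (rowv y)).
  have -> : (fun y : 'I_d -> R => std_gauss_pdf (rowv y)) = gpdf 0.
    by apply/funext => y; rewrite /gpdf subr0.
  exact: cmeas_gpdf.
have if0 : fint (fun y : 'I_d -> R => f (rowv y *m S) * std_gauss_pdf (rowv y)).
  apply: (@fint_le _ _ _ (fun y => C * std_gauss_pdf (rowv y))); last exact: fintZ.
  by move=> y; rewrite !normrM (ger0_norm C0); apply: ler_wpM2r.
pose l := Q ++ expscale (-1) W.
have il : fint (fun y : 'I_d -> R => expsum l (rowv y *m S) * std_gauss_pdf (rowv y)).
  apply: fint_le (nice_fint (0 : 'rV[R]_d) (nice_expsum (push l))) => y.
  rewrite /gpdf subr0; have -> : expsum (push l) (rowv y) = expsum l (rowv y *m S); last by [].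
  by rewrite /expsum big_map; apply: eq_bigr => p _ /=; rewrite dotv_mulmx.
have : Lam (S^T *m S) l <= gauss_expect S f.
  rewrite -gauss_expect_expsum; apply: intF_real_le => // y.
  apply: ler_wpM2r => //; rewrite /l expsum_cat expsum_scale.
  have := fQ (rowv y *m S); rewrite ler_norml.
  by move: (f _) (expsum _ _) (expsum _ _) => *; lra.
by rewrite /l !Lam_cat Lam_scale; move: LW; move: (Lam _ Q) (Lam _ W) => *; lra.
Qed.

End GaussianExpectation.

(** * Square roots of positive semidefinite matrices *)

Section SquareRoot.
Variable R : realType.

Lemma qform_block n (a : R) (b : 'rV[R]_n) (C : 'M[R]_n) (t : R) (v : 'rV[R]_n) :
  qform (row_mx t%:M v : 'rV[R]_(1 + n)) (block_mx a%:M b b^T C) =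
  a * t ^+ 2 + 2 * t * dotv b v + qform v C.
Proof.
have e1 : (v *m b^T) 0 0 = dotv b v.
  by rewrite mxE; apply: eq_bigr => j _; rewrite mxE mulrC.
have e2 : (b *m v^T) 0 0 = dotv b v by rewrite mxE; apply: eq_bigr => j _; rewrite mxE.
rewrite /qform mul_row_block tr_row_mx mul_row_col tr_scalar_mx.
rewrite !mul_scalar_mx mul_mx_scalar mulmxDl -scalemxAl.
move: (v *m C *m v^T) (v *m b^T) (b *m v^T) e1 e2 => M1 M2 M3 e1 e2.
by rewrite !mxE e1 e2 !eqxx mulr1n; ring.
Qed.

(* Cholesky elimination; a zero pivot of a semidefinite matrix has a zero row. *)
Lemma psd_sqrt n (A : 'M[R]_n) : A^T = A -> (forall h : 'rV[R]_n, 0 <= qform h A) ->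
  exists S : 'M[R]_n, S^T *m S = A.
Proof.
elim: n A => [|n IH] A sA pA; first by exists 0; apply/matrixP => -[].
pose A' : 'M[R]_(1 + n) := A; pose a := A' 0 0.
pose b : 'rV[R]_n := ursubmx A'; pose C := drsubmx A'.
have sA' : A'^T = A' by exact: sA.
have AE : A' = block_mx a%:M b b^T C.
  rewrite -[LHS]submxK; congr block_mx.
    by rewrite [LHS]mx11_scalar; congr (_%:M); rewrite !mxE; congr (A' _ _); apply/val_inj.
  by rewrite /b trmx_ursub sA'.
have qE t v : 0 <= a * t ^+ 2 + 2 * t * dotv b v + qform v C.
  by rewrite -qform_block -AE; exact: pA.
have sC : C^T = C by rewrite /C trmx_drsub sA'.
clearbody b C.
have z0 : dotv b 0 = 0 by rewrite -(scale0r 0) dotvZr mul0r.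
have q0 : qform (0 : 'rV[R]_n) C = 0 by rewrite /qform !mul0mx mxE.
have a0 : 0 <= a by have := qE 1 0; rewrite z0 q0; lra.
have b0 : a = 0 -> b = 0.
  move=> a00; apply/eqP; apply: contraT => bn.
  have bb : 0 < dotv b b.
    rewrite lt_neqAle; apply/andP; split; last by apply: sumr_ge0 => j _; rewrite -expr2 sqr_ge0.
    apply: contra bn; rewrite eq_sym psumr_eq0; last by move=> j _; rewrite -expr2 sqr_ge0.
    move=> /allP bz; apply/eqP/rowP => j; rewrite [RHS]mxE.
    by have := bz j (mem_index_enum _); rewrite /= mulf_eq0 orbb => /eqP.
  (* For a zero pivot the form is affine in [t]; this [t] would give it the value -1 if [b] were
     nonzero. *)
  have := qE (- (qform b C + 1) / (2 * dotv b b)) b; rewrite a00 mul0r add0r.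
  have -> : 2 * (- (qform b C + 1) / (2 * dotv b b)) * dotv b b = - (qform b C + 1).
    by field; rewrite lt0r_neq0.
  by rewrite opprD addrAC addNr add0r oppr_ge0 ler10.
(* Schur complement. For [a = 0] the convention [0^-1 = 0] makes it [C], which is correct since then
   [b = 0]. *)
pose C' := C - a^-1 *: (b^T *m b).
have sC' : C'^T = C' by rewrite /C' linearB linearZ /= trmx_mul trmxK sC.
have pC' (v : 'rV[R]_n) : 0 <= qform v C'.
  have -> : qform v C' = qform v C - a^-1 * dotv b v ^+ 2.
    rewrite /qform /C' mulmxBr mulmxBl -scalemxAr -scalemxAl.
    have -> : v *m (b^T *m b) *m v^T = (v *m b^T) *m (b *m v^T) by rewrite !mulmxA.
    have e1 : (v *m b^T) 0 0 = dotv b v.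
      by rewrite mxE; apply: eq_bigr => j _; rewrite mxE mulrC.
    have e2 : (b *m v^T) 0 0 = dotv b v by rewrite mxE; apply: eq_bigr => j _; rewrite mxE.
    move: (v *m C *m v^T) (v *m b^T) (b *m v^T) e1 e2 => M1 M2 M3 e1 e2.
    by rewrite !mxE big_ord1 e1 e2 expr2.
  have [az|an] := eqVneq a 0.
    by rewrite az invr0 mul0r subr0; have := qE 0 v; rewrite expr0n mulr0 add0r mulr0 mul0r add0r.
  (* The minimiser in [t], at which the form takes the value of the Schur complement. *)
  have := qE (- dotv b v / a) v.
  have -> : a * (- dotv b v / a) ^+ 2 + 2 * (- dotv b v / a) * dotv b v + qform v C =
     qform v C - a^-1 * dotv b v ^+ 2 by field.
  by [].
have [S' hS'] := IH C' sC' pC'.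
pose r := Num.sqrt a; have rr : r * r = a by rewrite -expr2 sqr_sqrtr.
pose B := block_mx r%:M (r^-1 *: b) 0 S' : 'M[R]_(1 + n).
suff H : B^T *m B = A' :> 'M[R]_(1 + n) by exists B.
rewrite AE /B tr_block_mx mulmx_block !tr_scalar_mx !trmx0 !mul0mx !addr0 !mulmx0 !addr0.
have rb : (r * r^-1) *: b = b.
  have [az|an] := eqVneq a 0; first by rewrite b0// scaler0.
  by rewrite divff ?scale1r// sqrtr_eq0 -ltNge lt_neqAle eq_sym an.
congr block_mx.
- by rewrite mul_scalar_mx scale_scalar_mx rr.
- by rewrite mul_scalar_mx scalerA rb.
- by rewrite mul_mx_scalar linearZ /= scalerA -[RHS](congr1 trmx rb) linearZ.
- by rewrite hS' /C' [(r^-1 *: b)^T]linearZ /= -scalemxAl -scalemxAr scalerA -invfM rr addrC subrK.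
Qed.

End SquareRoot.

Section Main.
Variables (R : realType) (d : nat) (beta m : R) (th : 'rV[R]_d).
Hypotheses (b1 : 1 < beta) (m0 : 0 < m) (mE : m = tanhR (beta * m)).
Hypothesis th0 : 0 < sqnorm th.
Variable U : forall n, sample R n d -> R.
Hypothesis mU : forall n (x : sample R n d), minimizer beta (field th x) (U x).
Let b0 : 0 < beta. Proof. exact: lt_trans b1. Qed.
Let Ib := Ibeta beta m th.

Lemma Ibeta_sym : Ib^T = Ib.
Proof.
rewrite /Ib /Ibeta linearB linearZ /= trmx_mul trmxK; congr (_ - _).
apply/matrixP => j k; rewrite !mxE eq_sym; congr (_ - mix_expect _ _ _).
by apply/funext => X; rewrite [X 0 k * _]mulrC.
Qed.

(** Obtained from the limit rather than by algebra: [cosh (h . T) >= 1], while [expect_le_Lam]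
    applied to the constant 1 bounds 1 by the limiting moment [exp (h I h / 2)]. *)
Lemma Ibeta_psd h : 0 <= qform h Ib.
Proof.
have e : 1 <= expR (qform h Ib / 2).
  apply/ler_addgt0Pr => e e0.
  pose l := [:: (2^-1, h); (2^-1, - h)] : seq (R * 'rV[R]_d).
  have l1 y : 1 <= expsum l y.
    rewrite /expsum !big_cons big_nil /= addr0 dotvNl.
    by have := expR_ge1Dx (dotv h y); have := expR_ge1Dx (- dotv h y); lra.
  have f1 (y : 'rV[R]_d) : `|1 : R| <= 1 by rewrite normr1.
  have [n1 hn1] := expect_le_Lam b1 m0 mE th0 mU f1 l1 e0.
  have := hn1 n1 (leqnn _); rewrite /cw_expect.
  have -> : (fun x : sample R n1 d => 1 * cw_density beta th x) = cw_density beta th.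
    by apply/funext => x; rewrite mul1r.
  rewrite intF_real_cw_density; have -> // : Lam (Ibeta beta m th) l = expR (qform h Ib / 2).
  by rewrite /Lam !big_cons big_nil /= addr0 qformN -/Ib; move: (expR _) => E; field.
by move: e; rewrite -[X in X <= _]expR0 ler_expR pmulr_lge0.
Qed.

Lemma bad_prob N (eps : R) : 0 < eps -> exists2 K, 0 < K & forall n, (0 < n)%N ->
  forall A : sample R n d -> Prop, (forall x, A x -> ~ good_up_to_sign beta m th N K x) ->
  0 <= cw_prob beta th A <= eps.
Proof.
move=> e0; have [C C0 hC] := bad_weight_int th b1 m0 mE N.
pose K := 1 + C / eps; have K1 : 1 <= K by rewrite lerDl divr_ge0// ltW.
have K0 : 0 < K by exact: lt_le_trans K1.
exists K => // n n0 A hA; have [_ iB JB] := hC K n K0 n0.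
have /andP[-> /= h] := cw_prob_le (@bad_weight_ge0 R d beta m th N K n)
  (fun x Ax => cw_density_le_bad_weight n0 K0 (hA x Ax)) iB.
apply: le_trans h _; apply: le_trans JB _; rewrite ler_pdivrMr ?exprn_gt0//.
have h1 : C <= eps * K by rewrite /K mulrDr mulr1 mulrCA mulfV ?lt0r_neq0// mulr1 lerDr ltW.
by apply: le_trans h1 _; rewrite ler_pM2l// expr2 ler_peMl// ltW.
Qed.

Lemma posterior_mean_error : bounded_in_prob beta th (fun n x =>
  \sum_(i < n) post_mean beta th x i *: obs x i - tanh_score beta th x (U x)).
Proof.
move=> eps e0; have [N exN] := expansion b1 m0 mE th0.
have [K K0 bad] := bad_prob N e0; have [B exB] := exN _ (ltW K0).
(* [B] does not depend on the shift, so the shift 0 will do. *)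
have [C [n1 hn1]] := exB 0; exists (Num.sqrt (d%:R * `|B| ^+ 2)), n1 => n nn.
have [n0 {}hn1] := hn1 n nn; set A := (X in cw_prob _ _ X).
suff hA x : A x -> ~ good_up_to_sign beta m th N K x by case/andP: (bad n n0 A hA).
rewrite /A ltNge => /negP ne gx; apply: ne.
have [hB _] := hn1 x _ (mU x) gx; rewrite /enorm ler_sqrt; last by rewrite mulr_ge0.
rewrite /sqnorm /dotv; set v := _ - _ in hB *.
apply: (@le_trans _ _ (\sum_(j < d) `|B| ^+ 2)); last by rewrite sumr_const card_ord -[leLHS]mulr_natl.
apply: ler_sum => j _; rewrite -expr2 -(real_normK (num_real (v 0 j))) lerXn2r ?nnegrE//.
exact: le_trans (hB j) (ler_norm _).
Qed.

Lemma lan_expansion h : vanishing_in_prob beta th (fun n x =>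
  log_lr beta (th + (Num.sqrt n%:R)^-1 *: h) th x
  - (dotv h (Delta_tilde beta th x (U x)) - 2^-1 * qform h (Ibeta beta m th))).
Proof.
move=> eps e0; apply/cvgrPdist_le => eta eta0; have [N exN] := expansion b1 m0 mE th0.
have [K K0 bad] := bad_prob N eta0; have [B exB] := exN _ (ltW K0).
have [C [n1 hn1]] := exB h; have [n2 hn2] := eventually_small (normr_ge0 C) e0.
near=> n; have n1n : (n1 <= n)%N by near: n; exact: nbhs_infty_ge.
have n2n : (n2 <= n)%N by near: n; exact: nbhs_infty_ge.
have [n0 {}hn1] := hn1 n n1n; have [_ {}hn2] := hn2 n n2n.
rewrite sub0r normrN.
have /andP[p0 p1] : 0 <= cw_prob beta th (fun x : sample R n d => eps < `|log_lr beta (th + (Num.sqrt n%:R)^-1 *: h) th x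
  - (dotv h (Delta_tilde beta th x (U x)) - 2^-1 * qform h (Ibeta beta m th))|) <= eta; last by rewrite ger0_norm.
apply: bad => // x; rewrite ltNge => /negP ne gx; apply: ne.
have [_ h1] := hn1 x _ (mU x) gx; apply: le_trans h1 _; apply: le_trans hn2.
by rewrite ler_wpM2r ?invr_ge0 ?sqrtr_ge0// ler_norm.
Unshelve. all: by end_near. Qed.

(** [expect_le_Lam] gives upper bounds only; applied to majorants of [f] and of [- f] it yields the
    limit. The factor [S] exists by [Ibeta_psd]. *)
Lemma score_clt : conv_dist_normal beta th (fun n x => Delta_tilde beta th x (U x)) (Ibeta beta m th).
Proof.
have [S hS] := psd_sqrt Ibeta_sym Ibeta_psd; exists S; split => // f cf [C fC].
have upper g : continuous g -> (forall y, `|g y| <= C) -> forall e, 0 < e ->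
    exists n1, forall n, (n1 <= n)%N ->
      cw_expect beta th (fun x : sample R n d => g (Delta_tilde beta th x (U x))) <= gauss_expect S g + e.
  move=> cg gC e e0; have e2 : 0 < e / 2 by rewrite divr_gt0.
  have [l [gl]] := gauss_expect_approx S cg gC e2; rewrite hS => Ll.
  have [n1 hn1] := expect_le_Lam b1 m0 mE th0 mU gC gl e2; exists n1 => n /hn1 h.
  by apply: le_trans h _; rewrite [in leRHS](splitr e) addrA lerD2r.
apply/cvgrPdist_le => e e0; have [n1 h1] := upper f cf fC e e0.
have cN : continuous (fun y : 'rV[R]_d => - f y).
  by move=> y; apply: (@continuous_comp _ _ _ f -%R y (cf y)); exact: opp_continuous.
have [y|n2 h2] := upper (fun y => - f y) cN _ e e0; first by rewrite normrN.
near=> n; have {}h1 := h1 n; have {}h2 := h2 n.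
have n1n : (n1 <= n)%N by near: n; exact: nbhs_infty_ge.
have n2n : (n2 <= n)%N by near: n; exact: nbhs_infty_ge.
have {}h1 := h1 n1n; have {}h2 := h2 n2n.
have eN : cw_expect beta th (fun x : sample R n d => - f (Delta_tilde beta th x (U x))) =
   - cw_expect beta th (fun x : sample R n d => f (Delta_tilde beta th x (U x))).
  by rewrite /cw_expect -intF_realN; congr intF_real; apply/funext => x; rewrite mulNr.
have gN : gauss_expect S (fun y => - f y) = - gauss_expect S f.
  by rewrite /gauss_expect -intF_realN; congr intF_real; apply/funext => y; rewrite mulNr.
rewrite eN gN in h2; rewrite ler_norml.
by move: (cw_expect _ _ _) (gauss_expect _ _) h1 h2 => *; apply/andP; split; lra.
Unshelve. all: by end_near. Qed.

End Main.

Theorem mainTheorem9 (R : realType) (d : nat) (beta m : R) (th0 : 'rV[R]_d)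
  (U : forall n, sample R n d -> R) :
  1 < beta -> Theta1 th0 -> 0 < m -> m = tanhR (beta * m) ->
  (forall n (x : sample R n d), `|U n x| <= 1 /\
     forall u : R, `|u| <= 1 -> cw_objective beta th0 x (U n x) <= cw_objective beta th0 x u) ->
  [/\ bounded_in_prob beta th0 (fun n x =>
        \sum_(i < n) post_mean beta th0 x i *: obs x i - tanh_score beta th0 x (U n x)),
      (forall h : 'rV[R]_d,
        vanishing_in_prob beta th0 (fun n x =>
          log_lr beta (th0 + (Num.sqrt n%:R)^-1 *: h) th0 x
          - (dotv h (Delta_tilde beta th0 x (U n x))
             - 2^-1 * qform h (Ibeta beta m th0)))),
      conv_dist_normal beta th0 (fun n x => Delta_tilde beta th0 x (U n x))
        (Ibeta beta m th0)
    & LAN_at beta th0 (Ibeta beta m th0)].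
Proof.
move=> b1 [j [thj _]] m0 mE hU.
have th1 : 0 < sqnorm th0.
  rewrite /sqnorm /dotv (bigD1 j)//= ltr_wpDr ?mulr_gt0//.
  by apply: sumr_ge0 => k _; rewrite -expr2 sqr_ge0.
have mU n (x : sample R n d) : minimizer beta (field th0 x) (U n x) by exact: hU.
have lan := lan_expansion b1 m0 mE th1 mU.
have clt := score_clt b1 m0 mE th1 mU.
have pme := posterior_mean_error b1 m0 mE th1 mU.
split=> //.
by exists (fun n x => Delta_tilde beta th0 x (U n x)).
Qed.
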